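(* Let $N>0$ and let $$0<\tau\leq \tau_0(N):=\frac{1}{N+1+\sqrt{(N+1)^2+4}}.$$ Then problem $(P)_\tau$ admits a radially symmetric solution with flux pair $(\beta_1,\beta_2)$ if and only if $$\beta_1^2+\beta_2^2-2\tau\beta_1\beta_2-4(N+1)\beta_1-4\beta_2=0,\qquad \beta_1>4(N+1),\qquad \beta_2>4 .$$
   Context: For $N>0$, $\tau>0$ and real numbers $\beta_1,\beta_2$, problem $(P)_\tau$ asks for functions $v_1,v_2\in L^1_{loc}(\mathbb{R}^2)$ with $|x|^{2N}e^{v_1}\in L^1(\mathbb{R}^2)$ and $e^{v_2}\in L^1(\mathbb{R}^2)$ such that, in the sense of distributions on $\mathbb{R}^2$, $$-\Delta v_1=|x|^{2N}e^{v_1}-\tau e^{v_2},\qquad -\Delta v_2=e^{v_2}-\tau|x|^{2N}e^{v_1},$$ and $$\beta_1=\frac{1}{2\pi}\int_{\mathbb{R}^2}|x|^{2N}e^{v_1}\,dx,\qquad \beta_2=\frac{1}{2\pi}\int_{\mathbb{R}^2}e^{v_2}\,dx .$$ The pair $(\beta_1,\beta_2)$ is called the flux pair of the solution. A radial solution is a solution with $v_1,v_2$ radially symmetric about the origin. *)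

(* Defs.v *)
From HB Require Import structures.
From mathcomp Require Import all_boot all_order all_algebra.
From mathcomp Require Import all_classical all_reals all_analysis.
Set Implicit Arguments. Unset Strict Implicit. Unset Printing Implicit Defensive.
Import Order.TTheory GRing.Theory Num.Theory.
Import numFieldNormedType.Exports.
Local Open Scope classical_set_scope.
Local Open Scope ring_scope.

Section Defs.
Variable R : realType.

Definition leb2 := (@lebesgue_measure R \x @lebesgue_measure R)%E.

Definition sqnorm (x : R * R) : R := x.1 ^+ 2 + x.2 ^+ 2.

Definition weight (N : R) (x : R * R) : R := powR (sqnorm x) N.

Definition e1 : R * R := (1, 0).
Definition e2 : R * R := (0, 1).

Fixpoint iter_pd (s : seq bool) (f : R * R -> R) : R * R -> R :=
  match s with
  | [::] => f
  | b :: s' => fun x => 'D_(if b then e1 else e2) (iter_pd s' f) x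
  end.

Definition smooth (f : R * R -> R) : Prop :=
  forall s : seq bool,
    continuous (iter_pd s f) /\
    (forall x, derivable (iter_pd s f) x e1 /\ derivable (iter_pd s f) x e2).

Definition test_fun (phi : R * R -> R) : Prop :=
  smooth phi /\ exists r : R, 0 < r /\ forall x, r <= sqnorm x -> phi x = 0.

Definition laplacian (f : R * R -> R) (x : R * R) : R :=
  iter_pd [:: true; true] f x + iter_pd [:: false; false] f x.

Definition L1 (f : R * R -> R) : Prop := leb2.-integrable setT (EFin \o f).

Definition L1loc (f : R * R -> R) : Prop :=
  forall r : R, 0 < r -> leb2.-integrable [set x | sqnorm x < r ^+ 2] (EFin \o f).

Definition dist_eq_mlap (v g : R * R -> R) : Prop :=
  forall phi, test_fun phi ->
    - Rintegral leb2 setT (fun x => v x * laplacian phi x) =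
      Rintegral leb2 setT (fun x => g x * phi x).

Definition solves_P (N tau : R) (v1 v2 : R * R -> R) (b1 b2 : R) : Prop :=
  L1loc v1 /\ L1loc v2 /\
  L1 (fun x => weight N x * expR (v1 x)) /\ L1 (fun x => expR (v2 x)) /\
  dist_eq_mlap v1 (fun x => weight N x * expR (v1 x) - tau * expR (v2 x)) /\
  dist_eq_mlap v2 (fun x => expR (v2 x) - tau * (weight N x * expR (v1 x))) /\
  b1 = (2 * pi)^-1 * Rintegral leb2 setT (fun x => weight N x * expR (v1 x)) /\
  b2 = (2 * pi)^-1 * Rintegral leb2 setT (fun x => expR (v2 x)).

Definition radial (v : R * R -> R) : Prop :=
  forall x y, sqnorm x = sqnorm y -> v x = v y.

Definition tau0 (N : R) : R := (N + 1 + Num.sqrt ((N + 1) ^+ 2 + 4))^-1.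

End Defs.

(* Main.v *)
Require Import Defs.
From HB Require Import structures.
From mathcomp Require Import all_boot all_order all_algebra.
From mathcomp Require Import all_classical all_reals all_analysis.
From mathcomp Require Import measurable_realfun ring lra.
Set Implicit Arguments. Unset Strict Implicit. Unset Printing Implicit Defensive.
Import Order.TTheory GRing.Theory Num.Theory.
Import numFieldNormedType.Exports.
Local Open Scope classical_set_scope.
Local Open Scope ring_scope.

(** With s = |x|^2 and t = ln |x|, the fluxes x(t), y(t) of a radial solution
    through the disc of radius e^t satisfy the Toda system x' = e^u, y' = e^v,
    u' = p - x + tau y, v' = q - y + tau x, where p = 2 (N + 1) and q = 2, and they
    vanish at -oo. The quantity e^u + e^v - F(x, y), with
    F(x, y) = p x + q y - (x^2 + y^2 - 2 tau x y) / 2, is conserved, hence zero, so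
    the total fluxes lie on the conic F = 0; moreover e^u - p x + x^2 / 2 is
    increasing, which forces beta_1 > 2 p, and likewise beta_2 > 2 q.

    A distributional solution is classical up to a null set: testing against
    psi(|x|^2), where psi'' approximates the indicator of (0, g), gives an identity
    between moments of the profile which, differentiated in g, is the radial
    equation in integrated form.

    Conversely, Picard iteration yields a global radial solution for all initial
    values, whose flux through each disc depends continuously on them. For tau <= tau0 the
    part of the conic in the quadrant beta_1 > 2 p, beta_2 > 2 q is the graph of a
    decreasing function. If no solution on a suitable curve of initial values had
    fluxes (b1, b2), the sets {beta_1 > b1} and {beta_2 > b2} would split that curve
    into two disjoint nonempty open sets. *)

(** The arc of the conic in that quadrant ends at (2 p, 2 q + 4 tau p) and (2 p + 4 tau q, 2 q).
    These ends are limits of flux pairs: when one initial value is far below the other, the dominant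
    component first collects its full Liouville flux 2 p or 2 q almost undisturbed, and the other
    one, pushed up by the cross term, then overshoots towards the larger coordinate. The threshold
    tau0 is where dF/dy vanishes at (2 p + 4 tau q, 2 q): for q = 2 the inequality tau (2 p + 4 tau
    q) <= q reads 4 tau^2 + 2 (N + 1) tau <= 1. Beyond it the arc turns back near this end and is no
    longer a decreasing graph. Total fluxes are increasing limits of fluxes through discs, so their
    lower semicontinuity in the initial values comes for free. The connectedness argument is built
    on strict lower bounds because these define open sets without any uniform control at infinity.
    The variable s = |x|^2, rather than |x|, turns planar integrals of f(|x|^2) into pi times
    integrals in s, and smooth functions of s into smooth functions of x. *)

Section Calculus.
Variable R : realType.
Implicit Types (f g df dg : R -> R) (x y a b l : R).

Definition der f x (d : R) := is_derive x (1 : R) f d.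

Lemma der_cont f x d : der f x d -> {for x, continuous f}.
Proof. move=> [fx _]; exact/differentiable_continuous/derivable1_diffP. Qed.

Lemma derE f x d d' : der f x d -> d = d' -> der f x d'.
Proof. by move=> h <-. Qed.

Lemma derD f g x a b : der f x a -> der g x b -> der (fun y => f y + g y) x (a + b).
Proof. by move=> h1 h2; exact: is_deriveD. Qed.

Lemma derN f x a : der f x a -> der (fun y => - f y) x (- a).
Proof. by move=> h; exact: is_deriveN. Qed.

Lemma derB f g x a b : der f x a -> der g x b -> der (fun y => f y - g y) x (a - b).
Proof. by move=> h1 h2; apply: derD => //; exact: derN. Qed.

Lemma derM f g x a b : der f x a -> der g x b ->
  der (fun y => f y * g y) x (a * g x + f x * b).
Proof.
move=> h1 h2; have h := is_deriveM h1 h2; apply: (derE h).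
by rewrite /GRing.scale /= addrC mulrC (mulrC a).
Qed.

Lemma der_cst c x : der (fun=> c) x 0.
Proof. exact: is_derive_cst. Qed.

Lemma der_id x : der (fun y => y) x 1.
Proof. exact: is_derive_id. Qed.

Lemma derZ f x a c : der f x a -> der (fun y => c * f y) x (c * a).
Proof. by move=> h; apply: (derE (derM (der_cst c x) h)); rewrite mul0r add0r. Qed.

Lemma der_comp f g x a b : der f (g x) a -> der g x b -> der (fun y => f (g y)) x (a * b).
Proof. by move=> h1 h2; exact: (@is_derive1_comp R f g x a b). Qed.

Lemma der_exp f x a : der f x a -> der (fun y => expR (f y)) x (expR (f x) * a).
Proof. by move=> h; apply: (@der_comp expR) => //; exact: is_derive_expR. Qed.

Lemma der_ln f x a : 0 < f x -> der f x a -> der (fun y => ln (f y)) x (a / f x).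
Proof.
move=> p h; rewrite mulrC; apply: (@der_comp (@ln R)) => //; exact: is_derive1_ln.
Qed.

Lemma derV f x a : f x != 0 -> der f x a -> der (fun y => (f y)^-1) x (- a / f x ^+ 2).
Proof.
move=> p h; have := is_deriveV p h; move/derE; apply.
by rewrite /GRing.scale /= mulrC !mulrN mulNr.
Qed.

Lemma der_near f g x a : (\forall y \near x, f y = g y) -> der f x a -> der g x a.
Proof. exact: near_eq_is_derive. Qed.

Lemma der_sqr f x a : der f x a -> der (fun y => f y ^+ 2) x (2 * f x * a).
Proof.
move=> h; have := derM h h; move/derE => /(_ (2 * f x * a)).
by apply; ring.
Qed.

Lemma der_powR (n x : R) : 0 < x -> der (fun y => y `^ n) x (n * x `^ (n - 1)).
Proof. exact: is_derive1_powR. Qed.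

Lemma mvt f df a b : a < b -> (forall x, a <= x <= b -> der f x (df x)) ->
  exists2 c, a < c < b & f b - f a = df c * (b - a).
Proof.
move=> ab h; have [||c] := @MVT R f df a b ab.
- by move=> x; rewrite in_itv /= => /andP[h1 h2]; apply: h; rewrite !ltW.
- apply: derivable_within_continuous => x; rewrite in_itv /= => hx.
  by have [] := h x hx.
- by rewrite in_itv /=; exists c.
Qed.

Lemma der_le f df a b : a <= b -> (forall x, a <= x <= b -> der f x (df x)) ->
  (forall x, a <= x <= b -> 0 <= df x) -> f a <= f b.
Proof.
rewrite le_eqVlt => /predU1P[->//|ab] h p; rewrite -subr_ge0.
have [c /andP[h1 h2] ->] := mvt ab h.
by rewrite mulr_ge0 ?p ?subr_ge0 ?ltW.
Qed.

Lemma der_lt f df a b : a < b -> (forall x, a <= x <= b -> der f x (df x)) ->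
  (forall x, a <= x <= b -> 0 < df x) -> f a < f b.
Proof.
move=> ab h p; rewrite -subr_gt0.
have [c /andP[h1 h2] ->] := mvt ab h.
by rewrite mulr_gt0 ?p ?subr_gt0 // !ltW.
Qed.

Lemma der_le2 f df g dg a b : a <= b ->
  (forall x, a <= x <= b -> der f x (df x)) ->
  (forall x, a <= x <= b -> der g x (dg x)) ->
  (forall x, a <= x <= b -> df x <= dg x) -> f b - f a <= g b - g a.
Proof.
move=> ab hf hg h.
have := @der_le (fun x => g x - f x) (fun x => dg x - df x) a b ab.
have H : forall x, a <= x <= b -> der (fun x0 : R => g x0 - f x0) x (dg x - df x).
  by move=> x hx; apply: derB; [exact: hg|exact: hf].
move=> /(_ H); have H2 : forall x, a <= x <= b -> 0 <= dg x - df x.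
  by move=> x hx; rewrite subr_ge0 h.
by move=> /(_ H2); lra.
Qed.

Lemma der_norm_le f df g dg a b : a <= b ->
  (forall x, a <= x <= b -> der f x (df x)) ->
  (forall x, a <= x <= b -> der g x (dg x)) ->
  (forall x, a <= x <= b -> `|df x| <= dg x) -> `|f b - f a| <= g b - g a.
Proof.
move=> ab hf hg h; rewrite ler_norml; apply/andP; split.
  have := @der_le2 (fun x => - f x) (fun x => - df x) g dg a b ab.
  move=> H; suff : - f b - (- f a) <= g b - g a by lra.
  apply: H => // x hx; first by apply: derN; exact: hf.
  by have := h x hx; rewrite ler_norml; lra.
apply: (der_le2 ab hf hg) => x hx.
by have := h x hx; rewrite ler_norml; lra.
Qed.

Lemma der0_cst f a b : a <= b -> (forall x, a <= x <= b -> der f x 0) -> f a = f b.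
Proof.
rewrite le_eqVlt => /predU1P[->//|ab] h; have [c _] := mvt ab h.
by rewrite mul0r => /eqP; rewrite subr_eq0 => /eqP.
Qed.

(** Mean value theorem on an interval of length 1 far out, where the increment of a convergent
    function is small. The derivative need not converge; isolated times at which it is small suffice
    later. *)
Lemma increment_small_pinfty f df (l : R) :
  (forall x, der f x (df x)) -> (f t @[t --> +oo] --> l) ->
  forall eps T, 0 < eps -> exists2 t, T < t & df t < eps.
Proof.
move=> h cv eps T e0.
have /cvgrPdist_lt /(_ (eps / 2)) H := cv.
have /H [M [Mr HM]] : 0 < eps / 2 by lra.
pose a := `|M| + `|T| + 1.
have aM : M < a by have := ler_norm M; have := normr_ge0 T; rewrite /a; lra.
have aT : T < a by have := ler_norm T; have := normr_ge0 M; rewrite /a; lra.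
have aa : a < a + 1 by lra.
have [c /andP[c1 c2]] := mvt aa (fun x _ => h x).
have -> : a + 1 - a = 1 by ring.
rewrite mulr1 => e; exists c; first lra.
have := HM a aM; have := HM (a + 1) ltac:(lra).
rewrite !ltr_norml -e; lra.
Qed.

Lemma increment_small_ninfty f df (l T0 : R) :
  (forall x, x < T0 -> der f x (df x)) -> (f t @[t --> -oo] --> l) ->
  forall eps T, 0 < eps -> exists2 t, t < T & df t < eps.
Proof.
move=> h cv eps T e0.
have /cvgrPdist_lt /(_ (eps / 2)) H := cv.
have /H [M [Mr HM]] : 0 < eps / 2 by lra.
pose a := - (`|M| + `|T| + `|T0| + 1).
have [hM hT hT0] : [/\ - M <= `|M|, - T <= `|T| & - T0 <= `|T0|].
  by split; rewrite -normrN ler_norm.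
have [pM pT pT0] : [/\ 0 <= `|M|, 0 <= `|T| & 0 <= `|T0|] by rewrite !normr_ge0.
have aM : a < M by rewrite /a; lra.
have aT : a < T by rewrite /a; lra.
have aT0 : a < T0 by rewrite /a; lra.
have aa : a - 1 < a by lra.
have [x hx|c /andP[c1 c2]] := @mvt f df _ _ aa; first by apply: h; lra.
have -> : a - (a - 1) = 1 by ring.
rewrite mulr1 => e; exists c; first lra.
have := HM a aM; have := HM (a - 1) ltac:(lra).
rewrite !ltr_norml -e; lra.
Qed.

End Calculus.

(** * The Toda system *)

Section Toda.
Variable R : realType.
Implicit Types (p q tau T t : R) (u v x y : R -> R).

(* The radial problem in t = ln |x|: x and y are the fluxes through the disc of
   radius e^t, while u = v_1 + p t and v = v_2 + q t with p = 2 (N_1 + 1) and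
   q = 2 (N_2 + 1); the statement is the case (N_1, N_2) = (N, 0), and keeping
   both exponents makes the two equations interchangeable. *)
Record toda p q tau T u v x y : Prop := Toda {
  toda_x : forall t, t < T -> der x t (expR (u t));
  toda_y : forall t, t < T -> der y t (expR (v t));
  toda_u : forall t, t < T -> der u t (p - x t + tau * y t);
  toda_v : forall t, t < T -> der v t (q - y t + tau * x t);
  toda_x0 : x t @[t --> -oo] --> (0 : R);
  toda_y0 : y t @[t --> -oo] --> (0 : R) }.

Lemma toda_sym p q tau T u v x y :
  toda p q tau T u v x y -> toda q p tau T v u y x.
Proof. by case=> *; split. Qed.

Lemma nondecreasing_ge0 (f : R -> R) T : (forall a b, a <= b -> b < T -> f a <= f b) ->
  (f t @[t --> -oo] --> (0 : R)) -> forall t, t < T -> 0 <= f t.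
Proof.
move=> h cv t tT; rewrite leNgt; apply/negP => ft.
have /cvgrPdist_lt /(_ (- f t)) := cv.
move=> /(_ ltac:(lra)) [M [Mr HM]].
pose a := - (`|M| + `|t| + 1).
have [hM ht] : - M <= `|M| /\ - t <= `|t| by split; rewrite -normrN ler_norm.
have [pM pt] : 0 <= `|M| /\ 0 <= `|t| by [].
have := HM a ltac:(rewrite /a; lra).
have := h a t ltac:(rewrite /a; lra) tT.
by rewrite ltr_norml; lra.
Qed.

Section Facts.
Variables (p q tau T : R) (u v x y : R -> R).
Hypothesis H : toda p q tau T u v x y.

Lemma toda_x_nd a b : a <= b -> b < T -> x a <= x b.
Proof.
move=> ab bT; apply: (der_le ab (df := fun t => expR (u t))) => t ht.
  by apply: (toda_x H); lra.
exact: expR_ge0.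
Qed.

Lemma toda_x_ge0 t : t < T -> 0 <= x t.
Proof. by apply: nondecreasing_ge0; [exact: toda_x_nd|exact: (toda_x0 H)]. Qed.

Lemma toda_x_gt0 t : t < T -> 0 < x t.
Proof.
move=> tT; have := @toda_x_ge0 (t - 1) ltac:(lra).
suff : x (t - 1) < x t by lra.
apply: (der_lt (df := fun t => expR (u t))); first lra.
  by move=> s hs; apply: (toda_x H); lra.
by move=> s hs; exact: expR_gt0.
Qed.

End Facts.

Lemma toda_y_ge0 p q tau T u v x y : toda p q tau T u v x y -> forall t, t < T -> 0 <= y t.
Proof. move=> /toda_sym H; exact: (toda_x_ge0 H). Qed.

Lemma toda_y_gt0 p q tau T u v x y : toda p q tau T u v x y -> forall t, t < T -> 0 < y t.
Proof. move=> /toda_sym H; exact: (toda_x_gt0 H). Qed.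

Lemma toda_y_nd p q tau T u v x y : toda p q tau T u v x y ->
  forall a b, a <= b -> b < T -> y a <= y b.
Proof. move=> /toda_sym H; exact: (toda_x_nd H). Qed.

(** The function F of the overview. Its partial derivatives are the right-hand sides of u' and v',
    and -2 F with p = 2 (N + 1), q = 2 is the left-hand side of the conic in the theorem. *)
Definition pohozaev p q tau (a b : R) :=
  p * a + q * b - (a ^+ 2 + b ^+ 2 - 2 * tau * a * b) / 2.

Lemma toda_energy p q tau T u v x y : toda p q tau T u v x y ->
  forall t, t < T -> expR (u t) + expR (v t) = pohozaev p q tau (x t) (y t).
Proof.
move=> H.
pose E t := expR (u t) + expR (v t) - (p * x t + q * y t -
  2^-1 * (x t ^+ 2 + y t ^+ 2 - 2 * tau * (x t * y t))).
have dE t : t < T -> der E t 0.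
  move=> tT; have [[[hx hy] hu] hv] := (toda_x H tT, toda_y H tT, toda_u H tT, toda_v H tT).
  apply: derE.
    apply: derB; first by apply: derD; apply: der_exp; [exact: hu|exact: hv].
    apply: derB; first by apply: derD; apply: derZ; [exact: hx|exact: hy].
    apply: derZ; apply: derB; last by apply: derZ; apply: derM; [exact: hx|exact: hy].
    by apply: derD; apply: der_sqr; [exact: hx|exact: hy].
  by field.
have cE a b : a < T -> b < T -> E a = E b.
  move=> aT bT; have [ab|/ltW ab] := leP a b.
    by apply: der0_cst => // t ht; apply: dE; lra.
  by apply/esym; apply: der0_cst => // t ht; apply: dE; lra.
have pE (t : R) : pohozaev p q tau (x t) (y t) = p * x t + q * y t -
  2^-1 * (x t ^+ 2 + y t ^+ 2 - 2 * tau * (x t * y t)) by rewrite /pohozaev; field.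
have cp : pohozaev p q tau (x t) (y t) @[t --> -oo] --> (0 : R).
  have -> : (0 : R) = p * 0 + q * 0 - 2^-1 * (0 * 0 + 0 * 0 - 2 * tau * (0 * 0)) by ring.
  under eq_fun do rewrite pE !expr2.
  have [cx cy] := (toda_x0 H, toda_y0 H).
  apply: cvgB; first by apply: cvgD; apply: cvgMr.
  apply: cvgMr; apply: cvgB; first by apply: cvgD; apply: cvgM.
  by apply: cvgMr; apply: cvgM.
have cxy : x t + y t @[t --> -oo] --> (0 : R).
  by rewrite -(addr0 (0:R)); apply: cvgD; [exact: (toda_x0 H)|exact: (toda_y0 H)].
move=> t tT.
suff E0 : E t = 0 by rewrite pE; move: E0; rewrite /E; lra.
apply/eqP; rewrite -normr_le0; apply/ler_addgt0Pl => e e0; rewrite addr0.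
have /cvgrPdist_lt /(_ (e/2)) := cp.
move=> /(_ ltac:(lra)) [M [Mr HM]].
(* The integral e^u + e^v of the flux x + y converges at -oo, so its derivative is small at some
   time [s] far to the left; as [E] is constant, one such time is enough. *)
have [|s sM hs] := @increment_small_ninfty _ (fun t => x t + y t)
  (fun t => expR (u t) + expR (v t)) 0 T _ cxy (e / 2) (Num.min M T) ltac:(lra).
  by move=> s sT; apply: derD; [exact: (toda_x H)|exact: (toda_y H)].
move: sM; rewrite lt_min => /andP[sM sT].
rewrite (cE _ _ tT sT) /E -pE.
have := HM s sM; rewrite sub0r normrN => h2.
apply: (le_trans (ler_normB _ _)).
have := expR_ge0 (u s); have := expR_ge0 (v s) => e1 e2.
by rewrite ger0_norm ?addr_ge0//; lra.
Qed.

(** The energy identity makes F(x, y) positive. For tau < 1 its quadratic part dominates (1 - tau)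
    (x^2 + y^2) / 2, so the fluxes stay in a bounded region that depends on p, q, tau only. *)
Lemma toda_bounded p q tau T u v x y : 0 < p -> 0 < q -> 0 < tau -> tau < 1 ->
  toda p q tau T u v x y -> forall t, t < T -> x t <= 2 * (p + q) / (1 - tau).
Proof.
move=> p0 q0 t0 t1 H t tT.
have := toda_energy H tT; have := expR_gt0 (u t); have := expR_gt0 (v t).
have := toda_x_gt0 H tT; have := toda_y_gt0 H tT.
rewrite /pohozaev; set a := x t; set b := y t; move=> b0 a0 e1 e2 E.
rewrite ler_pdivlMr; last lra.
rewrite leNgt; apply/negP => h.
have h1 : (1 - tau) * (a ^+ 2 + b ^+ 2) <= 2 * (p * a + q * b).
  by have : 0 <= tau * (a - b) ^+ 2; [rewrite mulr_ge0 ?sqr_ge0 // ltW|nra].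
have h2 : 2 * (p + q) * a < a * (a * (1 - tau)) by nra.
have h3 : 0 <= (1 - tau) * (b - a * 0) ^+ 2 by rewrite mulr_ge0 ?sqr_ge0//; lra.
have : (1 - tau) * b ^+ 2 < 2 * q * b - 2 * q * a by nra.
have [ba|ab] := leP b a; first by nra.
have h4 : 2 * (p + q) * b < b * (b * (1 - tau)) by nra.
nra.
Qed.

(** Bound for the linear part p x + q y of F, with both fluxes replaced by the bound of
    [toda_bounded]. It bounds e^u too, since e^u < F and the quadratic form is subtracted in F. *)
Definition toda_max p q tau := p * (2 * (p + q) / (1 - tau)) + q * (2 * (p + q) / (1 - tau)).

Lemma toda_exp_le p q tau T u v x y : 0 < p -> 0 < q -> 0 < tau -> tau < 1 ->
  toda p q tau T u v x y -> forall t, t < T -> expR (u t) <= toda_max p q tau.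
Proof.
move=> p0 q0 t0 t1 H t tT.
have := toda_energy H tT; have := expR_gt0 (v t).
have := toda_x_gt0 H tT; have := toda_y_gt0 H tT.
have := toda_bounded p0 q0 t0 t1 H tT.
have := toda_bounded q0 p0 t0 t1 (toda_sym H) tT; rewrite (addrC q p).
rewrite /pohozaev /toda_max; set B := _ / _; set a := x t; set b := y t.
move=> bB aB b0 a0 e1 E.
have h1 : 0 <= tau * (a - b) ^+ 2 by rewrite mulr_ge0 ?sqr_ge0 // ltW.
have h2 : 0 <= (1 - tau) * (a ^+ 2 + b ^+ 2) by apply: mulr_ge0; [lra|rewrite addr_ge0 ?sqr_ge0].
have h3 : p * a <= p * B by rewrite ler_pM2l.
have h4 : q * b <= q * B by rewrite ler_pM2l.
nra.
Qed.

(** The derivative of e^u - p x + x^2 / 2 is tau y e^u = tau y x', and y is nondecreasing. This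
    quantitative form of the monotonicity yields the strict bounds on the total fluxes and also the
    overshoot in [toda_second_mass]. *)
Lemma toda_excess p q tau T u v x y : 0 < tau ->
  toda p q tau T u v x y -> forall a b, a <= b -> b < T ->
  tau * y a * (x b - x a) <= (expR (u b) - (p * x b - x b ^+ 2 / 2))
     - (expR (u a) - (p * x a - x a ^+ 2 / 2)).
Proof.
move=> t0 H a b ab bT.
have -> : tau * y a * (x b - x a) = tau * y a * x b - tau * y a * x a by ring.
apply: (@der_le2 _ (fun t => tau * y a * x t) (fun t => tau * y a * expR (u t))
  (fun t => expR (u t) - (p * x t - x t ^+ 2 / 2)) (fun t => tau * y t * expR (u t))) => // t ht.
- by apply: derZ; apply: (toda_x H); lra.
- have tT : t < T by lra.
  have [hx hu] := (toda_x H tT, toda_u H tT).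
  apply: derE.
    apply: derB; first by apply: der_exp; exact: hu.
    apply: derB; first by apply: derZ; exact: hx.
    by apply: derM; [apply: der_sqr; exact: hx|exact: der_cst].
  by move=> /=; field.
- apply: ler_wpM2r; first exact: expR_ge0.
  by apply: ler_wpM2l; [exact: ltW|apply: (toda_y_nd H); lra].
Qed.

Lemma toda_excess_ge0 p q tau T u v x y : 0 < p -> 0 < tau ->
  toda p q tau T u v x y -> forall t, t < T ->
  0 <= expR (u t) - (p * x t - x t ^+ 2 / 2).
Proof.
move=> p0 t0 H t tT; apply/ler_addgt0Pl => e e0.
have /cvgrPdist_lt /(_ (e/p)) := toda_x0 H.
move=> /(_ ltac:(by rewrite divr_gt0)) [M [Mr HM]].
pose s := - (`|M| + `|t| + 1).
have [hM ht] : - M <= `|M| /\ - t <= `|t| by split; rewrite -normrN ler_norm.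
have [pM pt] : 0 <= `|M| /\ 0 <= `|t| by [].
have sM : s < M by rewrite /s; lra.
have st : s < t by rewrite /s; lra.
have := HM s sM; rewrite sub0r normrN => h2.
have sT : s < T by lra.
have x0 := toda_x_gt0 H sT; move: h2; rewrite gtr0_norm // ltr_pdivlMr // => h2.
have := toda_excess t0 H (ltW st) tT.
have h3 : 0 <= tau * y s * (x t - x s).
  rewrite mulr_ge0 ?subr_ge0 ?(toda_x_nd H (ltW st))// mulr_ge0 ?ltW//.
  exact: toda_y_gt0 H _ sT.
have := expR_gt0 (u s); have := sqr_ge0 (x s); lra.
Qed.

Section Global.
Variables (p q tau : R) (u v x y : R -> R) (b1 b2 : R).
Hypotheses (p0 : 0 < p) (q0 : 0 < q) (t0 : 0 < tau) (t1 : tau < 1).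
Hypothesis H : forall T, toda p q tau T u v x y.
Hypothesis cx : x t @[t --> +oo] --> b1.
Hypothesis cy : y t @[t --> +oo] --> b2.

Lemma toda_lim_ge t : x t <= b1.
Proof.
apply: (cvgr_to_ge cx).
near=> s; apply: (toda_x_nd (H (s + 1))); last lra.
by near: s; apply: nbhs_pinfty_ge; rewrite num_real.
Unshelve. all: by end_near. Qed.

Lemma toda_small eps T : 0 < eps -> exists2 t, T < t & expR (u t) + expR (v t) < eps.
Proof.
move=> e0.
apply: (@increment_small_pinfty _ (fun t => x t + y t) (fun t => expR (u t) + expR (v t)) (b1 + b2)) => //.
  by move=> s; apply: derD; [apply: (toda_x (H (s + 1)))|apply: (toda_y (H (s + 1)))]; lra.
by apply: cvgD.
Qed.

(** Limit of [toda_excess] from [T] along times going to +oo at which e^u is small, after dropping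
    the nonnegative excess at [T]. *)
Lemma toda_lim_excess T : tau * y T * (b1 - x T) <= b1 ^+ 2 / 2 - p * b1.
Proof.
apply/ler_addgt0Pl => e e0.
have c2 : - (p * x t - 2^-1 * (x t * x t)) @[t --> +oo] --> - (p * b1 - 2^-1 * (b1 * b1)).
  by apply: cvgN; apply: cvgB; apply: cvgMr => //; apply: cvgM.
have c1 : tau * y T * (x t - x T) @[t --> +oo] --> tau * y T * (b1 - x T).
  by apply: cvgMr; apply: cvgB => //; exact: cvg_cst.
have /cvgrPdist_lt /(_ (e/3)) := c2; move=> /(_ ltac:(lra)) [M2 [_ h2]].
have /cvgrPdist_lt /(_ (e/3)) := c1; move=> /(_ ltac:(lra)) [M1 [_ h1]].
have [t tM hs] := @toda_small (e/3) (Num.max M1 (Num.max M2 T)) ltac:(lra).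
move: tM; rewrite !gt_max => /and3P[a1 a2 a3].
move: (h1 t a1) (h2 t a2); rewrite !ltr_norml => k1 k2.
have := toda_excess t0 (H (t + 1)) (ltW a3) ltac:(lra).
have := toda_excess_ge0 p0 t0 (H (T + 1)) (t := T) ltac:(lra).
have := expR_gt0 (v t).
set E := expR (u T) - _; move: k1 k2 hs; set F := _ * _ * (x t - _).
rewrite !expr2; lra.
Qed.

Lemma toda_lim_gt : 2 * p < b1.
Proof.
have [hx hy] := (toda_x_gt0 (H 1) (t := 0) ltac:(lra), toda_y_gt0 (H 1) (t := 0) ltac:(lra)).
have b0 := toda_lim_ge 0.
have : x 0 < b1.
  apply: lt_le_trans (toda_lim_ge 1).
  apply: (der_lt (df := fun t => expR (u t))); first lra.
    by move=> s hs; apply: (toda_x (H 2)); lra.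
  by move=> s hs; exact: expR_gt0.
move=> xb; have := toda_lim_excess 0.
have : 0 < tau * y 0 * (b1 - x 0) by rewrite !mulr_gt0 // subr_gt0.
move=> h1 h2; have : 0 < b1 * (b1 - 2 * p) by lra.
by rewrite pmulr_rgt0 ?subr_gt0//; lra.
Qed.

Lemma toda_lim_conic : pohozaev p q tau b1 b2 = 0.
Proof.
apply/eqP; rewrite -normr_le0; apply/ler_addgt0Pl => e e0; rewrite addr0.
have pE (a b : R) : pohozaev p q tau a b = p * a + q * b -
  2^-1 * (a * a + b * b - 2 * tau * (a * b)) by rewrite /pohozaev; field.
have cp : pohozaev p q tau (x t) (y t) @[t --> +oo] --> pohozaev p q tau b1 b2.
  rewrite pE; under eq_fun do rewrite pE.
  apply: cvgB; first by apply: cvgD; apply: cvgMr.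
  apply: cvgMr; apply: cvgB; first by apply: cvgD; apply: cvgM.
  by apply: cvgMr; apply: cvgM.
have /cvgrPdist_lt /(_ (e/2)) := cp; move=> /(_ ltac:(lra)) [M [_ h]].
have [t tM hs] := @toda_small (e/2) M ltac:(lra).
have := h t tM; rewrite -(toda_energy (H (t + 1))); last lra.
have := expR_gt0 (v t); have := expR_gt0 (u t).
rewrite ltr_norml ler_norml; lra.
Qed.

End Global.

Lemma toda_cvg p q tau u v x y : 0 < p -> 0 < q -> 0 < tau -> tau < 1 ->
  (forall T, toda p q tau T u v x y) -> exists b : R, x t @[t --> +oo] --> b.
Proof.
move=> p0 q0 t0 t1 H; exists (sup (range x)); apply: nondecreasing_cvgr.
  by move=> a b ab; apply: (toda_x_nd (H (b + 1))) => //; lra.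
exists (2 * (p + q) / (1 - tau)) => _ [t _ <-].
by apply: (toda_bounded p0 q0 t0 t1 (H (t + 1))); lra.
Qed.

End Toda.

(** * Picard iteration for the radial system *)

Section Primitive.
Variable R : realType.
Implicit Types (h k : R -> R) (s x : R).
Local Notation leb := (@lebesgue_measure R).

Lemma continuous_integrable_itv h a b : continuous h -> leb.-integrable `[a, b] (EFin \o h).
Proof.
move=> ch; apply: continuous_compact_integrable; first exact: segment_compact.
exact: continuous_subspaceT.
Qed.

Lemma ex_primitive h : continuous h ->
  exists F : R -> R, (forall x, der F x (h x)) /\ F 0 = 0.
Proof.
move=> ch.
(* Integrals over intervals are unoriented, so the base point [a] must lie to the left of both [x]
   and 0. By [GE] its choice is immaterial, which allows freezing it in a neighbourhood of [x]. *)
pose G a x := \int[leb]_(t in `[a, x]) h t - \int[leb]_(t in `[a, 0]) h t.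
have GE a b x : a <= b -> b <= x -> b <= 0 -> G a x = G b x.
  move=> ab bx b0.
  have add y : b <= y -> \int[leb]_(t in `[a, y]) h t =
      \int[leb]_(t in `[a, b]) h t + \int[leb]_(t in `[b, y]) h t.
    move=> byy; have := @Rintegral_itvB R h (BLeft a) (BRight y) b.
    move=> /(_ (continuous_integrable_itv _ _ ch)).
    rewrite !bnd_simp => /(_ ab byy); rewrite (@Rintegral_itv_obnd_cbnd R b (BRight y) h) => [e|].
      by rewrite -e; ring.
    apply: (@integrableS _ _ _ leb `[b, y]) => //; last exact: continuous_integrable_itv.
    exact: subset_itv_oc_cc.
  by rewrite /G (add x) // (add 0) //; ring.
exists (fun x => G (- (`|x| + 1)) x); split; last by rewrite /G subrr.
move=> x; pose a := - (`|x| + 2).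
apply: (@der_near R (G a)).
  near=> y; apply: GE.
  - have : `|y| < `|x| + 1.
      have : `|y - x| < 1.
        by near: y; exists 1 => //= y /=; rewrite distrC.
      by have := ler_dist_dist y x; have := ler_norm (`|y| - `|x|); lra.
    by rewrite /a; lra.
  - by have := ler_norm (- y); rewrite normrN; lra.
  - by have := normr_ge0 y; lra.
have ax : a < x by have := ler_norm (- x); rewrite normrN /a; lra.
have [d1 d2] := @continuous_FTC1_closed R h a x (x + 1) ltac:(lra)
  (continuous_integrable_itv _ _ ch) ax (ch x).
rewrite /G; apply: derE; first apply: derB.
- by apply: DeriveDef; [exact: d1|rewrite -derive1E; exact: d2].
- exact: der_cst.
- by rewrite subr0.
Unshelve. all: by end_near. Qed.

(* Junk unless [h] is continuous. *)
Definition prim h : R -> R := xget (fun=> 0) [set F | (forall x, der F x (h x)) /\ F 0 = 0].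

Lemma der_prim h x : continuous h -> der (prim h) x (h x).
Proof. by move=> /ex_primitive [F hF]; have [] := xgetI (fun=> 0) (hF : [set F | _] F). Qed.

Lemma prim0 h : continuous h -> prim h 0 = 0.
Proof. by move=> /ex_primitive [F hF]; have [] := xgetI (fun=> 0) (hF : [set F | _] F). Qed.

(** Average of [h] between 0 and [s], extended continuously to 0. The solution of (s w')' = h that
    is regular at 0 has w' = [mean h]. *)
Definition mean h s := if s == 0 then h 0 else prim h s / s.

Lemma mul_mean h s : continuous h -> s * mean h s = prim h s.
Proof.
rewrite /mean => ch; case: eqP => [->|/eqP s0]; first by rewrite mul0r prim0.
by rewrite mulrC divfK.
Qed.

(** Mean value theorem for the difference of the primitives. The two conditions on [x] say that it
    lies between 0 and [s], for either sign of [s]. *)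
Lemma mean_sub_mvt h k s : continuous h -> continuous k ->
  exists2 x, (`|x| <= `|s|) && (0 <= s * x) & mean h s - mean k s = h x - k x.
Proof.
move=> ch ck; have [s0|s0] := eqVneq s 0.
  by exists 0; rewrite ?normr0 ?normr_ge0 ?mulr0 ?lexx // /mean s0 eqxx.
pose d x := prim h x - prim k x.
have dd x : der d x (h x - k x) by apply: derB; exact: der_prim.
have d0 : d 0 = 0 by rewrite /d !prim0 // subrr.
have ds : mean h s - mean k s = d s / s by rewrite /mean (negbTE s0) /d mulrBl.
have [sp|sn] := ltP 0 s.
  have [c /andP[c0 cs]] := mvt sp (fun x _ => dd x).
  rewrite d0 !subr0 => e; exists c; first by rewrite !ger0_norm ?mulr_ge0 ?ltW.
  by rewrite ds e mulfK.
have {}sn : s < 0 by rewrite lt_neqAle s0.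
have [c /andP[c0 cs]] := mvt sn (fun x _ => dd x).
rewrite d0 !sub0r => e; exists c.
  by rewrite !ler0_norm ?lerN2 ?mulr_le0 ?ltW.
have es : d s = (h c - k c) * s by apply: oppr_inj; rewrite e mulrN.
by rewrite ds es mulfK.
Qed.

Lemma mean_mvt h s : continuous h ->
  exists2 x, (`|x| <= `|s|) && (0 <= s * x) & mean h s = h x.
Proof.
move=> ch; have c0 : continuous (fun _ : R => 0 : R) by move=> ?; exact: cvg_cst.
have [x hx e] := mean_sub_mvt s ch c0.
have [y _ e0] := mean_sub_mvt s c0 c0.
exists x => //; move: e; rewrite subr0 => <-.
suff -> : mean (fun=> 0) s = 0 by rewrite subr0.
rewrite /mean; case: eqP => // _.
suff -> : prim (fun=> 0) s = 0 by rewrite mul0r.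
have hd z : der (prim (fun=> 0)) z 0 by exact: (der_prim z c0).
by rewrite (@is_derive_0_is_cst R _ s 0 hd) prim0.
Qed.

Lemma continuous_mean h : continuous h -> continuous (mean h).
Proof.
move=> ch s; have [->|s0] := eqVneq s 0.
  apply/cvgrPdist_lt => e e0.
  have /cvgrPdist_lt /(_ e e0) [d /= d0 hd] := ch 0.
  exists d => //; move=> t td.
  have {}td : `|t| < d by move: td => /=; rewrite !ltr_norml; lra.
  have [x /andP[xt _] ->] := mean_mvt t ch.
  rewrite {1}/mean eqxx; apply: hd => /=.
  by have := le_lt_trans xt td; rewrite !ltr_norml; lra.
apply: (@der_cont _ _ s).
apply: (@der_near R (fun s => prim h s * s^-1)).
  near=> t; rewrite /mean ifF //; apply/negbTE.
  near: t; exact: open_neq.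
apply: derM; first exact: der_prim.
by apply: derV => //; exact: der_id.
Unshelve. all: by end_near. Qed.

End Primitive.

Section GeometricCauchy.
Variable R : realType.

Lemma exp_half_ge0 (n : nat) : 0 <= (2^-1 : R) ^+ n.
Proof. by rewrite exprn_ge0 // invr_ge0. Qed.

(** The intervals of radius 2 C 2^(-n) around [u n] are nested; the supremum of their left ends lies
    in all of them, which gives the limit together with its rate. *)
Lemma geometric_cauchy (u : nat -> R) (C : R) : 0 <= C ->
  (forall n, `|u n.+1 - u n| <= C * 2^-1 ^+ n) ->
  exists l, forall n, `|u n - l| <= 2 * C * 2^-1 ^+ n.
Proof.
move=> C0 hu.
pose a n := u n - 2 * C * 2^-1 ^+ n; pose b n := u n + 2 * C * 2^-1 ^+ n.
have ha n : a n <= a n.+1.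
  rewrite /a exprS; have := hu n; rewrite ler_norml; have := exp_half_ge0 n.
  by set q := _ ^+ n => ?; lra.
have hb n : b n.+1 <= b n.
  rewrite /b exprS; have := hu n; rewrite ler_norml; have := exp_half_ge0 n.
  by set q := _ ^+ n => ?; lra.
have hab n : a n <= b n.
  rewrite /a /b; have : 0 <= 2 * C * 2^-1 ^+ n by rewrite !mulr_ge0 // exp_half_ge0.
  lra.
have ma := homo_leq (@lexx _ _) (@le_trans _ _) ha.
have mb : forall m n, (m <= n)%N -> b n <= b m.
  move=> m n mn; elim: n mn => [|n ih]; first by rewrite leqn0 => /eqP ->.
  rewrite leq_eqVlt => /predU1P[->//|]; rewrite ltnS => /ih; exact: le_trans.
have amn m n : a m <= b n.
  have := ma _ _ (leq_maxl m n); have := mb _ _ (leq_maxr m n); have := hab (maxn m n).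
  lra.
have hs : has_sup (range a).
  by split; [exists (a 0), 0|exists (b 0) => _ [n _ <-]].
exists (sup (range a)) => n.
have h1 : a n <= sup (range a) by apply: ub_le_sup; [exact: hs.2|exists n].
have h2 : sup (range a) <= b n by apply: ge_sup; [exact: hs.1|move=> _ [m _ <-]].
by rewrite ler_norml; move: h1 h2; rewrite /a /b; lra.
Qed.

Lemma le_geometric0 (x C D : R) : (forall n, x <= D + C * 2^-1 ^+ n) -> x <= D.
Proof.
move=> h; apply/ler_addgt0Pl => e e0.
have : (fun n => C * 2^-1 ^+ n : R) @ \oo --> (0 : R).
  rewrite -(mulr0 C); apply: cvgMr; apply: cvg_expr.
  by rewrite ger0_norm ?invr_ge0 // invf_lt1 // ltr1n.
move=> /cvgrPdist_lt /(_ e e0) [n _ /(_ n (leqnn n))] /=.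
rewrite sub0r normrN ltr_norml; have := h n; lra.
Qed.

End GeometricCauchy.

Section Picard.
Variable R : realType.
Implicit Types (h k : R -> R) (s x : R).

(* -4 (s w')' = h with w(0) = c, integrated twice; [`|s|] extends w evenly, so
   that it is continuous on the whole line. *)
Definition picard (c : R) h s : R := c - 4^-1 * prim (mean h) `|s|.

Lemma continuous_picard c h : continuous h -> continuous (picard c h).
Proof.
move=> ch s; apply: cvgB; first exact: cvg_cst.
apply: cvgMr.
apply: (@continuous_comp _ _ _ (fun s => `|s|) (prim (mean h))); first exact: norm_continuous.
apply: der_cont; apply: der_prim; exact: continuous_mean.
Qed.

Variables (K n : R).
Hypotheses (K0 : 0 < K) (n0 : 0 < n).

(* The source terms are Lipschitz with constant K e^(n s), so the Picard map
   contracts only in a norm with a doubly exponential weight. *)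
Definition wgt s : R := expR (K / n * expR (n * `|s|)).

(** The weight is chosen so that its derivative is the Lipschitz constant K e^(n s) times the weight
    itself: integrating Lipschitz constant times weight returns the weight. *)
Lemma der_wgt s : der (fun s => expR (K / n * expR (n * s))) s
  (K * expR (n * s) * expR (K / n * expR (n * s))).
Proof.
apply: derE.
  by apply: der_exp; apply: derZ; apply: der_exp; apply: derZ; exact: der_id.
by field; rewrite gt_eqF.
Qed.

Lemma wgt_ge1 s : 1 <= wgt s.
Proof. by rewrite -expR0 ler_expR mulr_ge0 ?divr_ge0 ?expR_ge0 // ltW. Qed.

Lemma wgt_mono s x : `|s| <= `|x| -> wgt s <= wgt x.
Proof.
move=> h; rewrite ler_expR ler_wpM2l //; first by rewrite divr_ge0 // ltW.
by rewrite ler_expR ler_wpM2l // ltW.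
Qed.

(** The factor 2 in the hypothesis accounts for the two terms of each source. The majorant is
    increasing on s >= 0, hence also bounds the difference of means; it is the derivative of 2 D
    times the weight, and the factor 1/4 of [picard] leaves D / 2, a contraction by one half. *)
Lemma picard_sub_le c c' h k D s : 0 <= D -> continuous h -> continuous k ->
  (forall x, `|h x - k x| <= 2 * (K * expR (n * `|x|) * (D * wgt x))) ->
  `|picard c h s - picard c' k s| <= `|c - c'| + D / 2 * wgt s.
Proof.
move=> D0 ch ck hk; rewrite /picard.
have [cmh cmk] := (continuous_mean ch, continuous_mean ck).
have := @der_norm_le R (fun r => prim (mean h) r - prim (mean k) r) (fun r => mean h r - mean k r)
  (fun r => 2 * D * expR (K / n * expR (n * r)))
  (fun r => 2 * D * (K * expR (n * r) * expR (K / n * expR (n * r)))) 0 `|s| (normr_ge0 s).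
move=> /(_ (fun x _ => derB (der_prim x cmh) (der_prim x cmk))).
move=> /(_ (fun x _ => derZ (2 * D) (der_wgt x))).
have H : forall x, 0 <= x <= `|s| -> `|mean h x - mean k x| <=
   2 * D * (K * expR (n * x) * expR (K / n * expR (n * x))).
  move=> x /andP[x0 xs]; have [y /andP[yx _] ->] := mean_sub_mvt x ch ck.
  apply: (le_trans (hk y)).
  have -> : 2 * (K * expR (n * `|y|) * (D * wgt y)) = 2 * D * (K * expR (n * `|y|) * wgt y) by ring.
  have -> : expR (K / n * expR (n * x)) = wgt x by rewrite /wgt ger0_norm.
  apply: ler_wpM2l; first by rewrite mulr_ge0.
  apply: ler_pM; rewrite ?mulr_ge0 ?expR_ge0 //; try exact: ltW.
    apply: ler_wpM2l; first exact: ltW.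
    by rewrite ler_expR ler_wpM2l ?(ltW n0) // -(ger0_norm x0).
  exact: wgt_mono.
move=> /(_ H); rewrite !prim0 // subrr subr0.
have -> : expR (K / n * expR (n * `|s|)) = wgt s by [].
set P := prim (mean h) _; set Q := prim (mean k) _ => PQ.
have -> : c - 4^-1 * P - (c' - 4^-1 * Q) = (c - c') - 4^-1 * (P - Q) by ring.
apply: (le_trans (ler_normB _ _)); rewrite lerD2l normrM ger0_norm ?invr_ge0 //.
have := expR_ge0 (K / n * expR (n * 0)).
have : 0 <= 2 * D * expR (K / n * expR (n * 0)) by rewrite mulr_ge0 ?expR_ge0 // mulr_ge0.
lra.
Qed.

Variables (f1 f2 : R -> R -> R) (tau : R).
Hypotheses (t0 : 0 < tau) (t1 : tau < 1).
Hypothesis cf1 : forall w : R -> R, continuous w -> continuous (fun s => f1 s (w s)).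
Hypothesis cf2 : forall w : R -> R, continuous w -> continuous (fun s => f2 s (w s)).
Hypothesis lf1 : forall s y z, `|f1 s y - f1 s z| <= K * expR (n * `|s|) * `|y - z|.
Hypothesis lf2 : forall s y z, `|f2 s y - f2 s z| <= K * expR (n * `|s|) * `|y - z|.
Hypothesis bf1 : forall s z, `|f1 s z| <= K * expR (n * `|s|).
Hypothesis bf2 : forall s z, `|f2 s z| <= K * expR (n * `|s|).

Definition src1 (w : (R -> R) * (R -> R)) s := f1 s (w.1 s) - tau * f2 s (w.2 s).
Definition src2 (w : (R -> R) * (R -> R)) s := f2 s (w.2 s) - tau * f1 s (w.1 s).
Definition pic (c : R * R) w := (picard c.1 (src1 w), picard c.2 (src2 w)).
Definition cont2 (w : (R -> R) * (R -> R)) := continuous w.1 /\ continuous w.2.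
Definition dist_le (D : R) (w w' : (R -> R) * (R -> R)) :=
  forall s, `|w.1 s - w'.1 s| <= D * wgt s /\ `|w.2 s - w'.2 s| <= D * wgt s.

Lemma cont_src1 w : cont2 w -> continuous (src1 w).
Proof.
move=> [c1 c2] s; apply: cvgB; first exact: (cf1 c1).
by apply: cvgMr; exact: (cf2 c2).
Qed.

Lemma cont_src2 w : cont2 w -> continuous (src2 w).
Proof.
move=> [c1 c2] s; apply: cvgB; first exact: (cf2 c2).
by apply: cvgMr; exact: (cf1 c1).
Qed.

Lemma cont2_pic c w : cont2 w -> cont2 (pic c w).
Proof.
by move=> h; split; apply: continuous_picard; [exact: cont_src1|exact: cont_src2].
Qed.

Lemma comb_le (a b M : R) : `|a| <= M -> `|b| <= M -> `|a - tau * b| <= 2 * M.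
Proof.
move=> ha hb; apply: (le_trans (ler_normB _ _)).
rewrite normrM (gtr0_norm t0); have : tau * `|b| <= 1 * `|b| by rewrite ler_wpM2r // ltW.
lra.
Qed.

Lemma pic_contract c c' w w' D d : 0 <= D -> cont2 w -> cont2 w' ->
  `|c.1 - c'.1| <= d -> `|c.2 - c'.2| <= d ->
  dist_le D w w' -> dist_le (d + D / 2) (pic c w) (pic c' w').
Proof.
move=> D0 cw cw' d1 d2 h s.
have d0 : 0 <= d by apply: le_trans d1.
have dw : d <= d * wgt s by rewrite -[leLHS]mulr1 ler_wpM2l // wgt_ge1.
have b1 x : `|f1 x (w.1 x) - f1 x (w'.1 x)| <= K * expR (n * `|x|) * (D * wgt x).
  apply: (le_trans (lf1 _ _ _)); apply: ler_wpM2l; last exact: (h x).1.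
  by rewrite mulr_ge0 ?expR_ge0 // ltW.
have b2 x : `|f2 x (w.2 x) - f2 x (w'.2 x)| <= K * expR (n * `|x|) * (D * wgt x).
  apply: (le_trans (lf2 _ _ _)); apply: ler_wpM2l; last exact: (h x).2.
  by rewrite mulr_ge0 ?expR_ge0 // ltW.
rewrite mulrDl; split.
  apply: (le_trans (@picard_sub_le _ _ _ _ D s D0 (cont_src1 cw) (cont_src1 cw') _)); last first.
    by rewrite lerD2r (le_trans d1).
  move=> x; rewrite /src1.
  set A := f1 _ _; set B := f2 _ _; set A' := f1 _ _; set B' := f2 _ _.
  have -> : A - tau * B - (A' - tau * B') = (A - A') - tau * (B - B') by ring.
  by apply: comb_le; [exact: b1|exact: b2].
apply: (le_trans (@picard_sub_le _ _ _ _ D s D0 (cont_src2 cw) (cont_src2 cw') _)); last first.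
  by rewrite lerD2r (le_trans d2).
move=> x; rewrite /src2.
set A := f2 _ _; set B := f1 _ _; set A' := f2 _ _; set B' := f1 _ _.
have -> : A - tau * B - (A' - tau * B') = (A - A') - tau * (B - B') by ring.
by apply: comb_le; [exact: b2|exact: b1].
Qed.

(** Comparison with the zero source, whose image is the constant [c]. It provides an a priori
    distance from which contraction can start. *)
Lemma picard_cst c h s : continuous h -> (forall x, `|h x| <= 2 * (K * expR (n * `|x|))) ->
  `|picard c h s - c| <= wgt s.
Proof.
move=> ch hh; have c0 : continuous (fun _ : R => 0 : R) by move=> ?; exact: cvg_cst.
have p0 : picard c (fun=> 0) s = c.
  rewrite /picard; suff -> : prim (mean (fun=> 0)) `|s| = 0 by rewrite mulr0 subr0.
  have hd x : der (prim (mean (fun=> 0))) x (0 : R).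
    apply: derE (der_prim x (continuous_mean c0)) _.
    by have [y _ ->] := mean_mvt x c0.
  by rewrite (@is_derive_0_is_cst R _ `|s| 0 hd) prim0 //; exact: continuous_mean.
rewrite -{2}p0; have := @picard_sub_le c c h (fun=> 0) 1 s ler01 ch c0.
rewrite subrr normr0 add0r => H; apply: (le_trans (H _)).
  move=> x; rewrite subr0; apply: (le_trans (hh x)).
  rewrite mul1r ler_wpM2l // -[leLHS]mulr1 ler_wpM2l ?wgt_ge1 //.
  by rewrite mulr_ge0 ?expR_ge0 // ltW.
by have := wgt_ge1 s; lra.
Qed.

Lemma pic_cst c w s : cont2 w ->
  `|(pic c w).1 s - c.1| <= wgt s /\ `|(pic c w).2 s - c.2| <= wgt s.
Proof.
move=> cw; split; apply: picard_cst; rewrite /src1 /src2.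
- exact: cont_src1.
- by move=> x; apply: comb_le.
- exact: cont_src2.
- by move=> x; apply: comb_le.
Qed.

Lemma picard_exists c : exists w, cont2 w /\ (w.1 =1 (pic c w).1 /\ w.2 =1 (pic c w).2).
Proof.
pose u m := iter m (pic c) (fun=> c.1, fun=> c.2).
have cu m : cont2 (u m).
  elim: m => [|m ih]; first by split=> ?; exact: cvg_cst.
  exact: cont2_pic.
have du m : dist_le (2^-1 ^+ m) (u m.+1) (u m).
  elim: m => [|m ih]; first by move=> s; rewrite expr0 mul1r; exact: (pic_cst c s (cu 0)).
  have := @pic_contract c c (u m.+1) (u m) (2^-1 ^+ m) 0 (exp_half_ge0 R m) (cu _) (cu _).
  rewrite !subrr normr0 lexx => /(_ isT isT ih).
  by rewrite add0r exprSr.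
have lim1 s : exists l, forall m, `|(u m).1 s - l| <= 2 * wgt s * 2^-1 ^+ m.
  apply: geometric_cauchy; first exact: expR_ge0.
  by move=> m; rewrite mulrC; have [] := du m s.
have lim2 s : exists l, forall m, `|(u m).2 s - l| <= 2 * wgt s * 2^-1 ^+ m.
  apply: geometric_cauchy; first exact: expR_ge0.
  by move=> m; rewrite mulrC; have [] := du m s.
pose w := (fun s => sval (cid (lim1 s)), fun s => sval (cid (lim2 s))).
have w1 s m : `|(u m).1 s - w.1 s| <= 2 * wgt s * 2^-1 ^+ m by rewrite /w /=; case: cid => /=.
have w2 s m : `|(u m).2 s - w.2 s| <= 2 * wgt s * 2^-1 ^+ m by rewrite /w /=; case: cid => /=.
(* Convergence is uniform only locally; near [s] the weight is bounded by its value at |s| + 1. *)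
have ulim (v : nat -> R -> R) (l : R -> R) : (forall m, continuous (v m)) ->
    (forall s m, `|v m s - l s| <= 2 * wgt s * 2^-1 ^+ m) -> continuous l.
  move=> cv hv s; apply/cvgrPdist_lt => e e0.
  pose M := wgt (`|s| + 1).
  have M1 : 1 <= M by exact: wgt_ge1.
  have [m hm] : exists m, 2 * M * 2^-1 ^+ m < e / 3.
    apply: contrapT => /forallNP h.
    have : e / 3 <= 0; last by lra.
    apply: (@le_geometric0 R _ (2 * M) 0) => m; rewrite add0r leNgt; apply/negP; exact: h.
  have /cvgrPdist_lt /(_ (e/3)) := cv m s.
  move=> /(_ ltac:(lra)) [d /= d0 hd].
  exists (Num.min d 1) => /=; first by rewrite lt_min d0 ltr01.
  move=> t /=; rewrite lt_min => /andP[td t1'].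
  have := hd t td.
  have wt : wgt t <= M.
    apply: wgt_mono; rewrite [leRHS]ger0_norm; last by have := normr_ge0 s; lra.
    by have := ler_dist_dist t s; rewrite (distrC t s); have := ler_norm (`|t| - `|s|); lra.
  have ws : wgt s <= M.
    by apply: wgt_mono; rewrite [leRHS]ger0_norm; have := normr_ge0 s; lra.
  have q0 := exp_half_ge0 R m.
  have hr r : wgt r <= M -> `|v m r - l r| < e / 3.
    move=> wr; apply: (le_lt_trans (hv r m)); apply: le_lt_trans hm.
    by apply: ler_wpM2r => //; apply: ler_wpM2l.
  by have := hr _ ws; have := hr _ wt; rewrite !ltr_norml; lra.
have cw : cont2 w.
  split; [apply: (ulim (fun m => (u m).1)) => // m; exact: (cu m).1|].
  by apply: (ulim (fun m => (u m).2)) => // m; exact: (cu m).2.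
exists w; split => //.
have key m : dist_le (2 * 2^-1 ^+ m / 2) (u m.+1) (pic c w).
  have := @pic_contract c c (u m) w (2 * 2^-1 ^+ m) 0.
  rewrite !subrr normr0 lexx add0r; apply=> //.
  by move=> s; rewrite mulrAC; split.
split=> s; apply/eqP; rewrite -subr_eq0 -normr_le0;
  apply: (@le_geometric0 R _ (2 * wgt s) 0) => m; rewrite add0r.
  have [k1 _] := key m s; have := w1 s m.+1.
  have -> : w.1 s - (pic c w).1 s = ((u m.+1).1 s - (pic c w).1 s) - ((u m.+1).1 s - w.1 s) by ring.
  move=> k2; apply: (le_trans (ler_normB _ _)); move: k1 k2; rewrite exprS.
  by set q := _ ^+ m; lra.
have [_ k1] := key m s; have := w2 s m.+1.
have -> : w.2 s - (pic c w).2 s = ((u m.+1).2 s - (pic c w).2 s) - ((u m.+1).2 s - w.2 s) by ring.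
move=> k2; apply: (le_trans (ler_normB _ _)); move: k1 k2; rewrite exprS.
by set q := _ ^+ m; lra.
Qed.

Lemma picard_stable c c' w w' d : cont2 w -> cont2 w' ->
  w.1 =1 (pic c w).1 /\ w.2 =1 (pic c w).2 -> w'.1 =1 (pic c' w').1 /\ w'.2 =1 (pic c' w').2 ->
  `|c.1 - c'.1| <= d -> `|c.2 - c'.2| <= d -> dist_le (2 * d) w w'.
Proof.
move=> cw cw' [e1 e2] [e1' e2'] d1 d2.
have d0 : 0 <= d by apply: le_trans d1.
(* The map D -> d + D / 2 of [pic_contract] has fixed point 2 d. Iteration starts at 3 d + 2, more
   than the distance d + 2 obtained by comparing both solutions with their initial values. *)
have H m : dist_le (2 * d + (d + 2) * 2^-1 ^+ m) w w'.
  elim: m => [|m ih].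
    move=> s; rewrite expr0 mulr1.
    have [a1 a2] := pic_cst c s cw; have [a1' a2'] := pic_cst c' s cw'.
    rewrite -e1 in a1; rewrite -e2 in a2; rewrite -e1' in a1'; rewrite -e2' in a2'.
    have dw : d <= d * wgt s by rewrite -[leLHS]mulr1 ler_wpM2l // wgt_ge1.
    have d20 : 0 <= d * wgt s by apply: le_trans dw.
    by move: d1 d2 a1 a2 a1' a2'; rewrite !ler_norml; split; lra.
  move=> s; have := @pic_contract c c' w w' (2 * d + (d + 2) * 2^-1 ^+ m) d _ cw cw' d1 d2 ih s.
  rewrite -e1 -e2 -e1' -e2' exprS.
  have -> : d + (2 * d + (d + 2) * 2^-1 ^+ m) / 2 = 2 * d + (d + 2) * (2^-1 * 2^-1 ^+ m) by field.
  by apply; rewrite addr_ge0 ?mulr_ge0 ?exp_half_ge0 ?addr_ge0.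
move=> s; split; apply: (@le_geometric0 R _ ((d + 2) * wgt s)) => m; have [h1 h2] := H m s.
  by move: h1; set q := _ ^+ m; lra.
by move: h2; set q := _ ^+ m; lra.
Qed.

End Picard.

(** * Source terms: powers and truncated exponentials *)

Section Power.
Variable R : realType.
Implicit Types (N s z k : R).

(** Even extension of s^N, continuous on the whole line as the Picard operator requires. *)
Definition pw N s : R := `|s| `^ N.

Lemma pw_ge0 N s : 0 <= pw N s.
Proof. exact: powR_ge0. Qed.

Lemma pwE N s : 0 <= s -> pw N s = s `^ N.
Proof. by rewrite /pw => /ger0_norm ->. Qed.

Lemma pw_mono N s z : 0 <= N -> `|s| <= `|z| -> pw N s <= pw N z.
Proof. by move=> N0 h; apply: ge0_ler_powR => //; rewrite nnegrE. Qed.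

Lemma continuous_pw N : 0 <= N -> continuous (pw N).
Proof.
move=> N0 s; have [->|s0] := eqVneq s 0; last first.
  apply: (@continuous_comp _ _ _ (fun s => `|s|) (fun s => s `^ N)).
    exact: norm_continuous.
  by apply: der_cont; apply: der_powR; rewrite normr_gt0.
move: N0; rewrite le_eqVlt => /predU1P[<-|N0].
  rewrite /pw; under eq_fun do rewrite powRr0; exact: cvg_cst.
apply/cvgrPdist_lt => e e0.
have /cvgrPdist_lt /(_ e e0) [d /= d0 hd] := powR_cvg0 N0.
exists d => // t td.
rewrite /pw normr0 powR0 ?gt_eqF //.
have [->|t0] := eqVneq t 0; first by rewrite normr0 powR0 ?gt_eqF // subrr normr0.
apply: hd; last by rewrite normr_gt0.
by move: td => /=; rewrite !sub0r !normrN normr_id.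
Qed.

Lemma pw_le_expR N n s : 0 <= N -> N <= n -> pw N s <= expR (n * `|s|).
Proof.
move=> N0 Nn.
have h : `|s| <= expR `|s| by have := expR_ge1Dx `|s|; lra.
apply: (le_trans (ge0_ler_powR N0 _ _ h)); rewrite ?nnegrE ?expR_ge0 //.
by rewrite -expRM mulrC ler_expR ler_wpM2r.
Qed.

(** The exponential is not globally Lipschitz. Capping its argument makes it so, and Picard
    iteration then converges on the whole line at once; the cap is shown later to be inactive. *)
Definition trunc_exp k z : R := expR (Num.min z k).

Lemma trunc_exp_le k z : trunc_exp k z <= expR k.
Proof. by rewrite ler_expR ge_min lexx orbT. Qed.

Lemma trunc_expE k z : z <= k -> trunc_exp k z = expR z.
Proof. by move=> h; rewrite /trunc_exp min_l. Qed.

Lemma trunc_exp_lip k y z : `|trunc_exp k y - trunc_exp k z| <= expR k * `|y - z|.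
Proof.
wlog yz : y z / y <= z.
  move=> h; have [/h //|/ltW /h] := leP y z.
  by rewrite distrC (distrC z).
have e1 : trunc_exp k y <= trunc_exp k z by rewrite ler_expR le_min !ge_min yz lexx orbT.
have := trunc_exp_le k z; move: e1; rewrite /trunc_exp.
set a := Num.min y k; set b := Num.min z k => e1 e2.
have [ab bz] : a <= b /\ b - a <= z - y.
  by rewrite /a /b; case: (leP y k); case: (leP z k); lra.
rewrite ler0_norm ?subr_le0 // ler0_norm ?subr_le0 // !opprB.
have h : expR b - expR a <= expR b * (b - a).
  have := expR_ge1Dx (a - b); rewrite expRD expRN => h.
  have := expR_gt0 b => b0.
  have : expR b * (1 + (a - b)) <= expR b * (expR a / expR b) by rewrite ler_pM2l.
  by rewrite mulrCA mulfV ?gt_eqF // mulr1; lra.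
apply: (le_trans h); apply: ler_pM => //; lra.
Qed.

Lemma continuous_trunc_exp k (w : R -> R) : continuous w -> continuous (fun s => trunc_exp k (w s)).
Proof.
move=> cw s; apply: (@continuous_comp _ _ _ (fun s => Num.min (w s) k) expR); last exact: continuous_expR.
by apply: (@continuous_min R R w (fun=> k)); [exact: cw|exact: cvg_cst].
Qed.

End Power.

(** * The change of variable s = e^(2 t) *)

Section RadialToda.
Variable R : realType.
Variables (N1 N2 tau : R) (w1 w2 X Y : R -> R).

Lemma der_exp2 (t : R) : der (fun t : R => expR (2 * t)) t (2 * expR (2 * t)).
Proof. by apply: derE; [apply: der_exp; apply: derZ; exact: der_id|ring]. Qed.

Lemma cvg_exp2_ninfty (f : R -> R) (l : R) :
  (f s @[s --> 0^'+] --> l) -> f (expR (2 * t)) @[t --> -oo] --> l.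
Proof.
move=> cf; apply/cvgrPdist_lt => e e0.
have /cvgrPdist_lt /(_ e e0) [d /= d0 hd] := cf.
exists (ln d / 2); split; first exact: num_real.
move=> t tl; apply: hd; last exact: expR_gt0.
rewrite /= sub0r normrN gtr0_norm ?expR_gt0 //.
by rewrite -[ltRHS]lnK // ltr_expR; lra.
Qed.

Lemma cvg_exp2_pinfty (f : R -> R) (l : R) :
  (f s @[s --> +oo] --> l) -> f (expR (2 * t)) @[t --> +oo] --> l.
Proof.
move=> cf; apply/cvgrPdist_lt => e e0.
have /cvgrPdist_lt /(_ e e0) [M [Mr hM]] := cf.
exists (`|M|); split; first exact: num_real.
move=> t tl; apply: hM.
have := expR_ge1Dx (2 * t); have := ler_norm M; have := normr_ge0 M; move: tl => /=; lra.
Qed.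

(** The flux (1 / (2 pi)) times the integral over |x|^2 < s is one half of an integral in s, whence
    the 1/2 in X' and Y'. Since ds = 2 s dt, the integrand becomes s^(N + 1) e^w, that is e^u with u
    = w + 2 (N + 1) t. *)
Lemma radial_toda T :
  (forall s, 0 < s < expR (2 * T) -> der X s (2^-1 * (s `^ N1 * expR (w1 s)))) ->
  (forall s, 0 < s < expR (2 * T) -> der Y s (2^-1 * (s `^ N2 * expR (w2 s)))) ->
  (forall s, 0 < s < expR (2 * T) -> der w1 s (- (X s - tau * Y s) / (2 * s))) ->
  (forall s, 0 < s < expR (2 * T) -> der w2 s (- (Y s - tau * X s) / (2 * s))) ->
  (X s @[s --> 0^'+] --> (0 : R)) -> (Y s @[s --> 0^'+] --> (0 : R)) ->
  toda (2 * (N1 + 1)) (2 * (N2 + 1)) tau T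
    (fun t => w1 (expR (2 * t)) + 2 * (N1 + 1) * t)
    (fun t => w2 (expR (2 * t)) + 2 * (N2 + 1) * t)
    (fun t => X (expR (2 * t))) (fun t => Y (expR (2 * t))).
Proof.
move=> dX dY d1 d2 X0 Y0.
have rng t : t < T -> 0 < expR (2 * t) < expR (2 * T).
  by move=> tT; rewrite expR_gt0 ltr_expR; lra.
have eE N t w : 2^-1 * (expR (2 * t) `^ N * expR w) * (2 * expR (2 * t)) =
    expR (w + 2 * (N + 1) * t).
  have -> : w + 2 * (N + 1) * t = w + (2 * t) * N + 2 * t by ring.
  by rewrite 2!expRD (expRM (2 * t)); field.
split.
- move=> t tT; rewrite -eE; apply: (@der_comp R X); last exact: der_exp2.
  exact: dX (rng t tT).
- move=> t tT; rewrite -eE; apply: (@der_comp R Y); last exact: der_exp2.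
  exact: dY (rng t tT).
- move=> t tT; apply: derE.
    apply: derD; last by apply: derZ; exact: der_id.
    by apply: (@der_comp R w1); [exact: d1 (rng t tT)|exact: der_exp2].
  by field; rewrite gt_eqF // expR_gt0.
- move=> t tT; apply: derE.
    apply: derD; last by apply: derZ; exact: der_id.
    by apply: (@der_comp R w2); [exact: d2 (rng t tT)|exact: der_exp2].
  by field; rewrite gt_eqF // expR_gt0.
- exact: cvg_exp2_ninfty.
- exact: cvg_exp2_ninfty.
Qed.

End RadialToda.

(** * Derivative and one-sided bounds of the Picard operator *)

Section FixedPoint.
Variable R : realType.

Lemma prim_lin (h k : R -> R) (a s : R) : continuous h -> continuous k ->
  prim (fun s => h s - a * k s) s = prim h s - a * prim k s.
Proof.
move=> ch ck.
have cg : continuous (fun s => h s - a * k s).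
  by move=> t; apply: cvgB; [exact: ch|apply: cvgMr; exact: ck].
pose d t := prim (fun s => h s - a * k s) t - (prim h t - a * prim k t).
have hd t : der d t 0.
  apply: derE.
    apply: derB; first exact: der_prim.
    by apply: derB; [exact: der_prim|apply: derZ; exact: der_prim].
  by rewrite subrr.
have := is_derive_0_is_cst s 0 hd.
by rewrite /d !prim0 // mulr0 !subr0 => /eqP; rewrite subr_eq0 => /eqP.
Qed.

Lemma der_picard (c : R) (h : R -> R) s : continuous h -> 0 < s ->
  der (picard c h) s (- prim h s / (4 * s)).
Proof.
move=> ch s0.
apply: (@der_near R (fun s => c - 4^-1 * prim (mean h) s)).
  near=> t; rewrite /picard gtr0_norm //; near: t.
  by exists s => // t /=; rewrite ltr_norml; lra.
apply: derE.
  apply: derB; first exact: der_cst.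
  by apply: derZ; apply: der_prim; exact: continuous_mean.
by rewrite -mul_mean //; field; rewrite gt_eqF.
Unshelve. all: by end_near. Qed.

(** Only a lower bound on the source matters for an upper bound on the solution. It passes through
    two successive averages, each replaced by a value at an intermediate point of [0, s]. *)
Lemma picard_le (c B : R) (h : R -> R) s : continuous h -> 0 <= s ->
  (forall r, 0 <= r <= s -> - B <= h r) -> picard c h s <= c + 4^-1 * (s * B).
Proof.
move=> ch s0 hB; rewrite /picard ger0_norm //.
have cm := continuous_mean ch.
rewrite -(mul_mean s cm).
have [x /andP[xs sx] ->] := mean_mvt s cm.
have [y /andP[yx xy] ->] := mean_mvt x ch.
have hs : `|s| = s by rewrite ger0_norm.
have [->|sn] := eqVneq s 0; first by rewrite !mul0r; lra.
have sp : 0 < s by rewrite lt_neqAle eq_sym sn.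
have x0 : 0 <= x by move: sx; rewrite pmulr_rge0.
have [xe|xn] := eqVneq x 0.
  move: yx; rewrite xe normr0 normr_le0 => /eqP ->.
  have : - B <= h 0 by apply: hB; rewrite lexx s0.
  nra.
have y0 : 0 <= y by move: xy; rewrite pmulr_rge0 // lt_neqAle eq_sym xn.
move: yx xs; rewrite hs (ger0_norm x0) (ger0_norm y0) => yx xs.
have : - B <= h y by apply: hB; rewrite y0 (le_trans yx).
nra.
Qed.

Lemma prim_bounds (B : R) (h : R -> R) s : continuous h -> 0 <= s ->
  (forall r, 0 <= r <= s -> 0 <= h r <= B) -> 0 <= prim h s <= s * B.
Proof.
move=> ch s0 hB.
have := @der_le2 R (fun=> 0) (fun=> 0) (prim h) h 0 s s0 (fun x _ => der_cst 0 x) (fun x _ => der_prim x ch).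
have := @der_le2 R (prim h) h (fun r => B * r) (fun=> B) 0 s s0 (fun x _ => der_prim x ch).
have hd : forall x, 0 <= x <= s -> der (fun r => B * r) x B.
  by move=> x _; apply: derE; [apply: derZ; exact: der_id|rewrite mulr1].
move=> /(_ hd); rewrite prim0 // => h1 h2.
have a1 : forall x, 0 <= x <= s -> h x <= B by move=> x /hB /andP[].
have a2 : forall x, 0 <= x <= s -> 0 <= h x by move=> x /hB /andP[].
have := h1 a1; have := h2 a2; lra.
Qed.

Lemma first_exit (m : R -> R) (s1 : R) : continuous m -> m 0 < 0 -> 0 <= s1 -> 0 <= m s1 ->
  exists s, [/\ 0 < s, 0 <= m s & forall r, 0 <= r < s -> m r < 0].
Proof.
move=> cm m0 s10 ms1.
pose B := [set s | 0 <= s /\ 0 <= m s].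
have Bi : has_inf B by split; [exists s1|exists 0 => x []].
have i0 : 0 <= inf B by apply: lb_le_inf; [exists s1|move=> x []].
have mi : 0 <= m (inf B).
  rewrite leNgt; apply/negP => mi.
  have /cvgrPdist_lt /(_ (- m (inf B))) := cm (inf B).
  move=> /(_ ltac:(lra)) [d /= d0 hd].
  have [e [e0 me] eB] := inf_adherent d0 Bi.
  have ei : inf B <= e by apply: ge_inf => //; exact: Bi.2.
  have := hd e; rewrite /= ltr_norml; move=> /(_ ltac:(lra)).
  by rewrite ltr_norml; lra.
exists (inf B); split => //.
  rewrite lt_neqAle i0 andbT; apply/eqP => e; move: mi; rewrite -e; lra.
move=> r /andP[r0 ri]; rewrite ltNge; apply/negP => mr.
have : inf B <= r by apply: ge_inf => //; exact: Bi.2.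
lra.
Qed.

End FixedPoint.

(** * Global solutions of the truncated system, and removal of the truncation *)

Section Family.
Variable R : realType.
Variables (N1 N2 tau : R).
Hypotheses (N10 : 0 <= N1) (N20 : 0 <= N2) (t0 : 0 < tau) (t1 : tau < 1).

Let p := 2 * (N1 + 1).
Let q := 2 * (N2 + 1).
Let p0 : 0 < p. Proof. by have := N10; rewrite /p; lra. Qed.
Let q0 : 0 < q. Proof. by have := N20; rewrite /q; lra. Qed.

(* Solutions with initial values <= 0 never reach [cap1] and [cap2]
   ([fixed_lt_cap]), so the truncation in [nl1] and [nl2] is inactive for them.
   Near 0 this follows from the smallness of the correction term; for
   s >= exp (- cap_shift) from the bound [toda_max] on e^u. *)
Definition cap_log : R := ln (toda_max p q tau + toda_max q p tau) + 1.
Definition cap_shift : R := expR cap_log + `|cap_log| + 1.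
Definition cap1 := cap_log + (N1 + 1) * cap_shift.
Definition cap2 := cap_log + (N2 + 1) * cap_shift.

Definition nl1 s z : R := pw N1 s * trunc_exp cap1 z.
Definition nl2 s z : R := pw N2 s * trunc_exp cap2 z.

(** One growth rate for both sources. The summand 1 keeps it positive when both exponents vanish,
    because the weight divides by it. *)
Let n := N1 + N2 + 1.
Let K := expR cap1 + expR cap2.
Let n0 : 0 < n. Proof. by have := N10; have := N20; rewrite /n; lra. Qed.
Let K0 : 0 < K. Proof. by rewrite addr_gt0 ?expR_gt0. Qed.

Let nl_cont N k (w : R -> R) : 0 <= N -> continuous w ->
  continuous (fun s => pw N s * trunc_exp k (w s)).
Proof.
move=> N0 cw s; apply: cvgM; first exact: continuous_pw.
exact: continuous_trunc_exp.
Qed.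

Let nl_bd N k s z : 0 <= N -> N <= n -> expR k <= K ->
  `|pw N s * trunc_exp k z| <= K * expR (n * `|s|).
Proof.
move=> N0 Nn kK; rewrite mulrC normrM; apply: ler_pM => //.
  by rewrite ger0_norm ?expR_ge0 // (le_trans (trunc_exp_le _ _)).
by rewrite ger0_norm ?pw_ge0 // pw_le_expR.
Qed.

Let nl_lip N k s y z : 0 <= N -> N <= n -> expR k <= K ->
  `|pw N s * trunc_exp k y - pw N s * trunc_exp k z| <= K * expR (n * `|s|) * `|y - z|.
Proof.
move=> N0 Nn kK; rewrite -mulrBr normrM (mulrC K) -mulrA; apply: ler_pM => //.
  by rewrite ger0_norm ?pw_ge0 // pw_le_expR.
apply: (le_trans (trunc_exp_lip _ _ _)); exact: ler_wpM2r.
Qed.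

Let N1n : N1 <= n. Proof. by have := N10; have := N20; rewrite /n; lra. Qed.
Let N2n : N2 <= n. Proof. by have := N10; have := N20; rewrite /n; lra. Qed.
Let k1K : expR cap1 <= K. Proof. by rewrite lerDl expR_ge0. Qed.
Let k2K : expR cap2 <= K. Proof. by rewrite lerDr expR_ge0. Qed.

Definition fixed (c : R * R) (w : (R -> R) * (R -> R)) :=
  cont2 w /\ (w.1 =1 (pic nl1 nl2 tau c w).1 /\ w.2 =1 (pic nl1 nl2 tau c w).2).

Lemma fixed_exists c : exists w, fixed c w.
Proof.
by apply: (@picard_exists R K n K0 n0 nl1 nl2 tau t0 t1);
  [move=> w; exact: nl_cont|move=> w; exact: nl_cont|move=> s y z; exact: nl_lip|
   move=> s y z; exact: nl_lip|move=> s z; exact: nl_bd|move=> s z; exact: nl_bd].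
Qed.

Lemma fixed_stable c c' w w' d : fixed c w -> fixed c' w' ->
  `|c.1 - c'.1| <= d -> `|c.2 - c'.2| <= d -> dist_le K n (2 * d) w w'.
Proof.
move=> [cw ew] [cw' ew'] d1 d2.
apply: (@picard_stable R K n K0 n0 nl1 nl2 tau t0 t1 _ _ _ _ _ _ c c' w w' d) => //;
  [move=> ?; exact: nl_cont|move=> ?; exact: nl_cont|move=> s y z; exact: nl_lip|
   move=> s y z; exact: nl_lip|move=> s z; exact: nl_bd|move=> s z; exact: nl_bd].
Qed.

Definition mass1 (w : (R -> R) * (R -> R)) s := 2^-1 * prim (fun s => nl1 s (w.1 s)) s.
Definition mass2 (w : (R -> R) * (R -> R)) s := 2^-1 * prim (fun s => nl2 s (w.2 s)) s.

(** The left side is the largest correction that [small_le] allows near 0; [cap_shift] was chosen to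
    exceed e^(cap_log) + |cap_log|, which puts the caps above it. *)
Lemma cap_shift_gt N : 0 <= N -> expR cap_log / 4 < cap_log + (N + 1) * cap_shift.
Proof.
move=> N0; have h : cap_shift <= (N + 1) * cap_shift.
  rewrite -[leLHS]mul1r ler_wpM2r //; last lra.
  by rewrite /cap_shift; have := expR_ge0 cap_log; have := normr_ge0 cap_log; lra.
have := ler_norm (- cap_log); rewrite normrN.
by move: h; rewrite {2}/cap_shift; have := expR_gt0 cap_log; rewrite /cap_shift; lra.
Qed.

(** Lipschitz dependence at a fixed radius: [C] depends on [s] but on none of the solutions. No
    uniformity as s tends to +oo is claimed. *)
Lemma mass_stable s : 0 <= s -> exists2 C, 0 <= C & forall c c' w w' d,
  fixed c w -> fixed c' w' -> `|c.1 - c'.1| <= d -> `|c.2 - c'.2| <= d ->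
  `|mass1 w s - mass1 w' s| <= C * d /\ `|mass2 w s - mass2 w' s| <= C * d.
Proof.
move=> s0; exists (s * (K * expR (n * s) * wgt K n s)).
  by rewrite !mulr_ge0 ?expR_ge0 // ltW.
move=> c c' w w' d Hw Hw' h1 h2.
have d0 : 0 <= d by apply: le_trans h1.
have key N k (f g : R -> R) : 0 <= N -> N <= n -> expR k <= K -> continuous f -> continuous g ->
    (forall r, `|f r - g r| <= 2 * d * wgt K n r) ->
    `|2^-1 * prim (fun s => pw N s * trunc_exp k (f s)) s -
      2^-1 * prim (fun s => pw N s * trunc_exp k (g s)) s| <=
    s * (K * expR (n * s) * wgt K n s) * d.
  move=> N0 Nn kK cf cg hfg.
  have [cF cG] := (@nl_cont N k f N0 cf, @nl_cont N k g N0 cg).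
  rewrite -!mul_mean // -mulrBr -mulrBr normrM normrM (ger0_norm s0) ger0_norm ?invr_ge0 //.
  have [x /andP[xs _] ->] := mean_sub_mvt s cF cG.
  have b1 := @nl_lip N k x (f x) (g x) N0 Nn kK.
  have b2 : K * expR (n * `|x|) * `|f x - g x| <= K * expR (n * s) * (2 * d * wgt K n s).
    apply: ler_pM => //; first by rewrite mulr_ge0 ?expR_ge0 // ltW.
      rewrite ler_wpM2l ?(ltW K0) // ler_expR ler_wpM2l ?(ltW n0) //.
      by rewrite -(ger0_norm s0).
    apply: (le_trans (hfg x)); rewrite ler_wpM2l ?mulr_ge0 //.
    exact: (wgt_mono K0 n0).
  have := le_trans b1 b2; set Z := `|_| => hZ.
  have : s * Z <= s * (K * expR (n * s) * (2 * d * wgt K n s)) by rewrite ler_wpM2l.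
  lra.
have st := fixed_stable Hw Hw' h1 h2.
split; apply: key => //.
- exact: Hw.1.1.
- exact: Hw'.1.1.
- by move=> r; have [] := st r.
- exact: Hw.1.2.
- exact: Hw'.1.2.
- by move=> r; have [] := st r.
Qed.

Section Solution.
Variables (c : R * R) (w : (R -> R) * (R -> R)).
Hypothesis Hw : fixed c w.
Hypotheses (c1 : c.1 <= 0) (c2 : c.2 <= 0).

Let ch1 : continuous (fun s => nl1 s (w.1 s)).
Proof. by apply: nl_cont => //; exact: Hw.1.1. Qed.
Let ch2 : continuous (fun s => nl2 s (w.2 s)).
Proof. by apply: nl_cont => //; exact: Hw.1.2. Qed.

Let csrc1 : continuous (src1 nl1 nl2 tau w).
Proof. by move=> s; apply: cvgB; [exact: ch1|apply: cvgMr; exact: ch2]. Qed.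
Let csrc2 : continuous (src2 nl1 nl2 tau w).
Proof. by move=> s; apply: cvgB; [exact: ch2|apply: cvgMr; exact: ch1]. Qed.

(** Only the cross term -tau times the second source can raise the first component, and the
    truncation bounds it. *)
Lemma fixed_le1 s : 0 <= s -> w.1 s <= c.1 + 4^-1 * (s * (s `^ N2 * expR cap2)).
Proof.
move=> s0; rewrite Hw.2.1; apply: picard_le => // r /andP[r0 rs].
rewrite /src1.
have a1 : 0 <= nl1 r (w.1 r) by rewrite mulr_ge0 ?pw_ge0 ?expR_ge0.
have a2 : nl2 r (w.2 r) <= s `^ N2 * expR cap2.
  apply: ler_pM; rewrite ?pw_ge0 ?expR_ge0 ?trunc_exp_le //.
  by rewrite -pwE //; apply: pw_mono => //; rewrite !ger0_norm.
have a3 : 0 <= nl2 r (w.2 r) by rewrite mulr_ge0 ?pw_ge0 ?expR_ge0.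
have := t0; have := t1; nra.
Qed.

Lemma fixed_le2 s : 0 <= s -> w.2 s <= c.2 + 4^-1 * (s * (s `^ N1 * expR cap1)).
Proof.
move=> s0; rewrite Hw.2.2; apply: picard_le => // r /andP[r0 rs].
rewrite /src2.
have a1 : 0 <= nl2 r (w.2 r) by rewrite mulr_ge0 ?pw_ge0 ?expR_ge0.
have a2 : nl1 r (w.1 r) <= s `^ N1 * expR cap1.
  apply: ler_pM; rewrite ?pw_ge0 ?expR_ge0 ?trunc_exp_le //.
  by rewrite -pwE //; apply: pw_mono => //; rewrite !ger0_norm.
have a3 : 0 <= nl1 r (w.1 r) by rewrite mulr_ge0 ?pw_ge0 ?expR_ge0.
have := t0; have := t1; nra.
Qed.

Let dw1 s : 0 < s -> der w.1 s (- (mass1 w s - tau * mass2 w s) / (2 * s)).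
Proof.
move=> s0; have h := der_picard c.1 csrc1 s0.
have -> : w.1 = picard c.1 (src1 nl1 nl2 tau w) by apply/funext => r; exact: Hw.2.1.
apply: derE h _.
by rewrite /src1 prim_lin // /mass1 /mass2; field; rewrite gt_eqF.
Qed.

Let dw2 s : 0 < s -> der w.2 s (- (mass2 w s - tau * mass1 w s) / (2 * s)).
Proof.
move=> s0; have h := der_picard c.2 csrc2 s0.
have -> : w.2 = picard c.2 (src2 nl1 nl2 tau w) by apply/funext => r; exact: Hw.2.2.
apply: derE h _.
by rewrite /src2 prim_lin // /mass1 /mass2; field; rewrite gt_eqF.
Qed.

Let dm1 s : der (mass1 w) s (2^-1 * nl1 s (w.1 s)).
Proof. by apply: derZ; exact: der_prim. Qed.
Let dm2 s : der (mass2 w) s (2^-1 * nl2 s (w.2 s)).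
Proof. by apply: derZ; exact: der_prim. Qed.

Let m10 : mass1 w s @[s --> 0^'+] --> (0 : R).
Proof.
have e : mass1 w 0 = 0 by rewrite /mass1 prim0 ?mulr0.
have h : mass1 w s @[s --> (0 : R)] --> mass1 w 0 := der_cont (dm1 0).
by apply: cvg_at_right_filter; rewrite -[X in _ --> X]e.
Qed.

Let m20 : mass2 w s @[s --> 0^'+] --> (0 : R).
Proof.
have e : mass2 w 0 = 0 by rewrite /mass2 prim0 ?mulr0.
have h : mass2 w s @[s --> (0 : R)] --> mass2 w 0 := der_cont (dm2 0).
by apply: cvg_at_right_filter; rewrite -[X in _ --> X]e.
Qed.

Let toda_local T : (forall s, 0 < s < expR (2 * T) -> w.1 s <= cap1 /\ w.2 s <= cap2) ->
  toda p q tau T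
    (fun t => w.1 (expR (2 * t)) + p * t) (fun t => w.2 (expR (2 * t)) + q * t)
    (fun t => mass1 w (expR (2 * t))) (fun t => mass2 w (expR (2 * t))).
Proof.
move=> h; apply: radial_toda => //.
- move=> s hs; apply: derE (dm1 s) _.
  rewrite /nl1 trunc_expE; last exact: (h s hs).1.
  by rewrite pwE //; case/andP: hs => /ltW.
- move=> s hs; apply: derE (dm2 s) _.
  rewrite /nl2 trunc_expE; last exact: (h s hs).2.
  by rewrite pwE //; case/andP: hs => /ltW.
- by move=> s /andP[s0 _]; exact: dw1.
- by move=> s /andP[s0 _]; exact: dw2.
Qed.

(** This explains the term (N + 1) [cap_shift] in the caps: for s <= e^(-cap_shift) the factor s^(N
    + 1) cancels exactly its exponential. *)
Let small_le N s : 0 <= N -> 0 <= s -> s <= expR (- cap_shift) ->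
  4^-1 * (s * (s `^ N * expR (cap_log + (N + 1) * cap_shift))) <= expR cap_log / 4.
Proof.
move=> N0 s0 ss; rewrite mulrC ler_wpM2r ?invr_ge0 //.
have h : s `^ N <= expR (- cap_shift * N).
  by rewrite expRM; apply: ge0_ler_powR; rewrite // nnegrE ?expR_ge0.
have h2 : s * (s `^ N * expR (cap_log + (N + 1) * cap_shift)) <=
   expR (- cap_shift) * (expR (- cap_shift * N) * expR (cap_log + (N + 1) * cap_shift)).
  apply: ler_pM => //; first by rewrite mulr_ge0 ?powR_ge0 ?expR_ge0.
  by rewrite ler_wpM2r ?expR_ge0.
apply: (le_trans h2); rewrite -!expRD ler_expR.
by rewrite le_eqVlt; apply/orP; left; apply/eqP; ring.
Qed.

(** From e^u <= M with u = z + (N + 1) ln s one gets z <= ln M + (N + 1) [cap_shift]. The summand 1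
    in [cap_log] becomes a margin of 1 below the cap. *)
Let big_le N s M z : 0 <= N -> 0 < M -> M <= toda_max p q tau + toda_max q p tau ->
  expR (- cap_shift) <= s -> expR (z + 2 * (N + 1) * (ln s / 2)) <= M ->
  z <= cap_log + (N + 1) * cap_shift - 1.
Proof.
move=> N0 M0 MM ss h.
have s0 : 0 < s by apply: lt_le_trans ss; exact: expR_gt0.
have l1 : - cap_shift <= ln s by rewrite -(expRK (- cap_shift)) ler_ln ?posrE ?expR_gt0.
have : z + 2 * (N + 1) * (ln s / 2) <= ln (toda_max p q tau + toda_max q p tau).
  rewrite -(expRK (z + _)) ler_ln ?posrE ?expR_gt0 //; last exact: lt_le_trans MM.
  exact: le_trans MM.
have : (N + 1) * (- cap_shift) <= (N + 1) * ln s by rewrite ler_wpM2l //; lra.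
by rewrite /cap_log; lra.
Qed.

Lemma fixed_lt_cap s : 0 <= s -> w.1 s < cap1 /\ w.2 s < cap2.
Proof.
have sm r : 0 <= r -> r <= expR (- cap_shift) -> w.1 r < cap1 /\ w.2 r < cap2.
  move=> r0 rs; split.
    apply: le_lt_trans (fixed_le1 r0) _; have := small_le N20 r0 rs.
    by have := cap_shift_gt N10; have := c1; rewrite /cap1 /cap2; lra.
  apply: le_lt_trans (fixed_le2 r0) _; have := small_le N10 r0 rs.
  by have := cap_shift_gt N20; have := c2; rewrite /cap1 /cap2; lra.
pose m r := Num.max (w.1 r - cap1) (w.2 r - cap2).
have cm : continuous m.
  move=> r; apply: (@continuous_max R R (fun r => w.1 r - cap1) (fun r => w.2 r - cap2)).
    by apply: cvgB; [exact: Hw.1.1|exact: cvg_cst].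
  by apply: cvgB; [exact: Hw.1.2|exact: cvg_cst].
have mlt r : (m r < 0) = (w.1 r < cap1) && (w.2 r < cap2).
  by rewrite /m gt_max !subr_lt0.
move=> s0; apply/andP; rewrite -mlt ltNge; apply/negP => ms.
have m00 : m 0 < 0 by rewrite mlt; apply/andP; apply: sm; rewrite ?expR_ge0.
have [e [e0 me hm]] := first_exit cm m00 s0 ms.
have es : expR (- cap_shift) < e.
  rewrite ltNge; apply/negP => h; move: me; rewrite leNgt mlt.
  by have [-> ->] := sm e (ltW e0) h.
have good r : 0 < r < e -> w.1 r < cap1 /\ w.2 r < cap2.
  by move=> /andP[r0 re]; apply/andP; rewrite -mlt hm // ltW.
pose T := ln e / 2.
have eT : expR (2 * T) = e by rewrite /T mulrCA divff // mulr1 lnK.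
(* Before the first exit radius [e] the truncation is inactive, so the genuine Toda system holds on
   s < e and its a priori bound applies. *)
have TT : toda p q tau T
    (fun t => w.1 (expR (2 * t)) + p * t) (fun t => w.2 (expR (2 * t)) + q * t)
    (fun t => mass1 w (expR (2 * t))) (fun t => mass2 w (expR (2 * t))).
  by apply: toda_local => r; rewrite eT => /good [/ltW ? /ltW ?].
(* At a radius [r] slightly below [e] both components are at least 1 below their caps; changing by
   less than 1 from [r] to [e], they cannot reach the caps at [e]. *)
have [/cvgrPdist_lt k1 /cvgrPdist_lt k2] := (Hw.1.1 e, Hw.1.2 e).
have [d1 /= d10 h1] := k1 1 ltr01.
have [d2 /= d20 h2] := k2 1 ltr01.
pose d := Num.min (Num.min d1 d2) (e - expR (- cap_shift)).
have d0 : 0 < d by rewrite /d !lt_min d10 d20 subr_gt0.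
have [dd1 dd2 dd3] : [/\ d <= d1, d <= d2 & d <= e - expR (- cap_shift)].
  by rewrite /d; split; rewrite !ge_min lexx ?orbT.
pose r := e - d / 2.
have rs : expR (- cap_shift) <= r by rewrite /r; lra.
have r0 : 0 < r by apply: lt_le_trans rs; exact: expR_gt0.
have rT : ln r / 2 < T.
  by rewrite /T ltr_pM2r ?invr_gt0 // ltr_ln ?posrE // /r; lra.
have E2 : expR (2 * (ln r / 2)) = r by rewrite mulrCA divff // mulr1 lnK.
have := toda_exp_le p0 q0 t0 t1 TT rT; rewrite E2 => b1.
have := toda_exp_le q0 p0 t0 t1 (toda_sym TT) rT; rewrite E2 => b2.
have M1 : 0 < toda_max p q tau by apply: lt_le_trans b1; exact: expR_gt0.
have M2 : 0 < toda_max q p tau by apply: lt_le_trans b2; exact: expR_gt0.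
have g1 := big_le N10 M1 _ rs b1; have g2 := big_le N20 M2 _ rs b2.
have := g1 ltac:(lra); have := g2 ltac:(lra).
have := h1 r; have := h2 r; rewrite /= (_ : e - r = d / 2); last by rewrite /r; ring.
rewrite ger0_norm; last lra.
move=> /(_ ltac:(lra)) + /(_ ltac:(lra)).
rewrite !ltr_norml => l2 l1.
suff : m e < 0 by lra.
by rewrite mlt /cap1 /cap2; apply/andP; split; lra.
Qed.

Lemma fixed_toda T : toda p q tau T
    (fun t => w.1 (expR (2 * t)) + p * t) (fun t => w.2 (expR (2 * t)) + q * t)
    (fun t => mass1 w (expR (2 * t))) (fun t => mass2 w (expR (2 * t))).
Proof.
by apply: toda_local => s /andP[/ltW s0 _]; have [/ltW ? /ltW ?] := fixed_lt_cap s0.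
Qed.

Lemma fixed_at0 : w.1 0 = c.1 /\ w.2 0 = c.2.
Proof.
have cm1 := continuous_mean csrc1; have cm2 := continuous_mean csrc2.
by split; rewrite ?Hw.2.1 ?Hw.2.2 /= /picard normr0 prim0 // mulr0 subr0.
Qed.

(** The factor after e^(c.2) is independent of the initial values, so the flux through a fixed disc
    tends to 0 as c.2 tends to -oo. *)
Lemma mass2_le s : 0 <= s -> mass2 w s <=
  expR c.2 * (2^-1 * (s * (s `^ N2 * expR (4^-1 * (s * (s `^ N1 * expR cap1)))))).
Proof.
move=> s0; rewrite /mass2.
have := @prim_bounds R (s `^ N2 * expR (c.2 + 4^-1 * (s * (s `^ N1 * expR cap1)))) _ s ch2 s0.
have H : forall r, 0 <= r <= s -> 0 <= nl2 r (w.2 r) <=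
    s `^ N2 * expR (c.2 + 4^-1 * (s * (s `^ N1 * expR cap1))).
  move=> r /andP[r0 rs]; rewrite mulr_ge0 ?pw_ge0 ?expR_ge0 //=.
  apply: ler_pM; rewrite ?pw_ge0 ?expR_ge0 //.
    by rewrite -pwE //; apply: pw_mono => //; rewrite !ger0_norm.
  rewrite ler_expR ge_min; apply/orP; left; apply: (le_trans (fixed_le2 r0)).
  rewrite lerD2l ler_wpM2l ?invr_ge0 //; apply: ler_pM => //.
    by rewrite mulr_ge0 ?powR_ge0 ?expR_ge0.
  rewrite ler_wpM2r ?expR_ge0 // -!pwE //; apply: pw_mono => //; by rewrite !ger0_norm.
move=> /(_ H) /andP[_]; rewrite expRD; lra.
Qed.

Lemma mass1_le s : 0 <= s -> mass1 w s <=
  expR c.1 * (2^-1 * (s * (s `^ N1 * expR (4^-1 * (s * (s `^ N2 * expR cap2)))))).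
Proof.
move=> s0; rewrite /mass1.
have := @prim_bounds R (s `^ N1 * expR (c.1 + 4^-1 * (s * (s `^ N2 * expR cap2)))) _ s ch1 s0.
have H : forall r, 0 <= r <= s -> 0 <= nl1 r (w.1 r) <=
    s `^ N1 * expR (c.1 + 4^-1 * (s * (s `^ N2 * expR cap2))).
  move=> r /andP[r0 rs]; rewrite mulr_ge0 ?pw_ge0 ?expR_ge0 //=.
  apply: ler_pM; rewrite ?pw_ge0 ?expR_ge0 //.
    by rewrite -pwE //; apply: pw_mono => //; rewrite !ger0_norm.
  rewrite ler_expR ge_min; apply/orP; left; apply: (le_trans (fixed_le1 r0)).
  rewrite lerD2l ler_wpM2l ?invr_ge0 //; apply: ler_pM => //.
    by rewrite mulr_ge0 ?powR_ge0 ?expR_ge0.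
  rewrite ler_wpM2r ?expR_ge0 // -!pwE //; apply: pw_mono => //; by rewrite !ger0_norm.
move=> /(_ H) /andP[_]; rewrite expRD; lra.
Qed.

End Solution.
End Family.

(** * Shooting *)

Section Shooting.
Variable R : realType.
Implicit Types (p q tau b eps t T : R) (u v x y : R -> R).

(* As long as x < 2 p, the function u - 2 ln (2 p - x) - p t is nondecreasing. *)
Lemma toda_first_mass p q tau eps : 0 < p -> 0 < tau -> 0 < eps ->
  exists T, forall u v x y, (forall T', toda p q tau T' u v x y) ->
    (u t - p * t @[t --> -oo] --> (0 : R)) -> 2 * p - eps < x T.
Proof.
(* Constant in e^u >= k e^(p t): the monotone function is compared at t, where 2 p - x >= eps, and
   near -oo, where 2 p - x <= 2 p. *)
move=> p0 t0 e0; pose k := expR (2 * ln eps - 2 * ln (2 * p)).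
have k0 : 0 < k by exact: expR_gt0.
(* Integrating k e^(p t) over [0, T] gives a flux of at least k T = 2 p, a contradiction. [T]
   depends on p and eps only, so it serves all solutions at once. *)
pose T := 2 * p / k.
exists T => u v x y H cu; rewrite ltNge; apply/negP => xT.
have T0 : 0 < T by rewrite divr_gt0 // mulr_gt0.
have xle t : t <= T -> x t <= 2 * p - eps.
  by move=> tT; apply: le_trans xT; apply: (toda_x_nd (H (T + 1))) => //; lra.
have hu t : t <= T -> k * expR (p * t) <= expR (u t).
  move=> tT; rewrite -expRD ler_expR; apply/ler_addgt0Pl => e e1.
  have /cvgrPdist_lt /(_ e e1) [M [_ hM]] := cu.
  pose s := - (`|M| + `|t| + 1).
  have [mM mt] : - M <= `|M| /\ - t <= `|t| by split; rewrite -normrN ler_norm.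
  have [pM pt] : 0 <= `|M| /\ 0 <= `|t| by [].
  have sM : s < M by rewrite /s; lra.
  have st : s <= t by rewrite /s; lra.
  have := hM s sM; rewrite sub0r normrN ltr_norml => /andP[us _].
  pose L r := u r - 2 * ln (2 * p - x r) - p * r.
  have : L s <= L t.
    apply: (der_le st (df := fun r => (p - x r + tau * y r) - 2 * ((0 - expR (u r)) / (2 * p - x r)) - p * 1)) => r hr.
      have rT : r <= T by lra.
      have hx := xle r rT.
      apply: derB; last by apply: derZ; exact: der_id.
      apply: derB; first by apply: (toda_u (H (r + 1))); lra.
      apply: derZ; apply: (@der_ln _ (fun r => 2 * p - x r)); first lra.
      by apply: derB; [exact: der_cst|apply: (toda_x (H (r + 1))); lra].
    have rT : r <= T by lra.
    have hx := xle r rT.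
    have d0 : 0 < 2 * p - x r by lra.
    have := toda_excess_ge0 p0 t0 (H (r + 1)) (t := r) ltac:(lra).
    have := toda_y_ge0 (H (r + 1)) (t := r) ltac:(lra).
    move=> y0 ex.
    (* Nonnegativity of the excess reads e^u >= x (2 p - x) / 2. It makes the derivative of [L] at
       least tau y. *)
    have h1 : x r / 2 <= expR (u r) / (2 * p - x r).
      by rewrite ler_pdivlMr //; lra.
    have : 0 <= tau * y r by rewrite mulr_ge0 // ltW.
    by rewrite sub0r mulNr; lra.
  rewrite /L.
  have l1 : ln (2 * p - x s) <= ln (2 * p).
    have xs := toda_x_ge0 (H (s + 1)) (t := s) ltac:(lra).
    have := xle s (le_trans st tT) => h.
    by rewrite ler_ln ?posrE; lra.
  have l2 : ln eps <= ln (2 * p - x t).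
    have h := xle t tT.
    by rewrite ler_ln ?posrE; lra.
  lra.
have := @der_le2 R (fun r => k / p * expR (p * r)) (fun r => k * expR (p * r)) x (fun r => expR (u r)) 0 T (ltW T0).
have H1 : forall r, 0 <= r <= T -> der (fun r0 => k / p * expR (p * r0)) r (k * expR (p * r)).
  move=> r _; apply: derE; first by apply: derZ; apply: der_exp; apply: derZ; exact: der_id.
  by field; rewrite gt_eqF.
have H2 : forall r, 0 <= r <= T -> der x r (expR (u r)).
  by move=> r _; apply: (toda_x (H (r + 1))); lra.
move=> /(_ H1 H2 (fun r hr => hu r (proj2 (andP hr)))).
have x0 := toda_x_ge0 (H 1) (t := 0) ltac:(lra).
rewrite mulr0 expR0 mulr1 => h.
have : k / p * (expR (p * T) - 1) <= 2 * p - eps by lra.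
have : k / p * (p * T) <= k / p * (expR (p * T) - 1).
  rewrite ler_wpM2l ?divr_ge0 ?(ltW k0) ?(ltW p0) //.
  by have := expR_ge1Dx (p * T); lra.
have -> : k / p * (p * T) = 2 * p by rewrite /T; field; rewrite !gt_eqF.
lra.
Qed.

(** Insert x(T) close to 2 p and y(T) close to 0 in [toda_lim_excess] with the components exchanged:
    in the limit 2 tau p b2 <= b2^2 / 2 - q b2, that is b2 >= 2 q + 4 tau p. A small [eps] loses
    less than the gap to [b]. *)
Lemma toda_second_mass p q tau b : 0 < p -> 0 < q -> 0 < tau -> tau < 1 ->
  2 * q < b -> b < 2 * q + 4 * (tau * p) ->
  exists2 eps, 0 < eps & forall u v x y b1 b2 T, (forall T', toda p q tau T' u v x y) ->
    (x t @[t --> +oo] --> b1) -> (y t @[t --> +oo] --> b2) ->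
    2 * p - eps < x T -> y T < eps -> b < b2.
Proof.
move=> p0 q0 t0 t1 qb bq.
pose d := 2 * (tau * p) - (b / 2 - q).
have d0 : 0 < d by rewrite /d; lra.
have tp : 0 < tau * p by rewrite mulr_gt0.
(* The error is at most tau eps (2 p + b2), and 2 p <= (p / q) b2 because b2 > 2 q; so it is at most
   m eps b2 / 2. The factor 2 turns eps <= d / m into a strict contradiction. *)
pose m := 2 * (tau * (1 + p / q)).
have m0 : 0 < m by rewrite !mulr_gt0 // addr_gt0 // divr_gt0.
pose eps := Num.min (Num.min p q) (d / m).
have e0 : 0 < eps by rewrite !lt_min p0 q0 divr_gt0.
have [ep eq ed] : [/\ eps <= p, eps <= q & eps <= d / m].
  by rewrite /eps; split; rewrite !ge_min lexx ?orbT.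
exists eps => // u v x y b1 b2 T H cx cy xT yT.
rewrite ltNge; apply/negP => bb.
have Hs T' := toda_sym (H T').
have g2 := toda_lim_gt q0 t0 Hs cy cx.
have := toda_lim_excess q0 t0 Hs cy cx T.
set X := x T in xT *; set Y := y T in yT *.
have h1 : tau * (2 * p - eps) * (b2 - eps) <= tau * X * (b2 - Y).
  apply: ler_pM; [|lra| |lra]; first by rewrite mulr_ge0 ?ltW //; lra.
  by rewrite ler_wpM2l ?ltW //; lra.
move=> h2.
have b20 : 0 < b2 by lra.
have h3 : b2 ^+ 2 / 2 - q * b2 <= b2 * (2 * (tau * p) - d).
  have -> : b2 ^+ 2 / 2 - q * b2 = b2 * (b2 / 2 - q) by rewrite expr2; field.
  by rewrite ler_wpM2l ?(ltW b20) // /d; lra.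
have h4 : d * b2 <= tau * eps * (2 * p + b2).
  have : 0 <= tau * eps ^+ 2 by rewrite mulr_ge0 ?sqr_ge0 // ltW.
  nra.
have h5 : 2 * p <= p / q * b2.
  have -> : 2 * p = p / q * (2 * q) by field; rewrite gt_eqF.
  by rewrite ler_wpM2l ?divr_ge0 ?ltW.
have h6 : tau * eps * (2 * p + b2) <= tau * eps * ((1 + p / q) * b2).
  have te : 0 <= tau * eps by rewrite mulr_ge0 // ltW.
  by rewrite ler_wpM2l //; lra.
have h7 : d * b2 <= (tau * (1 + p / q) * eps) * b2 by lra.
move: h7; rewrite ler_pM2r // => h7.
move: ed; rewrite ler_pdivlMr // /m; lra.
Qed.

(** If dF/dx >= 0 at the point, then x > 2 p forces z = tau y > p. Read as a quadratic in x, F = 0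
    has a real root, so y^2 - 2 q y <= (tau y + p)^2; times tau^2 this bounds a function of z, and
    the condition on tau is what excludes z > p. *)
Lemma arc_slope p q tau (x y : R) : 0 < p -> 0 < q -> 0 < tau -> tau < 1 ->
  4 * p * tau ^+ 2 + 2 * q * tau <= p -> pohozaev p q tau x y = 0 ->
  2 * p < x -> 2 * q < y -> p - x + tau * y < 0.
Proof.
move=> p0 q0 t0 t1 c1 F0 px qy; rewrite ltNge; apply/negP => h.
have zp : p < tau * y by lra.
have x0 : 0 < x by lra.
have F1 : x ^+ 2 - 2 * x * (tau * y + p) + y ^+ 2 - 2 * q * y = 0.
  by move: F0; rewrite /pohozaev; lra.
have V : y ^+ 2 - 2 * q * y <= (tau * y + p) ^+ 2.
  by have := sqr_ge0 (x - (tau * y + p)); nra.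
pose z := tau * y.
have V2 : z * (z * (1 - tau ^+ 2) - 2 * q * tau - 2 * p * tau ^+ 2) <= p ^+ 2 * tau ^+ 2.
  have : tau ^+ 2 * (y ^+ 2 - 2 * q * y) <= tau ^+ 2 * (tau * y + p) ^+ 2.
    by rewrite ler_wpM2l ?sqr_ge0.
  by rewrite /z; lra.
have s1 : 0 < 1 - tau ^+ 2 by nra.
have s2 : p * (1 - tau ^+ 2) < z * (1 - tau ^+ 2) by rewrite ltr_pM2r.
have s3 : p * tau ^+ 2 < z * (1 - tau ^+ 2) - 2 * q * tau - 2 * p * tau ^+ 2 by lra.
have : p * (p * tau ^+ 2) < z * (z * (1 - tau ^+ 2) - 2 * q * tau - 2 * p * tau ^+ 2).
  by apply: ltr_pM => //; rewrite ?mulr_ge0 ?sqr_ge0 ?ltW.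
lra.
Qed.

Lemma pohozaev_sym p q tau (x y : R) : pohozaev p q tau x y = pohozaev q p tau y x.
Proof. by rewrite /pohozaev; ring. Qed.

(** The trapezoidal rule, exact because F is quadratic: the increment is the mean of the end
    gradients applied to the displacement. *)
Lemma pohozaev_sub p q tau (x y x' y' : R) :
  pohozaev p q tau x' y' - pohozaev p q tau x y =
  2^-1 * (((p - x + tau * y) + (p - x' + tau * y')) * (x' - x) +
   ((q - y + tau * x) + (q - y' + tau * x')) * (y' - y)).
Proof. by rewrite /pohozaev; field. Qed.

Section Arc.
Variables (p q tau : R).
Hypotheses (p0 : 0 < p) (q0 : 0 < q) (t0 : 0 < tau) (t1 : tau < 1).
Hypothesis C1 : 4 * p * tau ^+ 2 + 2 * q * tau <= p.
Hypothesis C2 : 4 * q * tau ^+ 2 + 2 * p * tau <= q.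

(** Both partial derivatives of F are negative at both points, so [pohozaev_sub] makes a nonzero
    displacement with nonnegative coordinates decrease F strictly. *)
Lemma arc_antitone (x y x' y' : R) :
  pohozaev p q tau x y = 0 -> 2 * p < x -> 2 * q < y ->
  pohozaev p q tau x' y' = 0 -> 2 * p < x' -> 2 * q < y' ->
  x <= x' -> y <= y' -> x = x' /\ y = y'.
Proof.
move=> F0 px qy F0' px' qy' xx yy.
have a1 := arc_slope p0 q0 t0 t1 C1 F0 px qy.
have a1' := arc_slope p0 q0 t0 t1 C1 F0' px' qy'.
have := F0; rewrite pohozaev_sym => G0; have := F0'; rewrite pohozaev_sym => G0'.
have a2 := arc_slope q0 p0 t0 t1 C2 G0 qy px.
have a2' := arc_slope q0 p0 t0 t1 C2 G0' qy' px'.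
have := pohozaev_sub p q tau x y x' y'; rewrite F0 F0' subrr => e.
set A := (p - x + _) + _ in e; set B := (q - y + _) + _ in e.
have A0 : A < 0 by rewrite /A; lra.
have B0 : B < 0 by rewrite /B; lra.
have r1 : 0 <= x' - x by lra.
have r2 : 0 <= y' - y by lra.
have m1 : A * (x' - x) <= 0 by rewrite mulr_le0_ge0 // ltW.
have m2 : B * (y' - y) <= 0 by rewrite mulr_le0_ge0 // ltW.
have z1 : A * (x' - x) = 0 by lra.
have z2 : B * (y' - y) = 0 by lra.
move: z1 z2 => /eqP; rewrite mulf_eq0 lt_eqF //= subr_eq0 => /eqP ->.
by move=> /eqP; rewrite mulf_eq0 lt_eqF //= subr_eq0 => /eqP ->.
Qed.

(** The bound is the abscissa of the end (2 p + 4 tau q, 2 q) of the arc, which lies on the conic.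
    [C2] says that dF/dy <= 0 there, so a point further right and above would have F < 0. *)
Lemma arc_bound (x y : R) : pohozaev p q tau x y = 0 -> 2 * p < x -> 2 * q < y ->
  x < 2 * p + 4 * (tau * q).
Proof.
move=> F0 px qy; rewrite ltNge; apply/negP => h.
have a1 := arc_slope p0 q0 t0 t1 C1 F0 px qy.
have := F0; rewrite pohozaev_sym => G0.
have a2 := arc_slope q0 p0 t0 t1 C2 G0 qy px.
have := pohozaev_sub p q tau (2 * p + 4 * (tau * q)) (2 * q) x y.
have -> : pohozaev p q tau (2 * p + 4 * (tau * q)) (2 * q) = 0 by rewrite /pohozaev; field.
rewrite F0 subrr => e.
set X := 2 * p + 4 * (tau * q) in h e.
set A := (p - X + _) + _ in e; set B := (q - _ + _) + _ in e.
have c2 := C2; have q0' := q0; have t0' := t0; have p0' := p0.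
have tq : 0 < tau * q by rewrite mulr_gt0.
have A0 : A < 0 by rewrite /A /X; lra.
have B0 : B < 0.
  have : tau * X <= q by rewrite /X; lra.
  by rewrite /B; lra.
have m1 : A * (x - X) <= 0 by rewrite mulr_le0_ge0 ?subr_ge0 // ltW.
have m2 : B * (y - 2 * q) < 0 by rewrite nmulr_rlt0 // subr_gt0.
lra.
Qed.

End Arc.
End Shooting.

(** * Connectedness of the curve of initial values *)

Section ShootingExistence.
Variable R : realType.
Variables (N1 N2 tau : R).
Hypotheses (N10 : 0 <= N1) (N20 : 0 <= N2) (t0 : 0 < tau) (t1 : tau < 1).
Let p := 2 * (N1 + 1).
Let q := 2 * (N2 + 1).
Hypothesis C1 : 4 * p * tau ^+ 2 + 2 * q * tau <= p.
Hypothesis C2 : 4 * q * tau ^+ 2 + 2 * p * tau <= q.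
Variables b1 b2 : R.
Hypotheses (Fb : pohozaev p q tau b1 b2 = 0) (pb1 : 2 * p < b1) (qb2 : 2 * q < b2).

Let p0 : 0 < p. Proof. by have := N10; rewrite /p; lra. Qed.
Let q0 : 0 < q. Proof. by have := N20; rewrite /q; lra. Qed.

Let fix_ := @fixed R N1 N2 tau.
Let m1 := @mass1 R N1 N2 tau.
Let m2 := @mass2 R N1 N2 tau.

(* Up to scaling every pair of initial values lies on this curve, which stays
   where both are <= 0 and the truncation levels are uniform. *)
Definition shoot_init (a : R) : R * R := (Num.min (- a) 0, Num.min a 0).

Let sol a := sval (cid (fixed_exists N10 N20 t0 t1 (shoot_init a))).
Let solP a : fix_ (shoot_init a) (sol a).
Proof. by rewrite /sol; case: cid. Qed.

Let init_le a : (shoot_init a).1 <= 0 /\ (shoot_init a).2 <= 0.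
Proof. by split; rewrite ge_min lexx orbT. Qed.

Let x_ a t := m1 (sol a) (expR (2 * t)).
Let y_ a t := m2 (sol a) (expR (2 * t)).
Let u_ a t := (sol a).1 (expR (2 * t)) + p * t.
Let v_ a t := (sol a).2 (expR (2 * t)) + q * t.

Let sol_toda a T : toda p q tau T (u_ a) (v_ a) (x_ a) (y_ a).
Proof. exact: (fixed_toda N10 N20 t0 t1 (solP a) (init_le a).1 (init_le a).2 T). Qed.
Let sol_toda' a T : toda q p tau T (v_ a) (u_ a) (y_ a) (x_ a).
Proof. exact: (toda_sym (sol_toda a T)). Qed.

Let cvg1 a : exists b : R, x_ a t @[t --> +oo] --> b.
Proof. exact: (toda_cvg p0 q0 t0 t1 (sol_toda a)). Qed.
Let cvg2 a : exists b : R, y_ a t @[t --> +oo] --> b.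
Proof. exact: (toda_cvg q0 p0 t0 t1 (sol_toda' a)). Qed.

Let beta1 a := sval (cid (cvg1 a)).
Let beta2 a := sval (cid (cvg2 a)).
Let beta1P a : x_ a t @[t --> +oo] --> beta1 a.
Proof. by rewrite /beta1; case: cid. Qed.
Let beta2P a : y_ a t @[t --> +oo] --> beta2 a.
Proof. by rewrite /beta2; case: cid. Qed.

Let beta1_gt a t : x_ a t <= beta1 a.
Proof. exact: (toda_lim_ge (sol_toda a) (@beta1P a)). Qed.
Let beta2_gt a t : y_ a t <= beta2 a.
Proof. exact: (toda_lim_ge (sol_toda' a) (@beta2P a)). Qed.

Let beta_conic a : [/\ pohozaev p q tau (beta1 a) (beta2 a) = 0, 2 * p < beta1 a & 2 * q < beta2 a].
Proof.
split.
- exact: (toda_lim_conic (sol_toda a) (@beta1P a) (@beta2P a)).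
- exact: (toda_lim_gt p0 t0 (sol_toda a) (@beta1P a) (@beta2P a)).
- exact: (toda_lim_gt q0 t0 (sol_toda' a) (@beta2P a) (@beta1P a)).
Qed.

Let init_lip a a' : `|(shoot_init a).1 - (shoot_init a').1| <= `|a - a'| /\
  `|(shoot_init a).2 - (shoot_init a').2| <= `|a - a'|.
Proof.
have h (z z' : R) : `|Num.min z 0 - Num.min z' 0| <= `|z - z'|.
  rewrite ler_norml; have := ler_norm (z - z'); have := ler_norm (- (z - z')); rewrite normrN.
  by case: (leP z 0); case: (leP z' 0); lra.
split; last exact: h.
by apply: (le_trans (h _ _)); rewrite opprK addrC distrC lexx.
Qed.

(** A supremum of functions continuous in [a] is lower semicontinuous: an excess over [b] is already
    visible at a finite radius, where it persists for nearby parameters. *)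
Let sup_open (m : (R -> R) * (R -> R) -> R -> R) (beta : R -> R) (b : R) :
  (forall a, m (sol a) (expR (2 * t)) @[t --> +oo] --> beta a) ->
  (forall a t, m (sol a) (expR (2 * t)) <= beta a) ->
  (forall s, 0 <= s -> exists2 C, 0 <= C & forall a a',
     `|m (sol a) s - m (sol a') s| <= C * `|a - a'|) ->
  open [set a | b < beta a].
Proof.
move=> cv le lip; rewrite openE => a /= ba.
have /cvgrPdist_lt /(_ ((beta a - b) / 2)) := cv a.
move=> /(_ ltac:(lra)) [M [_ hM]].
have := hM (M + 1) ltac:(lra); set t := M + 1; rewrite ltr_norml => /andP[_ h].
have [C C0 hC] := lip _ (expR_ge0 (2 * t)).
pose d := (beta a - b) / 2 / (C + 1).
have d0 : 0 < d by rewrite divr_gt0 //; lra.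
exists d => // a' /= aa'.
have := le a' t; have := hC a a'.
have : C * `|a - a'| <= (C + 1) * d by apply: ler_pM => //; [lra|exact: ltW].
have -> : (C + 1) * d = (beta a - b) / 2 by rewrite /d; field; rewrite gt_eqF //; lra.
rewrite ler_norml; lra.
Qed.

Let big1 : exists a, b1 < beta1 a.
Proof.
have G0 := Fb; rewrite pohozaev_sym in G0.
have hb := arc_bound p0 q0 t0 t1 C1 C2 Fb pb1 qb2.
have [eps e0 he] := toda_second_mass q0 p0 t0 t1 pb1 hb.
have [T hT] := @toda_first_mass R q p tau eps q0 t0 e0.
pose s := expR (2 * T).
pose C := 2^-1 * (s * (s `^ N1 * expR (4^-1 * (s * (s `^ N2 * expR (cap2 N1 N2 tau)))))).
have C0 : 0 <= C by rewrite !mulr_ge0 ?powR_ge0 ?expR_ge0.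
(* Then C < eps (1 + a) <= eps e^a, so the first flux at time [T] is below eps, while the second
   component, starting at 0, has nearly completed its flux 2 q. *)
pose a := C / eps; have a0 : 0 <= a by rewrite divr_ge0 // ltW.
exists a.
have i1 : (shoot_init a).1 = - a by rewrite /= min_l // oppr_le0.
have i2 : (shoot_init a).2 = 0 by rewrite /= min_r.
have H := sol_toda' a.
apply: (he _ _ _ _ _ _ T H (@beta2P a) (@beta1P a)).
  apply: (hT _ _ _ _ H).
  rewrite /u_ /v_; under eq_fun do rewrite addrK.
  apply: cvg_exp2_ninfty; apply: cvg_at_right_filter.
  have := (solP a).1.2 0; rewrite /continuous_at.
  by rewrite (fixed_at0 N10 N20 (solP a)).2 i2.
have := mass1_le N10 N20 t0 t1 (solP a) (expR_ge0 (2 * T)).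
rewrite i1 -/s -/C => h; apply: (le_lt_trans h).
rewrite expRN mulrC ltr_pdivrMr ?expR_gt0 //.
apply: (@lt_le_trans _ _ (eps * (1 + a))).
  by rewrite mulrDr mulr1 /a mulrC divfK ?gt_eqF //; lra.
by rewrite ler_wpM2l ?(ltW e0) // expR_ge1Dx.
Qed.

Let big2 : exists a, b2 < beta2 a.
Proof.
have G0 := Fb; rewrite pohozaev_sym in G0.
have hb := arc_bound q0 p0 t0 t1 C2 C1 G0 qb2 pb1.
have [eps e0 he] := toda_second_mass p0 q0 t0 t1 qb2 hb.
have [T hT] := @toda_first_mass R p q tau eps p0 t0 e0.
pose s := expR (2 * T).
pose C := 2^-1 * (s * (s `^ N2 * expR (4^-1 * (s * (s `^ N1 * expR (cap1 N1 N2 tau)))))).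
have C0 : 0 <= C by rewrite !mulr_ge0 ?powR_ge0 ?expR_ge0.
pose a := C / eps; have a0 : 0 <= a by rewrite divr_ge0 // ltW.
exists (- a).
have i1 : (shoot_init (- a)).1 = 0 by rewrite /= opprK min_r.
have i2 : (shoot_init (- a)).2 = - a by rewrite /= min_l // oppr_le0.
have H := sol_toda (- a).
apply: (he _ _ _ _ _ _ T H (@beta1P (- a)) (@beta2P (- a))).
  apply: (hT _ _ _ _ H).
  rewrite /u_ /v_; under eq_fun do rewrite addrK.
  apply: cvg_exp2_ninfty; apply: cvg_at_right_filter.
  have := (solP (- a)).1.1 0; rewrite /continuous_at.
  by rewrite (fixed_at0 N10 N20 (solP (- a))).1 i1.
have := mass2_le N10 N20 t0 t1 (solP (- a)) (expR_ge0 (2 * T)).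
rewrite i2 -/s -/C => h; apply: (le_lt_trans h).
rewrite expRN mulrC ltr_pdivrMr ?expR_gt0 //.
apply: (@lt_le_trans _ _ (eps * (1 + a))).
  by rewrite mulrDr mulr1 /a mulrC divfK ?gt_eqF //; lra.
by rewrite ler_wpM2l ?(ltW e0) // expR_ge1Dx.
Qed.

Lemma shooting : exists c w, [/\ fixed N1 N2 tau c w, c.1 <= 0, c.2 <= 0,
  mass1 N1 N2 tau w (expR (2 * t)) @[t --> +oo] --> b1 &
  mass2 N1 N2 tau w (expR (2 * t)) @[t --> +oo] --> b2].
Proof.
have [[a [e1 e2]]|no] := pselect (exists a, beta1 a = b1 /\ beta2 a = b2).
  exists (shoot_init a), (sol a); split; [exact: solP|exact: (init_le a).1|exact: (init_le a).2| |].
    by rewrite -e1; exact: (@beta1P a).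
  by rewrite -e2; exact: (@beta2P a).
exfalso.
pose A := [set a | b1 < beta1 a]; pose B := [set a | b2 < beta2 a].
have oA : open A.
  apply: (@sup_open m1 beta1 b1 (@beta1P) beta1_gt) => s s0.
  have [C C0 hC] := mass_stable N10 N20 t0 t1 s0; exists C => // a a'.
  have [l1 l2] := init_lip a a'.
  by have [] := hC _ _ _ _ _ (solP a) (solP a') l1 l2.
have oB : open B.
  apply: (@sup_open m2 beta2 b2 (@beta2P) beta2_gt) => s s0.
  have [C C0 hC] := mass_stable N10 N20 t0 t1 s0; exists C => // a a'.
  have [l1 l2] := init_lip a a'.
  by have [] := hC _ _ _ _ _ (solP a) (solP a') l1 l2.
(* On the arc, exceeding both [b1] and [b2] is impossible by monotonicity, and exceeding neither
   forces equality, which was excluded. *)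
have AB : A = ~` B.
  apply/seteqP; split => a; rewrite /A /B /= => h.
    move=> h2; have [F0 h3 h4] := beta_conic a.
    have [e _] := arc_antitone p0 q0 t0 t1 C1 C2 Fb pb1 qb2 F0 h3 h4 (ltW h) (ltW h2).
    by move: h; rewrite e ltxx.
  rewrite ltNge; apply/negP => h1; move/negP: h; rewrite -leNgt => h2.
  have [F0 h3 h4] := beta_conic a.
  by apply: no; exists a; apply: (arc_antitone p0 q0 t0 t1 C1 C2 F0 h3 h4 Fb pb1 qb2).
have conn : connected [set: R] by apply/connected_intervalP.
have [a1 h1] := big1; have [a2 h2] := big2.
have AT : A = setT.
  apply: conn; first by exists a1.
    by exists A => //; rewrite setTI.
  exists A; last by rewrite setTI.
  by rewrite AB; exact: open_closedC.
have : A a2 by rewrite AT.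
by rewrite AB.
Qed.

End ShootingExistence.

(** * Integration in polar coordinates *)

Section Polar.
Variable R : realType.
Local Notation leb := (@lebesgue_measure R).

Lemma measurable_sqnorm : measurable_fun [set: R * R] (@sqnorm R).
Proof.
apply: measurable_funD; apply: measurable_funX.
  exact: measurable_fst.
exact: measurable_snd.
Qed.

Lemma continuous_sqr : continuous (fun a : R => a ^+ 2).
Proof. move=> a; apply: (@der_cont R _ a (2 * a * 1)); apply: der_sqr; exact: der_id. Qed.

Lemma continuous_sqrt_sub (x : R) : continuous (fun a : R => Num.sqrt (x - a ^+ 2)).
Proof.
move=> a; apply: (@continuous_comp _ _ _ (fun a : R => x - a ^+ 2) (@Num.sqrt R)).
  by apply: continuousB; [exact: cst_continuous|exact: continuous_sqr].
exact: sqrt_continuous.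
Qed.

(** The derivative of arcsine blows up at the ends, so continuity up to them comes from inverting
    the sine on a segment. *)
Lemma asin_div_cont_within (r : R) : 0 < r ->
  {within `[- r, r], continuous (fun a => asin (a / r))}.
Proof.
move=> r0; have pi0 := @pi_gt0 R.
have := @segment_can_le_continuous R (- (pi / 2)) (pi / 2) (fun t => r * sin t) (fun a => asin (a / r)).
rewrite sinN sin_pihalf mulrN mulr1; apply.
- lra.
- apply: continuous_subspaceT => y; apply: continuousM; first exact: cst_continuous.
  exact: continuous_sin.
- move=> t ht; rewrite mulrAC divff ?gt_eqF // mul1r; exact: sinK.
Qed.

Lemma asin1 : asin 1 = pi / 2 :> R.
Proof.
have pi0 := @pi_gt0 R.
by rewrite -[in LHS]sin_pihalf sinK // in_itv /=; lra.
Qed.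

Lemma asinN1 : asin (-1) = - (pi / 2) :> R.
Proof.
have pi0 := @pi_gt0 R.
by rewrite -[in LHS]sin_pihalf -sinN sinK // in_itv /=; lra.
Qed.

(** Valid for all [a]: outside the disc the section is empty and [Num.sqrt] of a nonpositive number
    is 0. *)
Lemma disc_section_measure (x a : R) :
  leb [set b | sqnorm (a, b) < x] = (2 * Num.sqrt (x - a ^+ 2))%:E.
Proof.
have -> : [set b | sqnorm (a, b) < x] =
    [set` `](- Num.sqrt (x - a ^+ 2)), (Num.sqrt (x - a ^+ 2))[].
  apply/seteqP; split => b /=; rewrite in_itv /= /sqnorm /= -ltr_norml -ltrBrDl => h.
    by rewrite -sqrtr_sqr ltr_sqrt // (le_lt_trans _ h) // sqr_ge0.
  have [x0|x0] := leP (x - a ^+ 2) 0.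
    by move: h; rewrite (ler0_sqrtr x0) => /lt_geF; rewrite normr_ge0.
  by move: h; rewrite -sqrtr_sqr ltr_sqrt.
rewrite lebesgue_measure_itv /= lte_fin.
have := sqrtr_ge0 (x - a ^+ 2); set s := Num.sqrt _ => s0.
case: ifPn => h; first by rewrite -EFinB; congr EFin; ring.
have s00 : s = 0 by move: h; rewrite -leNgt; lra.
by rewrite s00 mulr0.
Qed.

Lemma semidisc_primitive (r a : R) : - r < a < r ->
  der (fun a => a * Num.sqrt (r ^+ 2 - a ^+ 2) + r ^+ 2 * asin (a / r)) a
    (2 * Num.sqrt (r ^+ 2 - a ^+ 2)).
Proof.
move=> /andP[ra ar]; have r0 : 0 < r by lra.
have d0 : 0 < r ^+ 2 - a ^+ 2 by nra.
have dq : der (fun a => r ^+ 2 - a ^+ 2) a (- (2 * a)).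
  by apply: derE; [apply: derB; [exact: der_cst|apply: der_sqr; exact: der_id]|move=> /=; ring].
have dr : der (fun a => a / r) a r^-1.
  by apply: derE; [apply: derM; [exact: der_id|exact: der_cst]|move=> /=; ring].
have ds := @der_comp R (@Num.sqrt R) (fun a => r ^+ 2 - a ^+ 2) a _ _ (is_derive1_sqrt d0) dq.
have ar1 : -1 < a / r < 1.
  by rewrite ltr_pdivlMr // ltr_pdivrMr //; lra.
have da := @der_comp R (@asin R) (fun a => a / r) a _ _ (is_derive1_asin ar1) dr.
apply: derE.
  apply: derD; first by apply: derM; [exact: der_id|exact: ds].
  by apply: derZ; exact: da.
have s0 : 0 < Num.sqrt (r ^+ 2 - a ^+ 2) by rewrite sqrtr_gt0.
have -> : Num.sqrt (1 - (a / r) ^+ 2) = Num.sqrt (r ^+ 2 - a ^+ 2) / r.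
  have -> : 1 - (a / r) ^+ 2 = (r ^+ 2 - a ^+ 2) / r ^+ 2 by field; lra.
  by rewrite sqrtrM ?(ltW d0) // -exprVn sqrtr_sqr gtr0_norm ?invr_gt0.
have sq : Num.sqrt (r ^+ 2 - a ^+ 2) ^+ 2 = r ^+ 2 - a ^+ 2 by rewrite sqr_sqrtr // ltW.
set s := Num.sqrt _ in s0 sq *.
transitivity (s + (r ^+ 2 - a ^+ 2) / s); first by field; rewrite !gt_eqF //=.
by rewrite -sq; field; rewrite gt_eqF.
Qed.

Lemma integral_semidisc (x : R) : 0 < x ->
  (\int[leb]_a (2 * Num.sqrt (x - a ^+ 2))%:E = (pi * x)%:E)%E.
Proof.
move=> x0; pose r := Num.sqrt x; have r0 : 0 < r by rewrite sqrtr_gt0.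
have rx : x = r ^+ 2 by rewrite sqr_sqrtr // ltW.
have rr : - r < r by lra.
rewrite rx.
have -> : (fun a => (2 * Num.sqrt (r ^+ 2 - a ^+ 2))%:E) =
   (fun a => (2 * Num.sqrt (r ^+ 2 - a ^+ 2))%:E) \_ `[- r, r].
  apply/funext => a; rewrite patchE; case: ifPn => //.
  rewrite notin_setE /= in_itv /= => ha; congr EFin.
  rewrite ler0_sqrtr ?mulr0 //.
  have : `|r| <= `|a|.
    rewrite (gtr0_norm r0) leNgt ltr_norml; apply/negP => /andP[h1 h2].
    by apply: ha; rewrite !ltW.
  by rewrite -ler_sqr ?nnegrE // !real_normK ?num_real //; lra.
rewrite -integral_mkcond.
pose F a := a * Num.sqrt (r ^+ 2 - a ^+ 2) + r ^+ 2 * asin (a / r).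
have [_ c2 c3] := (continuous_within_itvP (fun a => asin (a / r)) rr).1 (asin_div_cont_within r0).
have cs := @continuous_sqrt_sub (r ^+ 2).
rewrite (@continuous_FTC2 R (fun a => 2 * Num.sqrt (r ^+ 2 - a ^+ 2)) F) //.
- rewrite /F sqrrN subrr sqrtr0 !mulr0 !add0r divff ?gt_eqF // mulNr divff ?gt_eqF //.
  by rewrite asin1 asinN1 -EFinB; congr EFin; field.
- by apply: continuous_subspaceT => b; apply: cvgM; [exact: cvg_cst|exact: cs].
- split.
  + by move=> a; rewrite in_itv /= => /semidisc_primitive h; have [] := h.
  + apply: cvgD; last by apply: cvgMr.
    apply: cvg_at_right_filter; apply: cvgM; [exact: cvg_id|exact: cs].
  + apply: cvgD; last by apply: cvgMr.
    apply: cvg_at_left_filter; apply: cvgM; [exact: cvg_id|exact: cs].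
- move=> a; rewrite in_itv /= => /semidisc_primitive h.
  by rewrite derive1E; exact: derive_val.
Qed.

Lemma disc_measure (x : R) : @leb2 R [set z | sqnorm z < x] = (pi * Num.max x 0)%:E.
Proof.
have mD : measurable [set z : R * R | sqnorm z < x].
  rewrite -[X in measurable X]setTI.
  exact: (measurable_sqnorm measurableT (measurable_itv `]-oo, x[)).
rewrite /leb2 /product_measure1.
transitivity (\int[leb]_a (2 * Num.sqrt (x - a ^+ 2))%:E)%E.
  apply: eq_integral => a _; rewrite /= -disc_section_measure; congr (leb _).
  by apply/seteqP; split => b; rewrite /xsection /= inE.
have [x0|x0] := leP x 0.
  rewrite mulr0; apply: integral0_eq => a _.
  by rewrite ler0_sqrtr ?mulr0 //; have := sqr_ge0 a; lra.
exact: integral_semidisc.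
Qed.

Lemma sqnorm_ge0 (z : R * R) : 0 <= sqnorm z.
Proof. by rewrite addr_ge0 ?sqr_ge0. Qed.

Let pos : set (measurableTypeR R) := `[(0 : R), +oo[%classic.
Let mpos : measurable pos. Proof. exact: measurable_itv. Qed.
Let sq : R * R -> measurableTypeR R := @sqnorm R.
Let msq : measurable_fun [set: R * R] sq := measurable_sqnorm.
Let m1 : {measure set (measurableTypeR R) -> \bar R} :=
  measure_function_pushforward__canonical__measure_function_Measure (leb \x leb)%E msq.
Let m2 : {measure set (measurableTypeR R) -> \bar R} := mscale (NngNum (@pi_ge0 R)) (mrestr leb mpos).

(** The image of planar measure under |x|^2 is pi times Lebesgue measure on the half-line. By
    uniqueness on the rays ]-oo, x[, the area of discs decides, and no change of variables in the
    plane is needed. *)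
Let m12 (A : set (measurableTypeR R)) : measurable A -> m1 A = m2 A.
Proof.
have e1 x : m1 `]-oo, x[%classic = (pi * Num.max x 0)%:E.
  rewrite /m1 /= /pushforward.
  rewrite (_ : _ @^-1` _ = [set z | sqnorm z < x]); last first.
    by apply/seteqP; split => z /=; rewrite in_itv.
  exact: disc_measure.
have e x : m1 `]-oo, x[%classic = m2 `]-oo, x[%classic.
  rewrite e1.
  rewrite /m2 /= /mscale /= /mrestr.
  have -> : `]-oo, x[%classic `&` pos = [set` `[0, x[].
    apply/seteqP; split => z; rewrite /pos /= !in_itv /= andbT; first by case=> -> ->.
    by case/andP => -> ->.
  rewrite lebesgue_measure_itv /= lte_fin; case: ltP => h; last first.
    by rewrite mulr0 mule0.
  by rewrite -EFinB subr0 -EFinM.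
move=> mA.
refine (@measure_unique _ R (measurableTypeR R) (@RGenInftyO.G R) (fun n => `]-oo, n%:R[%classic) _ _ _ _ m1 m2 _ _ A mA).
- exact: RGenInftyO.measurableE.
- move=> _ _ [x ->] [y ->]; exists (Num.min x y).
  by apply/seteqP; split => z /=; rewrite !in_itv /= lt_min => /andP.
- by move=> n; exists n%:R.
- apply/seteqP; split => // z _; exists (Num.truncn `|z|).+1 => //=.
  by rewrite in_itv /=; apply: (le_lt_trans (ler_norm z)); exact: truncnS_gt.
- by move=> _ [x ->]; exact: e.
- by move=> n; rewrite e1 ltry.
Qed.

Lemma polar_ge0 (f : R -> \bar R) : measurable_fun setT f -> (forall x, 0 <= f x)%E ->
  (\int[@leb2 R]_z f (sqnorm z) = pi%:E * \int[leb]_(s in `[0%R, +oo[) f s)%E.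
Proof.
move=> mf f0.
transitivity (\int[m1]_(s in pos) f s)%E.
  rewrite /m1 ge0_integral_pushforward //; last exact: measurable_funTS.
  rewrite (_ : _ @^-1` _ = setT) //.
  by apply/seteqP; split => // z _; rewrite /preimage /pos /= in_itv /= andbT; exact: sqnorm_ge0.
transitivity (\int[mscale (NngNum (@pi_ge0 R)) leb]_(s in pos) f s)%E.
  apply: eq_measure_integral => A mA Ap; rewrite m12 // /m2 /= /mscale /= /mrestr setIidl //.
by rewrite ge0_integral_mscale //; exact: measurable_funTS.
Qed.

Lemma measurable_comp_sqnorm (f : R -> R) : measurable_fun setT f ->
  measurable_fun [set: R * R] (fun z => f (sqnorm z)).
Proof. move=> mf; exact: (measurableT_comp mf measurable_sqnorm). Qed.

Lemma polar_integrable (f : R -> R) : measurable_fun setT f ->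
  L1 (fun z => f (sqnorm z)) <-> leb.-integrable `[0, +oo[ (EFin \o f).
Proof.
move=> mf.
have e : (\int[@leb2 R]_z `|(f (sqnorm z))%:E| = pi%:E * \int[leb]_(s in `[0%R, +oo[) `|(f s)%:E|)%E.
  rewrite (@polar_ge0 (fun s => `|(f s)%:E|)%E) //.
  by apply/measurable_EFinP; apply: measurableT_comp.
split => [/integrableP[m i]|/integrableP[m i]]; apply/integrableP; split.
- by apply/measurable_EFinP; exact: measurable_funTS.
- move: i; rewrite /= e; set I := (\int[_]_(_ in _) _)%E.
  rewrite !ltey; apply: contra_neq => /= ->.
  by rewrite gt0_muley // lte_fin pi_gt0.
- by apply/measurable_EFinP; exact: measurable_comp_sqnorm.
- rewrite /= e; apply: lte_mul_pinfty => //; by rewrite lee_fin pi_ge0.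
Qed.

Lemma polar_Rintegral (f : R -> R) : measurable_fun setT f ->
  leb.-integrable `[0, +oo[ (EFin \o f) ->
  Rintegral (@leb2 R) setT (fun z => f (sqnorm z)) = pi * Rintegral leb `[0, +oo[ f.
Proof.
move=> mf i; have i2 := (polar_integrable mf).2 i.
have mE : measurable_fun setT (EFin \o f) by exact/measurable_EFinP.
have ep : (\int[@leb2 R]_z (fun z => (f (sqnorm z))%:E)^\+ z = pi%:E * \int[leb]_(s in `[0%R, +oo[) (EFin \o f)^\+ s)%E.
  rewrite -(polar_ge0 (measurable_funepos mE) (funepos_ge0 (EFin \o f))).
  by apply: eq_integral => z _; rewrite !funeposE.
have en : (\int[@leb2 R]_z (fun z => (f (sqnorm z))%:E)^\- z = pi%:E * \int[leb]_(s in `[0%R, +oo[) (EFin \o f)^\- s)%E.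
  rewrite -(polar_ge0 (measurable_funeneg mE) (funeneg_ge0 (EFin \o f))).
  by apply: eq_integral => z _; rewrite !funenegE.
rewrite /Rintegral [in LHS]integralE [in RHS]integralE ep en.
have := integrable_pos_fin_num mpos i.
have := integrable_neg_fin_num mpos i.
move=> /fineK <- /fineK <-.
by rewrite -!EFinM -!EFinB /= mulrBr.
Qed.

End Polar.

(** * Radial test functions *)

Section PartialDerivatives.
Variable R : realType.
Implicit Types (f g : R * R -> R) (z : R * R) (d : R).

Definition dx f z d := is_derive z (e1 R) f d.
Definition dy f z d := is_derive z (e2 R) f d.

Let quot1 f z : (fun h : R => h^-1 *: (f (h *: e1 R + z) - f z)) =
  (fun h : R => h^-1 *: ((fun t => f (t, z.2)) (h *: 1 + z.1) - (fun t => f (t, z.2)) z.1)).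
Proof.
apply/funext => h; congr (_ *: (f _ - f _)); last by case: z.
by rewrite /e1; case: z => a b; apply/pair_eqP; rewrite /= /GRing.scale /= mulr0 add0r !eqxx.
Qed.

Let quot2 f z : (fun h : R => h^-1 *: (f (h *: e2 R + z) - f z)) =
  (fun h : R => h^-1 *: ((fun t => f (z.1, t)) (h *: 1 + z.2) - (fun t => f (z.1, t)) z.2)).
Proof.
apply/funext => h; congr (_ *: (f _ - f _)); last by case: z.
by rewrite /e2; case: z => a b; apply/pair_eqP; rewrite /= /GRing.scale /= mulr0 add0r !eqxx.
Qed.

Lemma dxP f z d : dx f z d <-> der (fun t => f (t, z.2)) z.1 d.
Proof.
split=> -[h1 h2]; apply: DeriveDef.
- by move: h1; rewrite /derivable quot1.
- by move: h2; rewrite /derive quot1.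
- by move: h1; rewrite /derivable quot1.
- by move: h2; rewrite /derive quot1.
Qed.

Lemma dyP f z d : dy f z d <-> der (fun t => f (z.1, t)) z.2 d.
Proof.
split=> -[h1 h2]; apply: DeriveDef.
- by move: h1; rewrite /derivable quot2.
- by move: h2; rewrite /derive quot2.
- by move: h1; rewrite /derivable quot2.
- by move: h2; rewrite /derive quot2.
Qed.

Lemma dxE f z d : dx f z d -> 'D_(e1 R) f z = d.
Proof. by move=> h; exact: derive_val. Qed.

Lemma dyE f z d : dy f z d -> 'D_(e2 R) f z = d.
Proof. by move=> h; exact: derive_val. Qed.

End PartialDerivatives.

Section RadialSmooth.
Variable R : realType.
Variable F : nat -> R -> R.
Hypothesis dF : forall k x, der (F k) x (F k.+1 x).

(** Polynomials in the coordinates with coefficients F^(k)(|x|^2), with [F k] the k-th derivative.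
    The class is closed under both partial derivatives, so smoothness of all orders is one
    induction. *)
Inductive radial_poly : (R * R -> R) -> Prop :=
| RPbase k : radial_poly (fun z => F k (sqnorm z))
| RPx f : radial_poly f -> radial_poly (fun z => z.1 * f z)
| RPy f : radial_poly f -> radial_poly (fun z => z.2 * f z)
| RPadd f g : radial_poly f -> radial_poly g -> radial_poly (fun z => f z + g z).

Lemma der_sqnorm1 (y x : R) : der (fun t => sqnorm (t, y)) x (x + x).
Proof.
rewrite /sqnorm /=.
apply: derE; first by apply: derD; [apply: der_sqr; exact: der_id|exact: der_cst].
by rewrite /=; ring.
Qed.

Lemma der_sqnorm2 (y x : R) : der (fun t => sqnorm (x, t)) y (y + y).
Proof.
rewrite /sqnorm /=.
apply: derE; first by apply: derD; [exact: der_cst|apply: der_sqr; exact: der_id].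
by rewrite /=; ring.
Qed.

Lemma radial_poly_dx f : radial_poly f -> exists2 g, radial_poly g & forall z, dx f z (g z).
Proof.
elim=> [k|{}f rf [g rg dg]|{}f rf [g rg dg]|{}f {}g rf [f' rf' df] rg [g' rg' dg]].
- exists (fun z => z.1 * F k.+1 (sqnorm z) + z.1 * F k.+1 (sqnorm z)).
    by apply: RPadd; apply: RPx; exact: RPbase.
  move=> [x y]; apply/dxP => /=.
  by apply: derE; [apply: (@der_comp R (F k)); [exact: dF|exact: der_sqnorm1]|rewrite /=; ring].
- exists (fun z => f z + z.1 * g z); first by apply: RPadd => //; exact: RPx.
  move=> [x y]; apply/dxP => /=.
  by apply: derE; [apply: derM; [exact: der_id|exact/(dxP f (x, y))/dg]|rewrite /=; ring].
- exists (fun z => z.2 * g z); first exact: RPy.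
  by move=> [x y]; apply/dxP => /=; apply: derZ; exact/(dxP f (x, y))/dg.
- exists (fun z => f' z + g' z); first exact: RPadd.
  by move=> [x y]; apply/dxP => /=; apply: derD; [exact/(dxP f (x, y))/df|exact/(dxP g (x, y))/dg].
Qed.

Lemma radial_poly_dy f : radial_poly f -> exists2 g, radial_poly g & forall z, dy f z (g z).
Proof.
elim=> [k|{}f rf [g rg dg]|{}f rf [g rg dg]|{}f {}g rf [f' rf' df] rg [g' rg' dg]].
- exists (fun z => z.2 * F k.+1 (sqnorm z) + z.2 * F k.+1 (sqnorm z)).
    by apply: RPadd; apply: RPy; exact: RPbase.
  move=> [x y]; apply/dyP => /=.
  by apply: derE; [apply: (@der_comp R (F k)); [exact: dF|exact: der_sqnorm2]|rewrite /=; ring].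
- exists (fun z => z.1 * g z); first exact: RPx.
  by move=> [x y]; apply/dyP => /=; apply: derZ; exact/(dyP f (x, y))/dg.
- exists (fun z => f z + z.2 * g z); first by apply: RPadd => //; exact: RPy.
  move=> [x y]; apply/dyP => /=.
  by apply: derE; [apply: derM; [exact: der_id|exact/(dyP f (x, y))/dg]|rewrite /=; ring].
- exists (fun z => f' z + g' z); first exact: RPadd.
  by move=> [x y]; apply/dyP => /=; apply: derD; [exact/(dyP f (x, y))/df|exact/(dyP g (x, y))/dg].
Qed.

Lemma continuous_sqnorm : continuous (@sqnorm R).
Proof.
move=> z; rewrite /sqnorm; under eq_fun do rewrite !expr2.
by apply: cvgD; apply: cvgM; (exact: cvg_fst || exact: cvg_snd).
Qed.

Lemma radial_poly_cont f : radial_poly f -> continuous f.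
Proof.
elim=> [k z|{}f _ cf z|{}f _ cf z|{}f g _ cf _ cg z].
- apply: (@continuous_comp _ _ _ (@sqnorm R) (F k)); first exact: continuous_sqnorm.
  exact: der_cont (dF _ _).
- by apply: cvgM; [exact: cvg_fst|exact: cf].
- by apply: cvgM; [exact: cvg_snd|exact: cf].
- by apply: cvgD; [exact: cf|exact: cg].
Qed.

Lemma radial_poly_iter f s : radial_poly f -> radial_poly (iter_pd s f).
Proof.
move=> rf; elim: s => // b s ih /=; case: b.
  have [g rg dg] := radial_poly_dx ih.
  by rewrite (_ : (fun x => _) = g) //; apply/funext => z; exact: dxE (dg z).
have [g rg dg] := radial_poly_dy ih.
by rewrite (_ : (fun x => _) = g) //; apply/funext => z; exact: dyE (dg z).
Qed.

Lemma radial_smooth k : smooth (fun z => F k (sqnorm z)).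
Proof.
move=> s; have rs := radial_poly_iter s (RPbase k); split; first exact: radial_poly_cont.
move=> z; have [g _ dg] := radial_poly_dx rs; have [g' _ dg'] := radial_poly_dy rs.
by split; [have [] := dg z|have [] := dg' z].
Qed.

Lemma laplacian_radial z :
  laplacian (fun z => F 0 (sqnorm z)) z = 4 * (F 1 (sqnorm z) + sqnorm z * F 2 (sqnorm z)).
Proof.
rewrite /laplacian /=.
have -> : (fun x => 'D_(e1 R) (fun z => F 0 (sqnorm z)) x) = (fun z => 2 * z.1 * F 1 (sqnorm z)).
  apply/funext => -[x y]; apply: dxE; apply/dxP => /=.
  by apply: derE; [apply: (@der_comp R (F 0)); [exact: dF|exact: der_sqnorm1]|rewrite /=; ring].
have -> : (fun x => 'D_(e2 R) (fun z => F 0 (sqnorm z)) x) = (fun z => 2 * z.2 * F 1 (sqnorm z)).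
  apply/funext => -[x y]; apply: dyE; apply/dyP => /=.
  by apply: derE; [apply: (@der_comp R (F 0)); [exact: dF|exact: der_sqnorm2]|rewrite /=; ring].
case: z => x y.
rewrite (@dxE R _ _ (2 * F 1 (sqnorm (x, y)) + 4 * x ^+ 2 * F 2 (sqnorm (x, y)))); last first.
  apply/dxP => /=; apply: derE.
    apply: derM; first by apply: derZ; exact: der_id.
    by apply: (@der_comp R (F 1)); [exact: dF|exact: der_sqnorm1].
  by rewrite /=; ring.
rewrite (@dyE R _ _ (2 * F 1 (sqnorm (x, y)) + 4 * y ^+ 2 * F 2 (sqnorm (x, y)))); last first.
  apply/dyP => /=; apply: derE.
    apply: derM; first by apply: derZ; exact: der_id.
    by apply: (@der_comp R (F 1)); [exact: dF|exact: der_sqnorm2].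
  by rewrite /=; ring.
by rewrite [in sqnorm _ * _]/sqnorm /=; ring.
Qed.

End RadialSmooth.

(** * Smooth bumps *)

Section FlatFunctions.
Variable R : realType.

(* The functions x^(-k) e^(-1/x) span a space closed under differentiation. *)
Definition flat (k : nat) (x : R) : R := if 0 < x then x^-1 ^+ k * expR (- x^-1) else 0.

Lemma flat_ge0 k x : 0 <= flat k x.
Proof.
rewrite /flat; case: ifPn => // x0.
by rewrite mulr_ge0 ?expR_ge0 // exprn_ge0 // invr_ge0 ltW.
Qed.

(** From e^y >= (y / m)^m with y = 1 / x and m = k + 2. A quadratic bound is what makes the
    derivative at 0 vanish. *)
Lemma flat_le k x : flat k x <= (k.+2)%:R ^+ k.+2 * x ^+ 2.
Proof.
rewrite /flat; case: ifPn => [x0|_]; last by rewrite mulr_ge0 ?sqr_ge0 // exprn_ge0.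
set m := k.+2; have m0 : 0 < m%:R :> R by rewrite ltr0n.
pose y := x^-1; have y0 : 0 < y by rewrite invr_gt0.
have e1 : (y / m%:R) ^+ m <= expR y.
  have -> : expR y = expR (y / m%:R) ^+ m by rewrite -expRM_natl mulrC divfK // gt_eqF.
  have ym : 0 <= y / m%:R by rewrite divr_ge0 // ltW.
  rewrite lerXn2r // ?nnegrE ?expR_ge0 //.
  by apply: le_trans (expR_ge1Dx _); lra.
rewrite -/y expRN ler_pdivrMr ?expR_gt0 //.
apply: (@le_trans _ _ (m%:R ^+ m * x ^+ 2 * (y / m%:R) ^+ m)).
  rewrite expr_div_n; have -> : m%:R ^+ m * x ^+ 2 * (y ^+ m / m%:R ^+ m) = x ^+ 2 * y ^+ m.
    by field; rewrite expf_neq0 // gt_eqF.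
  have -> : x ^+ 2 * y ^+ m = (x * y) ^+ 2 * y ^+ k by rewrite /m !exprS; ring.
  by rewrite /y mulfV ?gt_eqF // expr1n mul1r.
by rewrite ler_wpM2l // mulr_ge0 ?sqr_ge0 // exprn_ge0 // ltW.
Qed.

Lemma der_exprn (f : R -> R) (x a : R) n : der f x a ->
  der (fun y => f y ^+ n) x (n%:R * a * f x ^+ n.-1).
Proof.
move=> h; elim: n => [|n ih].
  by rewrite !mul0r; under eq_fun do rewrite expr0; exact: der_cst.
under eq_fun do rewrite exprS.
apply: derE (derM h ih) _ => /=.
case: n {ih} => [|n] /=; first by rewrite expr0; ring.
by rewrite -[n.+2]addn1 natrD (exprS _ n); ring.
Qed.

Lemma der_flat k x : der (flat k) x (- k%:R * flat k.+1 x + flat k.+2 x).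
Proof.
have [x0|x0|->] := ltgtP x 0.
- have -> : - k%:R * flat k.+1 x + flat k.+2 x = 0.
    by rewrite /flat !ifF ?mulr0 ?addr0 //; apply/negbTE; rewrite -leNgt ltW.
  apply: (@der_near R (fun=> 0)); last exact: der_cst.
  near=> y; rewrite /flat ifF //; apply/negbTE; rewrite -leNgt.
  near: y; exists (- x); first by rewrite /= oppr_gt0.
  by move=> y /=; rewrite ltr_norml; lra.
- have -> : - k%:R * flat k.+1 x + flat k.+2 x =
     - k%:R * (x^-1 ^+ k.+1 * expR (- x^-1)) + x^-1 ^+ k.+2 * expR (- x^-1).
    by rewrite /flat x0.
  apply: (@der_near R (fun x => x^-1 ^+ k * expR (- x^-1))).
    near=> y; rewrite /flat ifT //.
    near: y; exists x => //.
    by move=> y /=; rewrite ltr_norml; lra.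
  have di : der (fun y : R => y^-1) x (- 1 / x ^+ 2) by apply: derV; [rewrite gt_eqF|exact: der_id].
  apply: derE; first by apply: derM; [apply: der_exprn; exact: di|apply: der_exp; apply: derN; exact: di].
  have -> : - 1 / x ^+ 2 = - x^-1 ^+ 2 by rewrite mulN1r exprVn.
  case: k => [|k] /=; first by rewrite !expr0; ring.
  by rewrite !exprS; ring.
- have -> : - k%:R * flat k.+1 0 + flat k.+2 0 = 0 :> R by rewrite /flat ltxx mulr0 addr0.
  have cv : (fun h : R => h^-1 *: (flat k (h *: 1 + 0) - flat k 0)) @ 0^' --> (0 : R).
    apply/cvgrPdist_lt => e e0.
    pose C : R := (k.+2)%:R ^+ k.+2; have C0 : 0 <= C by rewrite exprn_ge0.
    exists (e / (C + 1)); first by rewrite /= divr_gt0 //; lra.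
    move=> h /= hh hn; rewrite sub0r normrN addr0.
    have -> : flat k 0 = 0 by rewrite /flat ltxx.
    rewrite subr0 normrM normfV (ger0_norm (flat_ge0 _ _)).
    have h1 : h *: 1 = h by rewrite /GRing.scale /= mulr1.
    rewrite h1 mulrC ltr_pdivrMr ?normr_gt0 //.
    apply: (le_lt_trans (flat_le _ _)); rewrite -/C -(real_normK (num_real h)) expr2 mulrA ltr_pM2r ?normr_gt0 //.
    move: hh; rewrite sub0r normrN ltr_pdivlMr; last lra.
    by apply: le_lt_trans; rewrite mulrC ler_wpM2l //; lra.
  by apply: DeriveDef; [apply/cvg_ex; exists 0; exact: cv|apply/cvg_lim => //; exact: cv].
Unshelve. all: by end_near. Qed.

Lemma flat0_lt1 x : flat 0 x <= 1.
Proof.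
rewrite /flat; case: ifPn => // x0; rewrite expr0 mul1r -expR0 ler_expR oppr_le0 invr_ge0.
exact: ltW.
Qed.

Section Bump.
Variables (c g : R).

(** An algebra closed under differentiation, from which the successive derivatives of the bump are
    chosen one after the other. *)
Inductive bump_alg : (R -> R) -> Prop :=
| BAl k : bump_alg (fun s => flat k (c * s))
| BAr k : bump_alg (fun s => flat k (c * (g - s)))
| BAadd u v : bump_alg u -> bump_alg v -> bump_alg (fun s => u s + v s)
| BAmul u v : bump_alg u -> bump_alg v -> bump_alg (fun s => u s * v s)
| BAscale a u : bump_alg u -> bump_alg (fun s => a * u s).

Lemma bump_alg_der u : bump_alg u -> exists u', bump_alg u' /\ forall s, der u s (u' s).
Proof.
elim=> [k|k|{}u v hu [u' [hu' du]] hv [v' [hv' dv]]|{}u v hu [u' [hu' du]] hv [v' [hv' dv]]|a {}u hu [u' [hu' du]]].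
- exists (fun s => c * (- k%:R * flat k.+1 (c * s) + flat k.+2 (c * s))); split.
    by apply: BAscale; apply: BAadd; [apply: BAscale; exact: BAl|exact: BAl].
  move=> s; apply: derE.
    by apply: (@der_comp R (flat k)); [exact: der_flat|apply: derZ; exact: der_id].
  by ring.
- exists (fun s => - c * (- k%:R * flat k.+1 (c * (g - s)) + flat k.+2 (c * (g - s)))); split.
    by apply: BAscale; apply: BAadd; [apply: BAscale; exact: BAr|exact: BAr].
  move=> s; apply: derE.
    by apply: (@der_comp R (flat k)); [exact: der_flat|apply: derZ; apply: derB; [exact: der_cst|exact: der_id]].
  by ring.
- by exists (fun s => u' s + v' s); split; [exact: BAadd|move=> s; exact: derD].
- exists (fun s => u' s * v s + u s * v' s); split; last by move=> s; exact: derM.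
  by apply: BAadd; exact: BAmul.
- by exists (fun s => a * u' s); split; [exact: BAscale|move=> s; exact: derZ].
Qed.

(** Equal to exp(-1 / (c s) - 1 / (c (g - s))) on (0, g) and 0 elsewhere. The support does not move
    as [c] grows, while both exponents tend to 0 inside. *)
Definition bump s := flat 0 (c * s) * flat 0 (c * (g - s)).

Lemma bump_derivatives : exists F : nat -> R -> R, F 0 = bump /\ forall k s, der (F k) s (F k.+1 s).
Proof.
pose T := {u | bump_alg u}.
have b0 : bump_alg bump by exact: BAmul (BAl 0) (BAr 0).
pose next (u : T) : T := let h := cid (bump_alg_der (proj2_sig u)) in
  exist _ (sval h) (proj1 (proj2_sig h)).
exists (fun k => sval (iter k next (exist _ bump b0))); split => // k s /=.
set u := iter k _ _; rewrite /next; case: cid => /= u' [_ du]; exact: du.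
Qed.

End Bump.
End FlatFunctions.

Section IntegralTools.
Variable R : realType.
Local Notation leb := (@lebesgue_measure R).
Implicit Types (f h : R -> R) (a b : R).

Lemma continuous_bounded_itv h a b : a <= b -> continuous h ->
  exists2 M, 0 <= M & forall s, a <= s <= b -> `|h s| <= M.
Proof.
move=> ab ch.
have cn : {within `[a, b], continuous (fun s => `|h s|)}.
  apply: continuous_subspaceT => s; apply: (@continuous_comp _ _ _ h Num.norm); first exact: ch.
  exact: norm_continuous.
have [c _ hc] := EVT_max ab cn.
by exists `|h c| => // s hs; apply: hc; rewrite in_itv.
Qed.

Lemma integrable_mul_cont f h a b (i : interval R) : a <= b -> [set` i] `<=` `[a, b] ->
  leb.-integrable [set` i] (EFin \o f) -> continuous h ->
  leb.-integrable [set` i] (EFin \o (fun s => f s * h s)).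
Proof.
move=> ab iab fi ch; have [M M0 hM] := continuous_bounded_itv ab ch.
have mi : measurable [set` i] by exact: measurable_itv.
have mf : measurable_fun [set` i] f by apply/measurable_EFinP; exact: measurable_int fi.
apply: (@le_integrable _ _ _ leb _ mi _ (fun s => M%:E * `|(f s)%:E|)%E).
- apply/measurable_EFinP; apply: measurable_funM => //.
  by apply: measurable_funTS; exact: continuous_measurable_fun.
- move=> s si /=; rewrite lee_fin normrM normrM (ger0_norm M0) normr_id mulrC.
  by rewrite ler_wpM2r // hM //; have := iab s si; rewrite /= in_itv.
- by apply: integrableZl => //; exact: integrable_abse.
Qed.

Lemma integrable_extend f (c : R) : (forall s, c <= s -> f s = 0) ->
  leb.-integrable `[0, c[ (EFin \o f) ->
  leb.-integrable `[0, +oo[ (EFin \o f) /\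
  Rintegral leb `[0, +oo[ f = Rintegral leb `[0, c[ f.
Proof.
move=> f0 fi.
have e : f \_ `[0, +oo[ = f \_ `[0, c[.
  apply/funext => s; rewrite !patchE.
  have [sc|cs] := ltP s c.
    have -> : (s \in (`[0, +oo[%classic : set R)) = (s \in (`[0, c[%classic : set R)) => //.
    by apply/idP/idP; rewrite !inE /= !in_itv /= ?andbT ?sc ?andbT.
  by rewrite f0 //; case: ifP; case: ifP.
split; last by rewrite Rintegral_mkcond e -Rintegral_mkcond.
apply/integrable_mkcond => //; rewrite restrict_EFin e -restrict_EFin.
exact: ((@integrable_mkcond _ _ _ leb `[0, c[%classic (EFin \o f) (measurable_itv _)).1 fi).
Qed.

End IntegralTools.

(** * Limits of the bumps and of their second primitives *)

Section BumpLimit.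
Variable R : realType.
Variable g : R.
Hypothesis g0 : 0 < g.
Implicit Types (c d s : R).

Lemma bump_bounds c s : 0 <= bump c g s <= 1.
Proof.
have [h1 h2] := (flat_ge0 0 (c * s), flat_ge0 0 (c * (g - s))).
have [k1 k2] := (flat0_lt1 (c * s), flat0_lt1 (c * (g - s))).
by rewrite mulr_ge0 //= /bump -[leRHS]mulr1 ler_pM.
Qed.

Lemma continuous_bump c : continuous (bump c g).
Proof.
have [F [F0 dF]] := bump_derivatives c g.
by move=> s; rewrite -F0; exact: der_cont (dF 0 s).
Qed.

Lemma bump_out c s : 0 <= c -> g <= s -> bump c g s = 0.
Proof.
move=> c0 gs; rewrite /bump [flat 0 (c * (g - s))]/flat ifF ?mulr0 //.
by apply/negbTE; rewrite -leNgt mulr_ge0_le0 // subr_le0.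
Qed.

(** Each factor is at least 1 - 1 / (c d) by e^(-y) >= 1 - y, and a b >= a + b - 1 for a, b <= 1. *)
Lemma bump_ge c d s : 0 < c -> 0 < d -> d <= s <= g - d -> 1 - 2 / (c * d) <= bump c g s.
Proof.
move=> c0 d0 /andP[ds sg].
have key x : d <= x -> 1 - (c * d)^-1 <= flat 0 (c * x).
  move=> dx; have x1 : 0 < x by lra.
  have x0 : 0 < c * x by rewrite mulr_gt0.
  rewrite /flat x0 expr0 mul1r.
  have := expR_ge1Dx (- (c * x)^-1).
  have : (c * x)^-1 <= (c * d)^-1 by rewrite lef_pV2 ?posrE ?mulr_gt0 // ler_pM2l.
  lra.
have := key s ds; have := key (g - s) ltac:(lra).
have [k1 k2] := (flat0_lt1 (c * s), flat0_lt1 (c * (g - s))).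
have [h1 h2] := (flat_ge0 0 (c * s), flat_ge0 0 (c * (g - s))).
rewrite /bump; set a := flat _ _; set b := flat _ _.
have : 0 <= (1 - flat 0 (c * s)) * (1 - flat 0 (c * (g - s))) by rewrite mulr_ge0 // subr_ge0.
rewrite -/a -/b; lra.
Qed.

(** The L^1 distance from the bump to the indicator of (0, g); this single number controls the
    errors of both primitives. *)
Definition bump_defect c := g - prim (bump c g) g.

Lemma bump_defect_le c d : 0 < c -> 0 < d -> d <= g / 2 ->
  bump_defect c <= 2 * d + 2 * g / (c * d).
Proof.
move=> c0 d0 dg.
have cb := @continuous_bump c.
have dP x : der (prim (bump c g)) x (bump c g x) by exact: der_prim.
have mono a b : a <= b -> prim (bump c g) a <= prim (bump c g) b.
  by move=> ab; apply: (der_le ab (fun x _ => dP x)) => x _; have /andP[] := bump_bounds c x.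
have h1 := mono 0 d (ltW d0); have h2 := mono (g - d) g ltac:(lra).
rewrite prim0 // in h1.
have dg' : d <= g - d by lra.
have hd x : d <= x <= g - d -> der (fun s => (1 - 2 / (c * d)) * s) x (1 - 2 / (c * d)).
  by move=> _; apply: derE; [apply: derZ; exact: der_id|rewrite mulr1].
have := der_le2 dg' hd (fun x _ => dP x) (fun x hx => bump_ge c0 d0 hx).
have cd : 0 < (c * d)^-1 by rewrite invr_gt0 mulr_gt0.
rewrite /bump_defect; set A := prim _ g in h2 *; set B := prim _ (g - d) in h2 *.
set C := prim _ d in h1 *; set k := (c * d)^-1 in cd *.
have : 0 < k * d by rewrite mulr_gt0.
lra.
Qed.

Lemma bump_defect_le_width c : bump_defect c <= g.
Proof.
have cb := @continuous_bump c.
have := der_le (ltW g0) (fun x _ => der_prim x cb) (fun x _ => proj1 (andP (bump_bounds c x))).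
by rewrite prim0 // /bump_defect; lra.
Qed.

Lemma bump_defect_cvg : bump_defect n.+1%:R @[n --> \oo] --> (0 : R).
Proof.
apply/cvgrPdist_lt => e e0.
pose d := Num.min (e / 8) (g / 2).
have d0 : 0 < d by have := g0; rewrite lt_min; move=> ?; apply/andP; split; lra.
have [d1 d2] : d <= e / 8 /\ d <= g / 2 by rewrite /d; split; rewrite ge_min lexx ?orbT.
pose M := 4 * g / (d * e).
have M0 : 0 < M by rewrite divr_gt0 ?mulr_gt0.
exists (Num.truncn M) => //= n /= hn.
have nM : M < n.+1%:R.
  by apply: (lt_le_trans (truncnS_gt M)); rewrite ler_nat ltnS.
have n0 : 0 < n.+1%:R :> R by rewrite ltr0n.
have h := bump_defect_le n0 d0 d2.
have h0 : 0 <= bump_defect n.+1%:R.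
  have := @der_le2 R (prim (bump n.+1%:R g)) (bump n.+1%:R g) (fun s => s) (fun=> 1) 0 g (ltW g0)
    (fun x _ => der_prim x (@continuous_bump n.+1%:R)) (fun x _ => der_id x).
  have H : forall x, 0 <= x <= g -> bump n.+1%:R g x <= 1.
    by move=> x _; have /andP[] := bump_bounds n.+1%:R x.
  by move=> /(_ H); rewrite prim0 ?subr0 // /bump_defect; [lra|exact: continuous_bump].
rewrite sub0r normrN ger0_norm //; apply: (le_lt_trans h).
have : 2 * g / (n.+1%:R * d) < e / 2.
  rewrite ltr_pdivrMr ?mulr_gt0 //.
  have : M * (d * e) < n.+1%:R * (d * e) by rewrite ltr_pM2r // mulr_gt0.
  rewrite /M divfK; last by rewrite gt_eqF // mulr_gt0.
  lra.
set X := 2 * g / _; lra.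
Qed.

(* Second primitives vanishing for s >= g: as c -> +oo, [bump c g] tends to the
   indicator of (0, g), [bump1] to s - g and [bump2] to (g - s)^2 / 2 on (0, g). *)
Definition bump1 c s := prim (bump c g) s - prim (bump c g) g.
Definition bump2 c s := prim (bump1 c) s - prim (bump1 c) g.

Lemma der_bump1 c s : der (bump1 c) s (bump c g s).
Proof.
apply: derE; first by apply: derB; [apply: der_prim; exact: continuous_bump|exact: der_cst].
by rewrite subr0.
Qed.

Lemma continuous_bump1 c : continuous (bump1 c).
Proof. by move=> s; exact: der_cont (der_bump1 c s). Qed.

Lemma der_bump2 c s : der (bump2 c) s (bump1 c s).
Proof.
apply: derE; first by apply: derB; [apply: der_prim; exact: continuous_bump1|exact: der_cst].
by rewrite subr0.
Qed.

Lemma continuous_bump2 c : continuous (bump2 c).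
Proof. by move=> s; exact: der_cont (der_bump2 c s). Qed.

Lemma bump1_out c s : 0 <= c -> g <= s -> bump1 c s = 0.
Proof.
move=> c0 gs; have <- : bump1 c g = 0 by rewrite /bump1 subrr.
apply/esym; apply: der0_cst => // x /andP[gx _].
by apply: derE (der_bump1 c x) _; rewrite bump_out.
Qed.

Lemma bump2_out c s : 0 <= c -> g <= s -> bump2 c s = 0.
Proof.
move=> c0 gs; have <- : bump2 c g = 0 by rewrite /bump2 subrr.
apply/esym; apply: der0_cst => // x /andP[gx _].
by apply: derE (der_bump2 c x) _; rewrite bump1_out.
Qed.

Lemma bump1_approx c s : 0 <= s <= g -> 0 <= bump1 c s + (g - s) <= bump_defect c.
Proof.
move=> /andP[s0 sg].
have cb := @continuous_bump c.
have mono a b : a <= b -> prim (bump c g) b - prim (bump c g) a <= b - a.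
  move=> ab; apply: (der_le2 ab (fun x _ => der_prim x cb) (fun x _ => der_id x)) => x _.
  by have /andP[] := bump_bounds c x.
have := mono s g sg; have := mono 0 s s0; rewrite prim0 // /bump1 /bump_defect; lra.
Qed.

Lemma bump2_approx c s : 0 <= s <= g -> `|bump2 c s - (g - s) ^+ 2 / 2| <= bump_defect c * g.
Proof.
move=> /andP[s0 sg].
have hd x : der (fun s => bump2 c s - 2^-1 * (g - s) ^+ 2) x (bump1 c x + (g - x)).
  apply: derE.
    apply: derB; first exact: der_bump2.
    apply: derZ; apply: der_sqr; apply: derB; [exact: der_cst|exact: der_id].
  by rewrite /=; field.
have hd2 x : der (fun s => bump_defect c * s) x (bump_defect c).
  by apply: derE; [apply: derZ; exact: der_id|rewrite mulr1].
have H : forall x, s <= x <= g -> `|bump1 c x + (g - x)| <= bump_defect c.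
  move=> x hx; have := @bump1_approx c x ltac:(lra) => /andP[h1 h2].
  by rewrite ger0_norm.
have := der_norm_le sg (fun x _ => hd x) (fun x _ => hd2 x) H.
rewrite subrr expr0n /= mulr0 subr0.
have -> : bump2 c g = 0 by rewrite /bump2 subrr.
rewrite sub0r normrN.
have D0 : 0 <= bump_defect c by have := bump1_approx c (s := 0); rewrite lexx (ltW g0) => /(_ isT) /andP[h]; apply: le_trans.
have : 0 <= bump_defect c * s by rewrite mulr_ge0.
rewrite [_ / 2]mulrC; lra.
Qed.

(** The bump vanishes at s = 0 and does not tend to 1 there. The factor s, present in the Laplacian,
    restores convergence at 0. *)
Lemma bump_cvg s : 0 <= s < g -> s * bump n.+1%:R g s @[n --> \oo] --> s.
Proof.
move=> /andP[s0 sg]; have [->|sn] := eqVneq s 0.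
  by under eq_fun do rewrite mul0r; exact: cvg_cst.
have sp : 0 < s by rewrite lt_neqAle eq_sym sn.
pose d := Num.min s (g - s).
have d0 : 0 < d by rewrite lt_min sp subr_gt0.
have [d1 d2] : d <= s /\ d <= g - s by rewrite /d; split; rewrite ge_min lexx ?orbT.
apply/cvgrPdist_lt => e e0.
pose M := 2 * s / (d * e).
have M0 : 0 < M by rewrite divr_gt0 ?mulr_gt0.
exists (Num.truncn M) => //= n /= hn.
have nM : M < n.+1%:R.
  by apply: (lt_le_trans (truncnS_gt M)); rewrite ler_nat ltnS.
have n0 : 0 < n.+1%:R :> R by rewrite ltr0n.
have h := @bump_ge n.+1%:R d s n0 d0 ltac:(lra).
have /andP[b0 b1] := bump_bounds n.+1%:R s.
have sb : s * bump n.+1%:R g s <= s * 1 by rewrite ler_wpM2l.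
rewrite ger0_norm; last lra.
have : s * (1 - 2 / (n.+1%:R * d)) <= s * bump n.+1%:R g s by rewrite ler_wpM2l.
rewrite mulrBr mulr1.
have : s * (2 / (n.+1%:R * d)) < e.
  rewrite mulrA ltr_pdivrMr ?mulr_gt0 //.
  have : M * (d * e) < n.+1%:R * (d * e) by rewrite ltr_pM2r // mulr_gt0.
  rewrite /M divfK; last by rewrite gt_eqF // mulr_gt0.
  lra.
set X := s * _; set Y := s * _; lra.
Qed.

Lemma bump_test c : 0 <= c ->
  exists F : nat -> R -> R, [/\ F 0 = bump2 c, F 1 = bump1 c, F 2 = bump c g &
    forall k s, der (F k) s (F k.+1 s)].
Proof.
move=> c0; have [F [F0 dF]] := bump_derivatives c g.
exists (fun k => match k with 0 => bump2 c | 1 => bump1 c | k.+2 => F k end).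
split => //; case=> [|[|k]] s; [exact: der_bump2| |exact: dF].
by rewrite F0; exact: der_bump1.
Qed.

End BumpLimit.

(** * From the weak equation to the Toda system *)

Section IntegralFunction.
Variable R : realType.
Local Notation leb := (@lebesgue_measure R).
Implicit Types (f g phi : R -> R).

Definition int0 f (c : R) : R := Rintegral leb `[0, c] f.

Lemma int0_cont f s : (forall c, leb.-integrable `[0, c] (EFin \o f)) -> 0 < s ->
  {for s, continuous (int0 f)}.
Proof.
move=> fi s0; have s1 : 0 < s + 1 by lra.
have := parameterized_integral_continuous (ltW s1) (fi (s + 1)).
move=> /(continuous_within_itvP _ s1)[c _ _].
by apply: c; rewrite in_itv /=; lra.
Qed.

Lemma int0_right f : (forall c, leb.-integrable `[0, c] (EFin \o f)) ->
  int0 f s @[s --> 0^'+] --> 0.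
Proof.
move=> fi; have s1 : 0 < 1 :> R by [].
have := parameterized_integral_continuous (ltW s1) (fi 1).
move=> /(continuous_within_itvP _ s1)[_ c _].
move: c; rewrite {2}/parameterized_integral.
by rewrite set_itv1 Rintegral_set1.
Qed.

Lemma int0_ae_der f : (forall c, leb.-integrable `[0, c] (EFin \o f)) ->
  {ae leb, forall x, 0 < x -> der (int0 f) x (f x)}.
Proof.
move=> fi.
(* Truncation makes the function integrable on the whole line. Countably many exceptional null sets
   are discarded, and [n] is then taken larger than the point. *)
pose fn (n : nat) := f \_ `[0, n%:R].
have fni n : leb.-integrable setT (EFin \o fn n).
  rewrite /fn -restrict_EFin.
  exact: ((@integrable_mkcond _ _ _ leb `[0, n%:R]%classic (EFin \o f) (measurable_itv _)).1 (fi n%:R)).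
have fniS n y : leb.-integrable `[0, y] (EFin \o fn n).
  by apply: (integrableS _ _ _ (fni n)).
have H n := @FTC1 R (fn n) (BLeft 0) (fniS n)
  (@integrable_locally R f `[0, n%:R]%classic (measurable_itv _) (fi n%:R)).
have := ae_foralln H; apply: filterS => x hx x0.
pose n := (Num.truncn x).+1; have xn : x < n%:R by exact: truncnS_gt.
have [d1 d2] := hx n x0.
have d : der (fun c => Rintegral leb `[0, c] (fn n)) x (fn n x).
  by apply: DeriveDef d1 _; rewrite -derive1E.
have fnE s : 0 <= s <= n%:R -> fn n s = f s.
  by move=> hs; rewrite /fn patchE mem_set //= in_itv.
rewrite -fnE; last by rewrite (ltW x0) ltW.
apply: der_near d; near=> y.
apply: eq_Rintegral => s; rewrite inE /= in_itv /= => /andP[s0 sy].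
have hs : 0 <= s <= n%:R.
  rewrite s0 /=; apply: (le_trans sy); apply: ltW.
  by near: y; exact: lt_nbhsl.
exact: fnE.
Unshelve. all: by end_near. Qed.

Lemma ae_int0 f phi c : (forall c, leb.-integrable `[0, c] (EFin \o f)) ->
  (forall s, 0 < s -> {for s, continuous phi}) ->
  {ae leb, forall s, 0 < s -> phi s = f s} ->
  leb.-integrable `[0, c] (EFin \o phi) /\ int0 phi c = int0 f c.
Proof.
move=> fi cphi ae.
have mp : measurable_fun (`]0, +oo[%classic : set R) phi.
  apply: open_continuous_measurable_fun; first by rewrite set_itvoy; exact: open_gt.
  by move=> s; rewrite inE /= in_itv /= andbT => s0; exact: cphi.
have m0 : measurable_fun ([set (0 : R)] `|` (`]0, +oo[%classic : set R)) phi.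
  apply/measurable_funU; [exact: measurable_set1|exact: measurable_itv|].
  by split => //; exact: measurable_fun_set1.
have mc : measurable_fun (`[0, c]%classic : set R) phi.
  apply: measurable_funS m0; first by apply: measurableU; [exact: measurable_set1|exact: measurable_itv].
  move=> s /=; rewrite !in_itv /= andbT le_eqVlt => /andP[/orP[/eqP <-|s0] _]; [by left|by right].
have mf : measurable_fun (`[0, c]%classic : set R) f by apply/measurable_EFinP; exact: measurable_int (fi c).
have ae0 : {ae leb, forall s, `[0, c]%classic s -> phi s = f s}.
  have n0 : {ae leb, forall s : R, s != 0}.
    exists [set 0]; split => //; first exact: lebesgue_measure_set1.
    by move=> s /= /negP; rewrite negbK => /eqP.
  apply: (@filterS2 _ _ (ae_filter_ringOfSetsType leb) _ _ _ _ ae n0) => s h s0; rewrite /= in_itv /= => /andP[s1 _].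
  by apply: h; rewrite lt_neqAle eq_sym s0.
split.
  apply/integrableP; split; first exact/measurable_EFinP.
  have /integrableP[_] := fi c.
  rewrite (@ae_eq_integral _ _ _ leb `[0, c]%classic (fun s => `|(EFin \o phi) s|)%E) //.
  - by apply/measurable_EFinP; exact: measurableT_comp.
  - by apply/measurable_EFinP; exact: measurableT_comp.
  - by apply: (@filterS _ _ (ae_filter_ringOfSetsType leb) _ _ _ ae0) => s h /h /= ->.
rewrite /int0 /Rintegral (@ae_eq_integral _ _ _ leb `[0, c]%classic (EFin \o f)) //.
- exact/measurable_EFinP.
- exact/measurable_EFinP.
- by apply: (@filterS _ _ (ae_filter_ringOfSetsType leb) _ _ _ ae0) => s h /h /= ->.
Qed.

(** Upgrades Lebesgue differentiation to every s > 0 once [f] has a continuous version; this drives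
    the regularity argument. *)
Lemma int0_der f phi s : (forall c, leb.-integrable `[0, c] (EFin \o f)) ->
  (forall s, 0 < s -> {for s, continuous phi}) ->
  {ae leb, forall s, 0 < s -> phi s = f s} -> 0 < s ->
  der (int0 f) s (phi s).
Proof.
move=> fi cphi ae s0.
have s1 : s < s + 1 by lra.
have H : derivable (int0 phi) s 1 /\ (int0 phi)^`()%classic s = phi s.
  exact: (@continuous_FTC1 R phi (BLeft 0) s (s + 1) s1 (ae_int0 (s + 1) fi cphi ae).1 s0 (cphi s s0)).
have e : int0 f = int0 phi by apply/funext => c; rewrite (ae_int0 c fi cphi ae).2.
by rewrite e; case: H => d1 d2; apply: DeriveDef d1 _; rewrite -derive1E.
Qed.

Lemma integrableZ f a (i : interval R) :
  leb.-integrable [set` i] (EFin \o f) -> leb.-integrable [set` i] (EFin \o (fun s => a * f s)).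
Proof.
move=> fi; rewrite (_ : EFin \o _ = fun s => (a%:E * (f s)%:E)%E); last by apply/funext.
by apply: integrableZl => //; exact: measurable_itv.
Qed.

Lemma integrable_lin f g a b (i : interval R) :
  leb.-integrable [set` i] (EFin \o f) -> leb.-integrable [set` i] (EFin \o g) ->
  leb.-integrable [set` i] (EFin \o (fun s => a * f s + b * g s)).
Proof.
move=> fi gi.
rewrite (_ : EFin \o _ = (EFin \o (fun s => a * f s)) \+ (EFin \o (fun s => b * g s))); last by apply/funext.
apply: integrableD; [exact: measurable_itv|exact: integrableZ|exact: integrableZ].
Qed.

Lemma Rintegral_lin f g a b (i : interval R) :
  leb.-integrable [set` i] (EFin \o f) -> leb.-integrable [set` i] (EFin \o g) ->
  Rintegral leb [set` i] (fun s => a * f s + b * g s) =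
  a * Rintegral leb [set` i] f + b * Rintegral leb [set` i] g.
Proof.
move=> fi gi; have mi : measurable [set` i] by exact: measurable_itv.
rewrite RintegralD //; [|exact: (integrableZ a fi)|exact: (integrableZ b gi)].
by rewrite !RintegralZl.
Qed.

End IntegralFunction.

(** * Radial profiles *)

Section Profile.
Variable R : realType.
Local Notation leb := (@lebesgue_measure R).
Implicit Types (v g : R * R -> R).

(* For s < 0 this is the junk value v (0, 0). *)
Definition profile v (s : R) : R := v (Num.sqrt s, 0).

Lemma profileE v z : radial v -> v z = profile v (sqnorm z).
Proof.
move=> rv; apply: rv; rewrite [in RHS]/sqnorm /= sqr_sqrtr ?sqnorm_ge0 //.
by rewrite expr0n addr0.
Qed.

Lemma measurable_profile v : measurable_fun setT v -> measurable_fun setT (profile v).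
Proof.
move=> mv; apply: (measurableT_comp mv).
apply: measurable_fun_pair; last exact: measurable_cst.
by apply: continuous_measurable_fun; exact: sqrt_continuous.
Qed.

Lemma L1loc_measurable v : L1loc v -> measurable_fun setT v.
Proof.
move=> lv.
have -> : [set: R * R] = \bigcup_n [set z | sqnorm z < n.+1%:R ^+ 2].
  apply/seteqP; split => // z _; exists (Num.truncn (sqnorm z)) => //=.
  apply: (lt_le_trans (truncnS_gt _)); rewrite expr2 -natrM ler_nat.
  by rewrite -[leqLHS]muln1 leq_mul2l.
apply/measurable_fun_bigcup => n.
  rewrite -[X in measurable X]setTI.
  exact: (measurable_sqnorm measurableT (measurable_itv `]-oo, _[)).
have n0 : 0 < n.+1%:R :> R by rewrite ltr0n.
by apply/measurable_EFinP; exact: measurable_int (lv _ n0).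
Qed.

Lemma profile_integrable v (c : R) : radial v -> L1loc v ->
  leb.-integrable `[0, c] (EFin \o profile v).
Proof.
move=> rv lv; have mv := L1loc_measurable lv; have mp := measurable_profile mv.
pose r := `|c| + 1; have r0 : 0 < r by rewrite /r; have := normr_ge0 c; lra.
have cr : c < r ^+ 2.
  have := ler_norm c; have := normr_ge0 c.
  by rewrite /r sqrrD expr1n mulr1; have := sqr_ge0 `|c|; lra.
pose f := profile v \_ [set s | s < r ^+ 2].
have mI : measurable [set s : R | s < r ^+ 2] by exact: (measurable_itv `]-oo, _[).
have mf : measurable_fun setT f by apply/(measurable_restrictT _ _).1 => //; exact: measurable_funTS.
have fi : leb.-integrable `[0, +oo[ (EFin \o f).
  apply/(polar_integrable mf); rewrite /L1.
  have mD : measurable [set z : R * R | sqnorm z < r ^+ 2].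
    rewrite -[X in measurable X]setTI.
    exact: (measurable_sqnorm measurableT (measurable_itv `]-oo, _[)).
  have := (@integrable_mkcond _ _ _ (@leb2 R) _ (EFin \o v) mD).1 (lv r r0).
  rewrite (_ : (EFin \o v) \_ _ = EFin \o (fun z => f (sqnorm z))) //.
  rewrite restrict_EFin; apply/funext => z /=; congr EFin; rewrite /f !patchE.
  have -> : (sqnorm z \in [set s | s < r ^+ 2]) = (z \in [set z | sqnorm z < r ^+ 2]).
    by apply/idP/idP; rewrite !inE.
  by rewrite (profileE z rv).
have sub : `[0, c]%classic `<=` (`[0, +oo[%classic : set R).
  by move=> s /=; rewrite !in_itv /= andbT => /andP[].
have := @integrableS _ _ _ leb _ _ _ (measurable_itv _) (measurable_itv _) sub fi.
apply: eq_integrable => //= s; rewrite inE /= in_itv /= => /andP[s0 sc].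
by rewrite /f patchE mem_set //=; exact: le_lt_trans cr.
Qed.

Lemma L1_profile g : radial g -> L1 g -> leb.-integrable `[0, +oo[ (EFin \o profile g).
Proof.
move=> rg lg.
have mg : measurable_fun setT g by apply/measurable_EFinP; exact: measurable_int lg.
apply/(polar_integrable (measurable_profile mg)).
by rewrite (_ : (fun z => _) = g) //; apply/funext => z; rewrite -profileE.
Qed.

Lemma L1_Rintegral_profile g : radial g -> L1 g ->
  Rintegral (@leb2 R) setT g = pi * Rintegral leb `[0, +oo[ (profile g).
Proof.
move=> rg lg.
have mg : measurable_fun setT g by apply/measurable_EFinP; exact: measurable_int lg.
rewrite -(polar_Rintegral (measurable_profile mg)) ?L1_profile //.
by congr Rintegral; apply/funext => z; rewrite -profileE.
Qed.

Lemma L1_L1loc g : L1 g -> L1loc g.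
Proof.
move=> lg r r0; apply: (integrableS _ _ _ lg) => //.
rewrite -[X in measurable X]setTI.
exact: (measurable_sqnorm measurableT (measurable_itv `]-oo, _[)).
Qed.

End Profile.

(** * Moment identity and continuous representatives *)

Section WeakIdentity.
Variable R : realType.
Local Notation leb := (@lebesgue_measure R).
Variables (v g : R * R -> R).
Hypotheses (rv : radial v) (rg : radial g) (lv : L1loc v) (lg : L1 g).
Hypothesis weak : dist_eq_mlap v g.

Let w := profile v.
Let h := profile g.

Let iw c : leb.-integrable `[0, c] (EFin \o w). Proof. exact: profile_integrable. Qed.
Let ih c : leb.-integrable `[0, c] (EFin \o h).
Proof. by apply: profile_integrable => //; exact: L1_L1loc. Qed.

Let half_open (f : R -> R) (c : R) : leb.-integrable `[0, c] (EFin \o f) ->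
  leb.-integrable `[0, c[ (EFin \o f).
Proof.
move=> fi; apply: (integrableS _ _ _ fi) => //.
by move=> s /=; rewrite !in_itv /= => /andP[-> /ltW ->].
Qed.

Let sub_co (c : R) : [set` `[0, c[] `<=` (`[0, c]%classic : set R).
Proof. by move=> s /=; rewrite !in_itv /= => /andP[-> /ltW ->]. Qed.

Let mw : measurable_fun setT w.
Proof. by apply: measurable_profile; exact: L1loc_measurable. Qed.
Let mh : measurable_fun setT h.
Proof. by apply: measurable_profile; apply: L1loc_measurable; exact: L1_L1loc. Qed.

Let bump_identity c gam : 0 <= c -> 0 < gam ->
  Rintegral leb `[0, gam[ (fun s => w s * (4 * (bump1 gam c s + s * bump c gam s)) +
     h s * bump2 gam c s) = 0.
Proof.
move=> c0 g0; have [F [F0 F1 F2 dF]] := bump_test gam c0.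
pose phi z := F 0 (sqnorm z).
have tphi : test_fun phi.
  split; first exact: (radial_smooth dF 0).
  by exists gam; split => // z gz; rewrite /phi F0; exact: bump2_out.
pose k1 s := 4 * (bump1 gam c s + s * bump c gam s).
have ck1 : continuous k1.
  move=> s; apply: cvgMr; apply: cvgD; first exact: continuous_bump1.
  by apply: cvgM; [exact: cvg_id|exact: continuous_bump].
have ck2 := @continuous_bump2 R gam c.
have i1 : leb.-integrable `[0, gam[ (EFin \o (fun s => w s * k1 s)).
  by apply: (@integrable_mul_cont R w k1 0 gam) => //; [exact: ltW|exact: half_open].
have i2 : leb.-integrable `[0, gam[ (EFin \o (fun s => h s * bump2 gam c s)).
  by apply: (@integrable_mul_cont R h _ 0 gam) => //; [exact: ltW|exact: half_open].
have z1 s : gam <= s -> w s * k1 s = 0.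
  by move=> gs; rewrite /k1 bump1_out // bump_out // mulr0 addr0 !mulr0.
have z2 s : gam <= s -> h s * bump2 gam c s = 0.
  by move=> gs; rewrite bump2_out // mulr0.
have [j1 e1] := integrable_extend z1 i1; have [j2 e2] := integrable_extend z2 i2.
have m1 : measurable_fun setT (fun s => w s * k1 s).
  by apply: measurable_funM => //; exact: continuous_measurable_fun.
have m2 : measurable_fun setT (fun s => h s * bump2 gam c s).
  by apply: measurable_funM => //; exact: continuous_measurable_fun.
rewrite RintegralD // -e1 -e2.
have := weak tphi.
have -> : (fun x => v x * laplacian phi x) = (fun z => (fun s => w s * k1 s) (sqnorm z)).
  apply/funext => z; rewrite (laplacian_radial dF) F1 F2 (profileE z rv) //.
have -> : (fun x => g x * phi x) = (fun z => (fun s => h s * bump2 gam c s) (sqnorm z)).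
  by apply/funext => z; rewrite /phi F0 (profileE z rg).
rewrite (polar_Rintegral m1 j1) (polar_Rintegral m2 j2).
rewrite -mulrN => /(mulfI (lt0r_neq0 (pi_gt0 R))) <-.
by rewrite subrr.
Qed.

Let J c gam s := w s * (4 * (bump1 gam c s + s * bump c gam s)) + h s * bump2 gam c s.
(** Pointwise limit of [J] on [0, gam): [bump1] tends to s - gam and s times the bump to s, so the
    Laplacian tends to 4 (2 s - gam). *)
Let J0 gam s := w s * (4 * (2 * s - gam)) + h s * ((gam - s) ^+ 2 / 2).

Let iJ c gam : 0 < gam -> leb.-integrable `[0, gam[ (EFin \o J c gam).
Proof.
move=> g0; rewrite (_ : EFin \o _ =
  (EFin \o (fun s => w s * (4 * (bump1 gam c s + s * bump c gam s)))) \+ (EFin \o (fun s => h s * bump2 gam c s))) //.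
apply: integrableD => //.
  apply: (@integrable_mul_cont R w _ 0 gam) => //; [exact: ltW|exact: half_open|].
  move=> s; apply: cvgMr; apply: cvgD; first exact: continuous_bump1.
  by apply: cvgM; [exact: cvg_id|exact: continuous_bump].
apply: (@integrable_mul_cont R h _ 0 gam) => //; [exact: ltW|exact: half_open|].
exact: continuous_bump2.
Qed.

Let cont_quad gam : continuous (fun s : R => (gam - s) ^+ 2 / 2).
Proof.
move=> s; apply: (@der_cont R _ s (2 * (gam - s) * (0 - 1) * 2^-1 + (gam - s) ^+ 2 * 0)).
by apply: derM; [apply: der_sqr; apply: derB; [exact: der_cst|exact: der_id]|exact: der_cst].
Qed.

Let cont_lin gam : continuous (fun s : R => 4 * (2 * s - gam)).
Proof.
move=> s; apply: cvgMr; apply: cvgB; last exact: cvg_cst.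
by apply: cvgMr; exact: cvg_id.
Qed.

Let iJ0 gam : 0 < gam -> leb.-integrable `[0, gam] (EFin \o J0 gam).
Proof.
move=> g0; rewrite (_ : EFin \o _ =
  (EFin \o (fun s => w s * (4 * (2 * s - gam)))) \+ (EFin \o (fun s => h s * ((gam - s) ^+ 2 / 2)))) //.
apply: integrableD => //.
  by apply: (@integrable_mul_cont R w _ 0 gam) => //; first exact: ltW.
by apply: (@integrable_mul_cont R h _ 0 gam) => //; first exact: ltW.
Qed.

(** The limiting test function (gam - s)^2 / 2, cut off at gam, has a jump in its second derivative
    and is not admissible; dominated convergence along the bumps justifies its use. *)
Lemma weak_moment gam : 0 < gam ->
  Rintegral leb `[0, gam] (fun s => w s * (4 * (2 * s - gam)) + h s * ((gam - s) ^+ 2 / 2)) = 0.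
Proof.
move=> g0; rewrite -Rintegral_itv_bndo_bndc; last exact: half_open (iJ0 g0).
have n0 n : 0 <= n.+1%:R :> R by [].
have cb n := bump_defect_le_width g0 n.+1%:R.
pose D s : \bar R := (`|w s| * (8 * gam) + `|h s| * (gam ^+ 2 * 2))%:E.
have mD : measurable (`[0, gam[ : set R) by exact: measurable_itv.
have i0 := half_open (iJ0 g0).
have iD : leb.-integrable `[0, gam[ D.
  rewrite (_ : D = (fun s => (8 * gam)%:E * `|(w s)%:E| + (gam ^+ 2 * 2)%:E * `|(h s)%:E|)%E); last first.
    by apply/funext => s; rewrite /D -!EFinM -EFinD [_ * (8 * gam)]mulrC [_ * (_ * 2)]mulrC.
  apply: integrableD => //; apply: integrableZl => //; apply: integrable_abse.
    exact: half_open (iw gam).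
  exact: half_open (ih gam).
have := @dominated_convergence _ _ R leb `[0, gam[%classic mD (fun n s => (J n.+1%:R gam s)%:E) (EFin \o J0 gam) D.
case=> //.
- by move=> n; exact: measurable_int (iJ n.+1%:R g0).
- exact: measurable_int i0.
- apply: aeW => s /=; rewrite in_itv /= => /andP[s0 sg].
  have sg' : 0 <= s <= gam by rewrite s0 ltW.
  have c1 : bump1 gam n.+1%:R s @[n --> \oo] --> (s - gam).
    apply/cvgrPdist_le => e e0.
    have /cvgrPdist_le /(_ e e0) := @bump_defect_cvg R gam g0.
    apply: filterS => n /=; have := bump1_approx n.+1%:R sg' => /andP[a1 a2].
    by rewrite sub0r normrN !ler_norml; lra.
  have c2 : bump2 gam n.+1%:R s @[n --> \oo] --> ((gam - s) ^+ 2 / 2).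
    apply/cvgrPdist_le => e e0.
    have /cvgrPdist_le /(_ (e / gam) (divr_gt0 e0 g0)) := @bump_defect_cvg R gam g0.
    apply: filterS => n /=; have := bump2_approx g0 n.+1%:R sg' => a1.
    rewrite sub0r normrN => a2; rewrite distrC; apply: (le_trans a1).
    rewrite -ler_pdivlMr //; apply: le_trans a2; exact: ler_norm.
  have c3 := @bump_cvg R gam s; rewrite s0 sg in c3; have {}c3 := c3 isT.
  have cJ : J n.+1%:R gam s @[n --> \oo] --> J0 gam s.
    rewrite /J /J0 (_ : 2 * s - gam = (s - gam) + s); last ring.
    apply: cvgD; apply: cvgMr => //; apply: cvgMr; exact: cvgD.
  by apply: cvg_EFin => //; exact: nearW.
- apply: aeW => s n /=; rewrite in_itv /= => /andP[s0 sg].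
  have sg' : 0 <= s <= gam by rewrite s0 ltW.
  rewrite lee_fin /J; apply: (le_trans (ler_normD _ _)); rewrite !normrM.
  have /andP[a1 a2] := bump1_approx n.+1%:R sg'; have := bump2_approx g0 n.+1%:R sg' => a3.
  have /andP[b0 b1] := bump_bounds gam n.+1%:R s.
  have sb0 : 0 <= s * bump n.+1%:R gam s by rewrite mulr_ge0.
  have sb1 : s * bump n.+1%:R gam s <= s * 1 by rewrite ler_wpM2l.
  have q1 : `|4| * `|bump1 gam n.+1%:R s + s * bump n.+1%:R gam s| <= 8 * gam.
    have : `|bump1 gam n.+1%:R s + s * bump n.+1%:R gam s| <= 2 * gam.
      by have := cb n; rewrite ler_norml; lra.
    by rewrite (normr_nat R 4); lra.
  have q2 : `|bump2 gam n.+1%:R s| <= gam ^+ 2 * 2.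
    have : bump_defect gam n.+1%:R * gam <= gam * gam by rewrite ler_wpM2r // ltW.
    have : 0 <= (gam - s) ^+ 2 by exact: sqr_ge0.
    have : 0 <= s * (2 * gam - s) by rewrite mulr_ge0 //; lra.
    by move: a3; rewrite !ler_norml !expr2; lra.
  by apply: lerD; apply: ler_wpM2l.
move=> _ _ cv.
have z n : (\int[leb]_(x in `[0%R, gam[) (J n.+1%:R gam x)%:E = 0)%E.
  have fin : (\int[leb]_(x in `[0%R, gam[) (J n.+1%:R gam x)%:E)%E \is a fin_num.
    by apply: integrable_fin_num => //; exact: iJ.
  by rewrite -(fineK fin); congr EFin; exact: bump_identity.
have cv0 : (\int[leb]_(x in `[0%R, gam[) (J n.+1%:R gam x)%:E)%E @[n --> \oo] --> (0 : \bar R).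
  by under eq_fun do rewrite z; exact: cvg_cst.
by rewrite /Rintegral (cvg_unique _ cv cv0).
Qed.

Let W0 := int0 w.
Let W1 := int0 (fun s => s * w s).
Let G0 := int0 h.
Let G1 := int0 (fun s => s * h s).
Let G2 := int0 (fun s => s ^+ 2 * h s).

Let mul_int (f k : R -> R) : (forall c, leb.-integrable `[0, c] (EFin \o f)) -> continuous k ->
  forall c, leb.-integrable `[0, c] (EFin \o (fun s => k s * f s)).
Proof.
move=> fi ck c; have [c0|c0] := leP 0 c; last first.
  rewrite set_itv_ge ?bnd_simp -?ltNge //; exact: integrable_set0.
rewrite (_ : (fun s => k s * f s) = (fun s => f s * k s)); last by apply/funext => s; rewrite mulrC.
by apply: (@integrable_mul_cont R f k 0 c).
Qed.

Let iw1 : forall c, leb.-integrable `[0, c] (EFin \o (fun s => s * w s)).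
Proof. by apply: (mul_int iw) => s; exact: cvg_id. Qed.
Let ih1 : forall c, leb.-integrable `[0, c] (EFin \o (fun s => s * h s)).
Proof. by apply: (mul_int ih) => s; exact: cvg_id. Qed.
Let ih2 : forall c, leb.-integrable `[0, c] (EFin \o (fun s => s ^+ 2 * h s)).
Proof. by apply: (mul_int ih); exact: continuous_sqr. Qed.

Let moments gam : 0 < gam ->
  8 * W1 gam - 4 * gam * W0 gam + (gam ^+ 2 / 2 * G0 gam - gam * G1 gam + 2^-1 * G2 gam) = 0.
Proof.
move=> g0; rewrite -(weak_moment g0).
pose A s := 8 * (s * w s) + (- (4 * gam)) * w s.
pose B s := gam ^+ 2 / 2 * h s + (- gam) * (s * h s).
pose C s := 1 * B s + 2^-1 * (s ^+ 2 * h s).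
have iA : leb.-integrable `[0, gam] (EFin \o A) by exact: integrable_lin.
have iB : leb.-integrable `[0, gam] (EFin \o B) by exact: integrable_lin.
have iC : leb.-integrable `[0, gam] (EFin \o C) by exact: integrable_lin.
transitivity (Rintegral leb `[0, gam] (fun s => 1 * A s + 1 * C s)).
  rewrite Rintegral_lin // /C Rintegral_lin // /A Rintegral_lin // /B Rintegral_lin //.
  by rewrite /W1 /W0 /G0 /G1 /G2 /int0; ring.
by apply: eq_Rintegral => s _; rewrite /A /C /B; field.
Qed.

(** The moment identity holds for all gam > 0, so its derivative vanishes. The terms in h itself
    cancel, since the kernel (gam - s)^2 is zero at s = gam; w remains without any derivative. *)
Let weak_at (s : R) : 0 < s -> der W0 s (w s) -> der W1 s (s * w s) ->
  der G0 s (h s) -> der G1 s (s * h s) -> der G2 s (s ^+ 2 * h s) ->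
  s * w s = W0 s - 4^-1 * (s * G0 s - G1 s).
Proof.
move=> s0 dW0 dW1 dG0 dG1 dG2.
have dP : der (fun x => 8 * W1 x - 4 * x * W0 x + (x ^+ 2 * 2^-1 * G0 x - x * G1 x + 2^-1 * G2 x)) s
    (4 * (s * w s - W0 s + 4^-1 * (s * G0 s - G1 s))).
  apply: derE.
    apply: derD.
      apply: derB; first by apply: derZ; exact: dW1.
      by apply: derM; [apply: derZ; exact: der_id|exact: dW0].
    apply: derD; last by apply: derZ; exact: dG2.
    apply: derB; last by apply: derM; [exact: der_id|exact: dG1].
    apply: derM; last exact: dG0.
    by apply: derM; [apply: der_sqr; exact: der_id|exact: der_cst].
  by rewrite /=; field.
have d0 : der (fun=> 0 : R) s (4 * (s * w s - W0 s + 4^-1 * (s * G0 s - G1 s))).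
  apply: der_near dP; near=> x; apply: moments.
  by near: x; exact: lt_nbhsr.
have e1 : 'D_1 (fun _ : R => 0 : R) s = 0 by exact: derive_cst.
have [_ e2] := d0; move: e2; rewrite e1.
set a := s * w s; set b := s * G0 s; lra.
Unshelve. all: by end_near. Qed.

Let weak_ae : {ae leb, forall s, 0 < s -> s * w s = W0 s - 4^-1 * (s * G0 s - G1 s)}.
Proof.
have F := ae_filter_ringOfSetsType leb.
have A : {ae leb, forall s, 0 < s -> der W0 s (w s) /\ der W1 s (s * w s)}.
  apply: (@filterS2 _ _ F _ _ _ _ (int0_ae_der iw) (int0_ae_der iw1)) => s a b s0.
  by split; [exact: a|exact: b].
have B : {ae leb, forall s, 0 < s -> der G1 s (s * h s) /\ der G2 s (s ^+ 2 * h s)}.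
  apply: (@filterS2 _ _ F _ _ _ _ (int0_ae_der ih1) (int0_ae_der ih2)) => s a b s0.
  by split; [exact: a|exact: b].
apply: (@filterS3 _ _ F _ _ _ _ _ A (int0_ae_der ih) B) => s a b c s0.
have {a}[dW0 dW1] := a s0; have {c}[dG1 dG2] := c s0; have dG0 := b s0.
exact: weak_at.
Qed.

(** The right-hand side of [weak_ae] is continuous, so dividing by s gives a continuous version of
    the profile. Its derivative is stated conditionally on a continuous version [eta] of the source:
    that source contains the exponentials of both unknowns, so [eta] exists only after this lemma
    has been applied to both equations. *)
Lemma weak_radial : exists om : R -> R,
  [/\ forall s, 0 < s -> {for s, continuous om},
      {ae leb, forall s, 0 < s -> om s = w s} &
      forall eta : R -> R, (forall s, 0 < s -> {for s, continuous eta}) ->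
        {ae leb, forall s, 0 < s -> eta s = h s} ->
        forall s, 0 < s -> der om s (- (int0 h s) / (4 * s))].
Proof.
pose om s := (W0 s - 4^-1 * (s * G0 s - G1 s)) / s.
have com s : 0 < s -> {for s, continuous om}.
  move=> s0; apply: cvgM; last by apply: cvgV; [rewrite gt_eqF|exact: cvg_id].
  apply: cvgB; first exact: (int0_cont iw s0).
  apply: cvgMr; apply: cvgB; last exact: (int0_cont ih1 s0).
  by apply: cvgM; [exact: cvg_id|exact: (int0_cont ih s0)].
have aeom : {ae leb, forall s, 0 < s -> om s = w s}.
  apply: (@filterS _ _ (ae_filter_ringOfSetsType leb) _ _ _ weak_ae) => s hs s0.
  by rewrite /om -(hs s0) mulrAC divff ?mul1r // gt_eqF.
exists om; split => // eta ceta aeeta s s0.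
have dW := int0_der iw com aeom s0.
have dG := int0_der ih ceta aeeta s0.
have dG1 : der G1 s (s * eta s).
  apply: (int0_der (phi := fun s => s * eta s) ih1 _ _ s0) => [x x0|].
    by apply: cvgM; [exact: cvg_id|exact: ceta].
  by apply: (@filterS _ _ (ae_filter_ringOfSetsType leb) _ _ _ aeeta) => x hx x0; rewrite hx.
rewrite /om; apply: derE.
  apply: derM; last by apply: derV; [rewrite gt_eqF|exact: der_id].
  apply: derB; first exact: dW.
  apply: derZ; apply: derB; last exact: dG1.
  by apply: derM; [exact: der_id|exact: dG].
by rewrite /om -/G0; field; rewrite gt_eqF.
Qed.

End WeakIdentity.

Section IntegralLimit.
Variable R : realType.
Local Notation leb := (@lebesgue_measure R).

Lemma int0_cvg (f : R -> R) : (forall s, 0 <= s -> 0 <= f s) ->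
  leb.-integrable `[0, +oo[ (EFin \o f) ->
  int0 f s @[s --> +oo] --> Rintegral leb `[0, +oo[ f.
Proof.
move=> f0 fi; set I := Rintegral _ _ _.
have sub c : `[0, c]%classic `<=` (`[0, +oo[%classic : set R).
  by move=> s /=; rewrite !in_itv /= andbT => /andP[].
have fic c : leb.-integrable `[0, c] (EFin \o f).
  by apply: (integrableS _ _ _ fi).
have fin (c : R) : (\int[leb]_(s in `[0%R, c]) (f s)%:E)%E \is a fin_num.
  by apply: integrable_fin_num => //; exact: fic.
have finI : (\int[leb]_(s in `[0%R, +oo[) (f s)%:E)%E \is a fin_num.
  by apply: integrable_fin_num.
have mf c : measurable_fun (`[0, c]%classic : set R) (EFin \o f) by exact: measurable_int (fic c).
have mono c d : c <= d -> int0 f c <= int0 f d.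
  move=> cd; apply: fine_le => //; apply: ge0_subset_integral => //.
  - exact: mf.
  - by move=> s /=; rewrite in_itv /= lee_fin => /andP[s0 _]; exact: f0.
  - by move=> s /=; rewrite !in_itv /= => /andP[-> /le_trans ->].
have leI c : int0 f c <= I.
  apply: fine_le => //; apply: ge0_subset_integral => //.
  - exact: measurable_int fi.
  - by move=> s /=; rewrite in_itv /= lee_fin andbT => s0; exact: f0.
have cn : int0 f n%:R @[n --> \oo] --> I.
  apply: fine_cvg; rewrite fineK //.
  have -> : `[0, +oo[%classic = \bigcup_(n : nat) (`[0, n%:R]%classic : set R).
    apply/seteqP; split => s /=; last by move=> [n _]; exact: sub.
    rewrite in_itv /= andbT => s0; exists (Num.truncn s).+1 => //=.
    by rewrite in_itv /= s0 ltW // truncnS_gt.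
  pose F (n : nat) : set (measurableTypeR R) := `[0, n%:R]%classic.
  have nd : nondecreasing_seq F.
    move=> m n mn; rewrite subsetEset => s; rewrite /F /= !in_itv /= => /andP[-> /le_trans]; apply.
    by rewrite ler_nat.
  have mF n : measurable (F n) by exact: measurable_itv.
  have mfF n : measurable_fun (F n) (EFin \o f) by exact: mf.
  have fF n x : F n x -> (0 <= (EFin \o f) x)%E.
    by rewrite /F /= in_itv /= lee_fin => /andP[s0 _]; exact: f0.
  exact: (@ge0_nondecreasing_set_cvg_integral _ (measurableTypeR R) R F (EFin \o f) leb nd mF mfF fF).
apply/cvgrPdist_lt => e e0.
have /cvgrPdist_lt /(_ e e0) [n _ hn] := cn.
exists n%:R; split; first exact: num_real.
move=> s ns; have := hn n (leqnn n); rewrite /= !ger0_norm ?subr_ge0 //.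
by have := mono _ _ (ltW ns); lra.
Qed.

End IntegralLimit.

Lemma L1_sub_scale (R : realType) (f g : R * R -> R) (a : R) : L1 f -> L1 g -> L1 (fun x => f x - a * g x).
Proof.
move=> fi gi; rewrite /L1.
rewrite (_ : EFin \o _ = (fun x => (f x)%:E - a%:E * (g x)%:E)%E); last by apply/funext.
by apply: integrableB => //; exact: integrableZl.
Qed.

(** * Necessity of the conic equation and of the bounds *)

Section Necessity.
Variable R : realType.
Local Notation leb := (@lebesgue_measure R).
Variables (N tau b1 b2 : R) (v1 v2 : R * R -> R).
Hypotheses (N0 : 0 < N) (t0 : 0 < tau).
Hypotheses (rv1 : radial v1) (rv2 : radial v2) (sol : solves_P N tau v1 v2 b1 b2).

Let f1 x := weight N x * expR (v1 x).
Let f2 x := expR (v2 x).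
Let k1 := profile f1.
Let k2 := profile f2.

Let rf1 : radial f1.
Proof. by move=> x y e; rewrite /f1 /weight e (rv1 e). Qed.
Let rf2 : radial f2.
Proof. by move=> x y e; rewrite /f2 (rv2 e). Qed.

Let if1 : L1 f1. Proof. by case: sol => _ [_ []]. Qed.
Let if2 : L1 f2. Proof. by case: sol => _ [_ [_ []]]. Qed.

Let weak_pair (v f g : R * R -> R) : radial v -> radial f -> radial g -> L1loc v -> L1 f -> L1 g ->
  dist_eq_mlap v (fun x => f x - tau * g x) ->
  exists om : R -> R, [/\ forall s, 0 < s -> {for s, continuous om},
      {ae leb, forall s, 0 < s -> om s = profile v s} &
      forall eta : R -> R, (forall s, 0 < s -> {for s, continuous eta}) ->
        {ae leb, forall s, 0 < s -> eta s = profile f s - tau * profile g s} ->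
        forall s, 0 < s ->
        der om s (- (2^-1 * int0 (profile f) s - tau * (2^-1 * int0 (profile g) s)) / (2 * s))].
Proof.
move=> rv rf rg lv lf lg we.
have rh : radial (fun x => f x - tau * g x) by move=> x y e; rewrite (rf _ _ e) (rg _ _ e).
have [om [c ae d]] := weak_radial rv rh lv (L1_sub_scale tau lf lg) we.
exists om; split => // eta ceta aeta s s0.
apply: derE; first exact: (d eta ceta aeta s s0).
have iF := profile_integrable s rf (L1_L1loc lf); have iG := profile_integrable s rg (L1_L1loc lg).
have -> : int0 (profile (fun x => f x - tau * g x)) s =
    1 * int0 (profile f) s + (- tau) * int0 (profile g) s.
  rewrite /int0 -Rintegral_lin //; apply: eq_Rintegral => y _.
  by rewrite /profile mul1r mulNr.
by field; rewrite gt_eqF.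
Qed.

Let half_flux f b : radial f -> L1 f -> (forall x, 0 <= f x) ->
  b = (2 * pi)^-1 * Rintegral (@leb2 R) setT f ->
  2^-1 * int0 (profile f) s @[s --> +oo] --> b.
Proof.
move=> rf lf f0 ->.
have -> : (2 * pi)^-1 * Rintegral (@leb2 R) setT f = 2^-1 * Rintegral leb `[0, +oo[ (profile f).
  by rewrite L1_Rintegral_profile // invfM -mulrA mulKf // gt_eqF // pi_gt0.
by apply: cvgMr; apply: int0_cvg; [move=> s _; exact: f0|exact: L1_profile].
Qed.

Lemma necessity : [/\ pohozaev (2 * (N + 1)) 2 tau b1 b2 = 0, 4 * (N + 1) < b1 & 4 < b2].
Proof.
have [lv1 [lv2 [_ [_ [we1 [we2 [eb1 eb2]]]]]]] := sol.
have [om1 [c1 ae1 d1]] := weak_pair rv1 rf1 rf2 lv1 if1 if2 we1.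
have [om2 [c2 ae2 d2]] := weak_pair rv2 rf2 rf1 lv2 if2 if1 we2.
have kE1 s : 0 < s -> k1 s = s `^ N * expR (profile v1 s).
  by move=> s0; rewrite /k1 /profile /f1 /weight /sqnorm /= sqr_sqrtr ?ltW // expr0n addr0.
(* Continuous versions of both sources, from which [eta] is formed in each equation. The power s^0 =
   1 puts the second one in the form used by [radial_toda]. *)
pose p1 s := s `^ N * expR (om1 s); pose p2 s := s `^ 0 * expR (om2 s).
have cp1 s : 0 < s -> {for s, continuous p1}.
  move=> s0; apply: cvgM; first exact: der_cont (der_powR N s0).
  by apply: (@continuous_comp _ _ _ om1 (@expR R)); [exact: c1|exact: continuous_expR].
have cp2 s : 0 < s -> {for s, continuous p2}.
  move=> s0; apply: cvgM; first exact: der_cont (der_powR 0 s0).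
  by apply: (@continuous_comp _ _ _ om2 (@expR R)); [exact: c2|exact: continuous_expR].
have F := ae_filter_ringOfSetsType leb.
have ap1 : {ae leb, forall s, 0 < s -> p1 s = k1 s}.
  by apply: (@filterS _ _ F _ _ _ ae1) => s h s0; rewrite kE1 // /p1 h.
have ap2 : {ae leb, forall s, 0 < s -> p2 s = k2 s}.
  by apply: (@filterS _ _ F _ _ _ ae2) => s h s0; rewrite /p2 h // powRr0 mul1r.
have ik1 c : leb.-integrable `[0, c] (EFin \o k1) by exact: profile_integrable rf1 (L1_L1loc if1).
have ik2 c : leb.-integrable `[0, c] (EFin \o k2) by exact: profile_integrable rf2 (L1_L1loc if2).
have f10 x : 0 <= f1 x by rewrite mulr_ge0 ?powR_ge0 // expR_ge0.
have f20 x : 0 <= f2 x by exact: expR_ge0.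
pose X s := 2^-1 * int0 k1 s; pose Y s := 2^-1 * int0 k2 s.
have H T : toda (2 * (N + 1)) (2 * (0 + 1)) tau T
    (fun t => om1 (expR (2 * t)) + 2 * (N + 1) * t) (fun t => om2 (expR (2 * t)) + 2 * (0 + 1) * t)
    (fun t => X (expR (2 * t))) (fun t => Y (expR (2 * t))).
  apply: (@radial_toda R N 0 tau om1 om2 X Y T).
  - by move=> s /andP[s0 _]; apply: derZ; exact: int0_der ik1 cp1 ap1 s0.
  - by move=> s /andP[s0 _]; apply: derZ; exact: int0_der ik2 cp2 ap2 s0.
  - move=> s /andP[s0 _]; apply: (d1 (fun s => p1 s - tau * p2 s)) => // [y y0|].
      by apply: cvgB; [exact: cp1|apply: cvgMr; exact: cp2].
    by apply: (@filterS2 _ _ F _ _ _ _ ap1 ap2) => y h1 h2 y0; rewrite h1 // h2.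
  - move=> s /andP[s0 _]; apply: (d2 (fun s => p2 s - tau * p1 s)) => // [y y0|].
      by apply: cvgB; [exact: cp2|apply: cvgMr; exact: cp1].
    by apply: (@filterS2 _ _ F _ _ _ _ ap1 ap2) => y h1 h2 y0; rewrite h1 // h2.
  - by rewrite -[X in _ --> X](mulr0 (2^-1 : R)); apply: cvgMr; exact: (@int0_right R k1 ik1).
  - by rewrite -[X in _ --> X](mulr0 (2^-1 : R)); apply: cvgMr; exact: (@int0_right R k2 ik2).
have cx := cvg_exp2_pinfty (half_flux rf1 if1 f10 eb1).
have cy := cvg_exp2_pinfty (half_flux rf2 if2 f20 eb2).
have p0 : 0 < 2 * (N + 1) by have := N0; lra.
have q0 : 0 < 2 * (0 + 1) :> R by lra.
have := toda_lim_gt p0 t0 H cx cy.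
have := toda_lim_gt q0 t0 (fun T => toda_sym (H T)) cy cx.
have := toda_lim_conic H cx cy.
rewrite !add0r mulr1 => e h2 h1; split => //; lra.
Qed.

End Necessity.

(** * Classical radial solutions are weak solutions *)

Section PlaneContinuity.
Variable R : realType.
Implicit Types (f : R * R -> R) (z : R * R).
Local Notation leb := (@lebesgue_measure R).

(** The plane carries the product sigma-algebra, so an open set is written as a countable union of
    rational boxes contained in it. *)
Lemma open_measurable_plane (U : set (R * R)) : open U -> measurable U.
Proof.
move=> oU.
pose box (i : rat * rat * nat) : set (R * R) :=
  (ball (ratr i.1.1 : R) (i.2.+1%:R^-1)) `*` (ball (ratr i.1.2 : R) (i.2.+1%:R^-1)).
have mbox i : measurable (box i) by apply: measurableX; exact: measurable_ball.
have -> : U = \bigcup_(i : rat * rat * nat) (if `[< box i `<=` U >] then box i else set0).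
  apply/seteqP; split => [[x y] Uxy|z [i _]]; last first.
    by case: ifPn => // /asboolP; apply.
  have [e /= e0 eU] : exists2 e : R, 0 < e & ball (x, y) e `<=` U.
    by have /nbhs_ballP[e e0 he] := open_nbhs_nbhs (conj oU Uxy); exists e.
  pose n := Num.truncn (2 / e).
  have ne : (n.+1%:R : R)^-1 < e / 2.
    have : 2 / e < n.+1%:R by exact: truncnS_gt.
    rewrite ltr_pdivrMr // => h.
    rewrite invf_plt ?posrE ?divr_gt0 // invf_div ltr_pdivrMr //.
  have n0 : 0 < (n.+1%:R : R)^-1 by rewrite invr_gt0.
  pose d : R := n.+1%:R^-1; rewrite -/d in ne n0.
  have [a ha] := @rat_in_itvoo R (x - d) (x + d) ltac:(lra).
  have [b hb] := @rat_in_itvoo R (y - d) (y + d) ltac:(lra).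
  move: ha hb; rewrite !in_itv /= => ha hb.
  exists (a, b, n) => //=; rewrite ifT.
    by split; rewrite /ball /= ltr_norml -/d; lra.
  apply/asboolP => -[x' y'] [/=]; rewrite /ball /= !ltr_norml -/d => h1 h2.
  by apply: eU; split; rewrite /ball /= ltr_norml; lra.
apply: countable_bigcupT_measurable; first exact: countableP.
by move=> i; case: ifP.
Qed.

Lemma continuous_measurable_plane f : continuous f -> measurable_fun setT f.
Proof.
move=> cf; apply: (measurability (@RGenOInfty.G R)); first exact: RGenOInfty.measurableE.
move=> _ [_ [x ->] <-]; rewrite setTI; apply: open_measurable_plane.
rewrite set_itvoy; apply: open_comp; last exact: open_gt.
by move=> z _; exact: cf.
Qed.

Lemma continuous_bounded_disc f (r : R) : continuous f ->
  exists2 M, 0 <= M & forall z, sqnorm z <= r -> `|f z| <= M.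
Proof.
move=> cf; pose c := r + 1.
have cK : compact (`[- c, c]%classic `*` `[- c, c]%classic : set (R * R)).
  by apply: compact_setX; exact: segment_compact.
have := continuous_compact (continuous_subspaceT cf) cK => /compact_bounded [M [Mr hM]].
exists (`|M| + 1); first by have := normr_ge0 M; lra.
move=> [x y] h.
have key a b : a ^+ 2 + b ^+ 2 <= r -> - c <= a <= c by rewrite /c; nra.
apply: (hM (`|M| + 1)); first by have := ler_norm M; lra.
exists (x, y) => //; split => /=; rewrite in_itv /=.
  exact: (key x y).
by apply: (key y x); rewrite addrC.
Qed.

Lemma disc_measurable (r : R) : measurable [set z : R * R | sqnorm z <= r].
Proof.
rewrite -[X in measurable X]setTI.
exact: (measurable_sqnorm measurableT (measurable_itv `]-oo, r])).
Qed.

Lemma L1_bounded_support f (r M : R) : measurable_fun setT f ->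
  (forall z, sqnorm z <= r -> `|f z| <= M) -> (forall z, r < sqnorm z -> f z = 0) -> L1 f.
Proof.
move=> mf fM f0; rewrite /L1.
have -> : EFin \o f = (EFin \o f) \_ [set z | sqnorm z <= r].
  apply/funext => z; rewrite patchE; case: ifPn => // /negP; rewrite inE /= => /negP.
  by rewrite -ltNge => /f0 /= ->.
apply: ((@integrable_mkcond _ _ _ (@leb2 R) _ (EFin \o f) (disc_measurable r)).1 _).
apply: measurable_bounded_integrable.
- exact: disc_measurable.
- apply: (@le_lt_trans _ _ (@leb2 R [set z | sqnorm z < r + 1])).
    apply: le_measure; rewrite ?inE; first exact: disc_measurable.
      rewrite -[X in measurable X]setTI.
      exact: (measurable_sqnorm measurableT (measurable_itv `]-oo, _[)).
    by move=> z /=; lra.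
  by rewrite disc_measure ltry.
- exact: measurable_funTS.
- exists M; split; first exact: num_real.
  by move=> x Mx z /= hz; apply: (le_trans (fM z hz)); exact: ltW.
Qed.

(** Fubini with one line left out. Second derivatives of a radial function may be singular at the
    origin, and every horizontal line other than y = 0 avoids it. *)
Lemma plane_integral0_1 f : L1 f ->
  (forall y, y != 0 -> (\int[leb]_x (f (x, y))%:E = 0)%E) -> (\int[@leb2 R]_z (f z)%:E = 0)%E.
Proof.
move=> fi f0; rewrite /leb2 -(integral21_prod_meas1 fi).
have n0 : {ae leb, forall s : R, s != 0}.
  exists [set 0]; split => //; first exact: lebesgue_measure_set1.
  by move=> s /= /negP; rewrite negbK => /eqP.
rewrite (@ae_eq_integral _ _ _ leb setT (cst 0)%E) ?integral0 //.
  exact: (measurable_fubini_G fi).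
by apply: (@filterS _ _ (ae_filter_ringOfSetsType leb) _ _ _ n0) => s s0 _; exact: f0.
Qed.

Lemma plane_integral0_2 f : L1 f ->
  (forall x, x != 0 -> (\int[leb]_y (f (x, y))%:E = 0)%E) -> (\int[@leb2 R]_z (f z)%:E = 0)%E.
Proof.
move=> fi f0; rewrite /leb2 -(integral12_prod_meas1 fi).
have n0 : {ae leb, forall s : R, s != 0}.
  exists [set 0]; split => //; first exact: lebesgue_measure_set1.
  by move=> s /= /negP; rewrite negbK => /eqP.
rewrite (@ae_eq_integral _ _ _ leb setT (cst 0)%E) ?integral0 //.
  exact: (measurable_fubini_F fi).
by apply: (@filterS _ _ (ae_filter_ringOfSetsType leb) _ _ _ n0) => s s0 _; exact: f0.
Qed.

Lemma line_integral0 (D k : R -> R) (r : R) : 0 < r -> continuous k -> (forall x, der D x (k x)) ->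
  (forall x, r < `|x| -> D x = 0) -> (forall x, r < `|x| -> k x = 0) ->
  (\int[leb]_x (k x)%:E = 0)%E.
Proof.
move=> r0 ck dD D0 k0; pose c := r + 1.
have -> : (fun x => (k x)%:E) = (fun x => (k x)%:E) \_ `[- c, c].
  apply/funext => x; rewrite patchE; case: ifPn => // /negP; rewrite inE /= in_itv /= => h.
  congr EFin; apply: k0; rewrite ltNge ler_norml; apply/negP => h2; apply: h.
  by move: h2; rewrite /c; lra.
rewrite -integral_mkcond (@continuous_FTC2 R k D).
- by rewrite !D0 ?subee // /c ?normrN gtr0_norm; lra.
- by rewrite /c; lra.
- exact: continuous_subspaceT.
- split.
  + by move=> x _; have [] := dD x.
  + apply: cvg_at_right_filter; exact: der_cont (dD _).
  + apply: cvg_at_left_filter; exact: der_cont (dD _).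
- by move=> x _; rewrite derive1E; have [_] := dD x.
Qed.

End PlaneContinuity.

Section TestFunctions.
Variable R : realType.

Lemma test_lines (phi : R * R -> R) : test_fun phi -> exists r : R, exists px pxx py pyy : R * R -> R,
  [/\ 0 < r, forall z, r <= sqnorm z -> phi z = 0 &
   [/\ continuous phi, forall z, laplacian phi z = pxx z + pyy z,
    [/\ continuous pxx, forall x y, der (fun t => phi (t, y)) x (px (x, y)) &
      forall x y, der (fun t => px (t, y)) x (pxx (x, y))] &
    [/\ continuous pyy, forall x y, der (fun t => phi (x, t)) y (py (x, y)) &
      forall x y, der (fun t => py (x, t)) y (pyy (x, y))]]].
Proof.
move=> [sm [r [r0 hr]]].
exists r, (iter_pd [:: true] phi), (iter_pd [:: true; true] phi),
  (iter_pd [:: false] phi), (iter_pd [:: false; false] phi).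
have dx1 s z : dx (iter_pd s phi) z (iter_pd (true :: s) phi z).
  by apply: derivableP; have [_ /(_ z) []] := sm s.
have dy1 s z : dy (iter_pd s phi) z (iter_pd (false :: s) phi z).
  by apply: derivableP; have [_ /(_ z) []] := sm s.
split; [exact: r0|exact: hr|].
split; [by have [] := sm [::]|by []| |].
- split; first by have [] := sm [:: true; true].
    by move=> x y; exact: ((dxP _ (x, y) _).1 (dx1 [::] (x, y))).
  by move=> x y; exact: ((dxP _ (x, y) _).1 (dx1 [:: true] (x, y))).
- split; first by have [] := sm [:: false; false].
    by move=> x y; exact: ((dyP _ (x, y) _).1 (dy1 [::] (x, y))).
  by move=> x y; exact: ((dyP _ (x, y) _).1 (dy1 [:: false] (x, y))).
Qed.

End TestFunctions.

Lemma measurable_fun_inv (R : realType) : measurable_fun [set: R] (@GRing.inv R).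
Proof.
have m1 : measurable_fun ([set x : R | x != 0]) (@GRing.inv R).
  apply: open_continuous_measurable_fun; first exact: open_neq.
  by move=> x; rewrite inE /= => x0; apply: inv_continuous.
have -> : [set: R] = [set 0] `|` [set x : R | x != 0].
  by apply/seteqP; split => // x _ /=; case: (eqVneq x 0); [left|right].
apply/measurable_funU; [exact: measurable_set1|apply: open_measurable; exact: open_neq|].
by split => //; exact: measurable_fun_set1.
Qed.

(** * Green's identity for images of the Picard operator *)

Section RadialWeak.
Variable R : realType.
Local Notation leb := (@lebesgue_measure R).
Variables (c : R) (h : R -> R).
Hypothesis ch : continuous h.

Let v s := picard c h s.
Let m := mean h.
Let cm : continuous m. Proof. exact: continuous_mean. Qed.

(* With s = x^2 + y^2 and v a function of s alone, this is v_xx when a = x^2 and v_yy when a = y^2. *)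
Let hess a s := - (2^-1 * m s + a * ((h s - m s) / s)).

Let der_v s : 0 < s -> der v s (- (4^-1 * m s)).
Proof.
move=> s0; apply: derE; first exact: der_picard.
by rewrite -(mul_mean s ch) -/m; field; rewrite gt_eqF.
Qed.

Let der_m s : 0 < s -> der m s ((h s - m s) / s).
Proof.
move=> s0; apply: (@der_near R (fun s => prim h s * s^-1)).
  near=> t; rewrite /m /mean ifF //; apply/negbTE; rewrite gt_eqF //.
  by near: t; exact: lt_nbhsr.
apply: derE.
  by apply: derM; [exact: der_prim|apply: derV; [rewrite gt_eqF|exact: der_id]].
by rewrite -(mul_mean s ch) -/m; field; rewrite gt_eqF.
Unshelve. all: by end_near. Qed.

(** Green's identity on a line that avoids the origin: the integrand v P'' - v_xx P is the
    derivative of D = v P' - v_x P, which vanishes far out. *)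
Let line_weak (y r : R) (P P1 P2 : R -> R) : y != 0 -> 0 < r ->
  (forall x, der P x (P1 x)) -> (forall x, der P1 x (P2 x)) -> continuous P2 ->
  (forall x, r < `|x| -> P x = 0) ->
  (\int[leb]_x (v (x ^+ 2 + y ^+ 2) * P2 x - hess (x ^+ 2) (x ^+ 2 + y ^+ 2) * P x)%:E = 0)%E.
Proof.
move=> y0 r0 dP dP1 cP2 P0.
have sg x : 0 < x ^+ 2 + y ^+ 2 by rewrite ltr_wpDl ?sqr_ge0 // exprn_even_gt0.
have dsg x : der (fun x : R => x ^+ 2 + y ^+ 2) x (2 * x).
  by apply: derE; [apply: derD; [apply: der_sqr; exact: der_id|exact: der_cst]|rewrite /=; ring].
have csg : continuous (fun x : R => x ^+ 2 + y ^+ 2) by move=> x; exact: der_cont (dsg x).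
have out (f g : R -> R) : (forall x, der f x (g x)) -> (forall x, r < `|x| -> f x = 0) ->
    forall x, r < `|x| -> g x = 0.
  move=> df f0 x rx.
  have d0 : der (fun=> 0 : R) x (g x).
    apply: der_near (df x); near=> t; apply: f0; near: t.
    exact: (@norm_continuous _ R x _ (lt_nbhsr rx)).
  by have [_ <-] := d0; exact: derive_cst.
pose D x := v (x ^+ 2 + y ^+ 2) * P1 x - - (4^-1 * m (x ^+ 2 + y ^+ 2)) * (2 * x) * P x.
have P10 := out P P1 dP P0.
apply: (@line_integral0 R D _ r r0).
- have cv : continuous v by exact: continuous_picard.
  have cP x : {for x, continuous P} by exact: der_cont (dP x).
  move=> x; apply: cvgB; apply: cvgM => //.
  + by apply: (@continuous_comp _ _ _ (fun x : R => x ^+ 2 + y ^+ 2) v); [exact: csg|exact: cv].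
  + exact: cP2.
  + apply: cvgN; apply: cvgD.
      by apply: cvgMr; apply: (@continuous_comp _ _ _ (fun x : R => x ^+ 2 + y ^+ 2) m); [exact: csg|exact: cm].
    apply: cvgM; first exact: continuous_sqr.
    apply: cvgM; last by apply: cvgV; [rewrite gt_eqF|exact: csg].
    apply: cvgB.
      by apply: (@continuous_comp _ _ _ (fun x : R => x ^+ 2 + y ^+ 2) h); [exact: csg|exact: ch].
    by apply: (@continuous_comp _ _ _ (fun x : R => x ^+ 2 + y ^+ 2) m); [exact: csg|exact: cm].
  + exact: cP.
- move=> x; apply: derE.
    apply: derB.
      by apply: derM; [apply: (@der_comp R v); [exact: der_v|exact: dsg]|exact: dP1].
    apply: derM; last exact: dP.
    apply: derM; last by apply: derZ; exact: der_id.
    by apply: derN; apply: derZ; apply: (@der_comp R m); [exact: der_m|exact: dsg].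
  by rewrite /hess; field; rewrite gt_eqF.
- by move=> x rx; rewrite /D P0 // P10 // !mulr0 subr0.
- by move=> x rx; rewrite P0 // (out _ _ dP1 P10) // !mulr0 subr0.
Unshelve. all: by end_near. Qed.

(** Integrability for Fubini. The quotient (h - m) / s may be unbounded near 0, but it enters
    multiplied by [a], and 0 <= a <= s keeps [hess] bounded; at s = 0 the inverse is 0 by
    convention. *)
Let L1_dir (a psi phi : R * R -> R) (r : R) : 0 < r -> continuous phi -> continuous psi ->
  (forall z, r < sqnorm z -> phi z = 0) -> (forall z, r < sqnorm z -> psi z = 0) ->
  measurable_fun setT a -> (forall z, 0 <= a z <= sqnorm z) ->
  L1 (fun z => v (sqnorm z) * psi z - hess (a z) (sqnorm z) * phi z).
Proof.
move=> r0 cphi cpsi phi0 psi0 ma ha.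
have cv : continuous v by exact: continuous_picard.
have [B B0 hB] := continuous_bounded_disc r cphi.
have [C C0 hC] := continuous_bounded_disc r cpsi.
have [V V0 hV] := continuous_bounded_itv (ltW r0) cv.
have [H H0 hH] := continuous_bounded_itv (ltW r0) ch.
have [M M0 hM] := continuous_bounded_itv (ltW r0) cm.
apply: (@L1_bounded_support _ _ r (V * C + (2^-1 * M + (H + M)) * B)).
- apply: measurable_funB; apply: measurable_funM.
  + by apply: measurable_comp_sqnorm; exact: continuous_measurable_fun.
  + exact: continuous_measurable_plane.
  + apply: measurableT_comp; first exact: oppr_measurable.
    apply: measurable_funD.
      by apply: measurable_funM => //; apply: measurable_comp_sqnorm; exact: continuous_measurable_fun.
    apply: measurable_funM => //; apply: (measurable_comp_sqnorm (f := fun s => (h s - m s) / s)).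
    apply: measurable_funM; first by apply: measurable_funB; exact: continuous_measurable_fun.
    exact: measurable_fun_inv.
  + exact: continuous_measurable_plane.
- move=> z zr; have z0 := sqnorm_ge0 z.
  have zi : 0 <= sqnorm z <= r by rewrite z0.
  apply: (le_trans (ler_normB _ _)); apply: lerD; rewrite normrM.
    by apply: ler_pM => //; [exact: hV|exact: hC].
  apply: ler_pM => //; last exact: hB.
  rewrite normrN; apply: (le_trans (ler_normD _ _)); apply: lerD.
    by rewrite normrM ger0_norm ?invr_ge0 // ler_wpM2l ?invr_ge0 //; exact: hM.
  have hm : `|h (sqnorm z) - m (sqnorm z)| <= H + M.
    by apply: (le_trans (ler_normB _ _)); apply: lerD; [exact: hH|exact: hM].
  have /andP[a0 az] := ha z.
  rewrite mulrCA normrM -[leRHS]mulr1; apply: ler_pM => //.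
  rewrite ger0_norm ?divr_ge0 //.
  have [->|zn] := eqVneq (sqnorm z) 0; first by rewrite invr0 mulr0.
  by rewrite ler_pdivrMr ?mul1r // lt_neqAle eq_sym zn.
- by move=> z rz; rewrite phi0 // psi0 // !mulr0 subr0.
Qed.

Lemma radial_weak : dist_eq_mlap (fun z => v (sqnorm z)) (fun z => h (sqnorm z)).
Proof.
move=> phi /test_lines [r [px [pxx [py [pyy [r0 phi0 [cphi lap [cxx dx1 dx2] [cyy dy1 dy2]]]]]]]].
pose fx z := v (sqnorm z) * pxx z - hess (z.1 ^+ 2) (sqnorm z) * phi z.
pose fy z := v (sqnorm z) * pyy z - hess (z.2 ^+ 2) (sqnorm z) * phi z.
have phi1 z : r < sqnorm z -> phi z = 0 by move=> h1; apply: phi0; exact: ltW.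
have outx (f g : R * R -> R) : (forall x y, der (fun t => f (t, y)) x (g (x, y))) ->
    (forall z, r < sqnorm z -> f z = 0) -> forall z, r < sqnorm z -> g z = 0.
  move=> df f0 [x y] rz.
  have d0 : der (fun=> 0 : R) x (g (x, y)).
    apply: der_near (df x y); near=> t; apply: f0; near: t.
    have := @der_cont R _ _ _ (der_sqnorm1 y x) _ (lt_nbhsr rz).
    exact.
  by have [_ <-] := d0; exact: derive_cst.
have outy (f g : R * R -> R) : (forall x y, der (fun t => f (x, t)) y (g (x, y))) ->
    (forall z, r < sqnorm z -> f z = 0) -> forall z, r < sqnorm z -> g z = 0.
  move=> df f0 [x y] rz.
  have d0 : der (fun=> 0 : R) y (g (x, y)).
    apply: der_near (df x y); near=> t; apply: f0; near: t.
    have := @der_cont R _ _ _ (der_sqnorm2 y x) _ (lt_nbhsr rz).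
    exact.
  by have [_ <-] := d0; exact: derive_cst.
have pxx0 := outx px pxx dx2 (outx phi px dx1 phi1).
have pyy0 := outy py pyy dy2 (outy phi py dy1 phi1).
have Lx : L1 fx.
  apply: (L1_dir r0 cphi cxx phi1 pxx0); first exact: (measurable_funX 2 (measurable_fst)).
  by move=> z; rewrite sqr_ge0 /sqnorm lerDl sqr_ge0.
have Ly : L1 fy.
  apply: (L1_dir r0 cphi cyy phi1 pyy0); first exact: (measurable_funX 2 (measurable_snd)).
  by move=> z; rewrite sqr_ge0 /sqnorm lerDr sqr_ge0.
have big (x y : R) : r + 1 < `|x| -> r <= x ^+ 2 + y ^+ 2.
  move=> hx; have := sqr_ge0 y.
  have : (r + 1) ^+ 2 <= x ^+ 2 by rewrite -(real_normK (num_real x)) lerXn2r ?nnegrE; lra.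
  by have := r0; nra.
have r1 : 0 < r + 1 by have := r0; lra.
have Ix : (\int[@leb2 R]_z (fx z)%:E = 0)%E.
  apply: plane_integral0_1 => // y y0.
  apply: (@line_weak y (r + 1) (fun x => phi (x, y)) (fun x => px (x, y)) (fun x => pxx (x, y))) => //.
    move=> x; apply: (@continuous_comp _ _ _ (fun t : R => (t, y)) pxx); last exact: cxx.
    exact: (@cvg_pair _ _ _ _ _ _ _ _ _ (fun t : R => t) (fun=> y) (@cvg_id _ (nbhs x)) (@cvg_cst _ y _ _ _)).
  by move=> x hx; apply: phi0; exact: big.
have Iy : (\int[@leb2 R]_z (fy z)%:E = 0)%E.
  apply: plane_integral0_2 => // x x0.
  have := @line_weak x (r + 1) (fun y => phi (x, y)) (fun y => py (x, y)) (fun y => pyy (x, y)) x0 r1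
    (dy1 x) (dy2 x).
  under eq_integral do rewrite [_ + x ^+ 2]addrC; apply.
    move=> y; apply: (@continuous_comp _ _ _ (fun t : R => (x, t)) pyy); last exact: cyy.
    exact: (@cvg_pair _ _ _ _ _ _ _ _ _ (fun=> x) (fun t : R => t) (@cvg_cst _ x _ _ _) (@cvg_id _ (nbhs y))).
  by move=> y hy; apply: phi0; rewrite /sqnorm /= addrC; exact: big.
have Lh : L1 (fun z => h (sqnorm z) * phi z).
  have [B B0 hB] := continuous_bounded_disc r cphi.
  have [H H0 hH] := continuous_bounded_itv (ltW r0) ch.
  apply: (@L1_bounded_support _ _ r (H * B)).
  - apply: measurable_funM; last exact: continuous_measurable_plane.
    by apply: measurable_comp_sqnorm; exact: continuous_measurable_fun.
  - move=> z zr; rewrite normrM; apply: ler_pM => //; last exact: hB.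
    by apply: hH; rewrite sqnorm_ge0.
  - by move=> z rz; rewrite phi1 // mulr0.
have e : (fun z => v (sqnorm z) * laplacian phi z) = (fun z => fx z + fy z - h (sqnorm z) * phi z).
  (* The two values of [hess] add up to -h: away from 0 because x^2 + y^2 = s, at the origin because
     m 0 = h 0. *)
  apply/funext => z; rewrite lap /fx /fy /hess; have [z0|zn] := eqVneq (sqnorm z) 0.
    have := sqr_ge0 z.1; have := sqr_ge0 z.2; move: z0; rewrite /sqnorm => z0 a1 a2.
    have -> : z.1 ^+ 2 = 0 by lra.
    have -> : z.2 ^+ 2 = 0 by lra.
    by rewrite addr0 /m /mean eqxx; lra.
  have -> : z.2 ^+ 2 = sqnorm z - z.1 ^+ 2 by rewrite /sqnorm; ring.
  by field.
have Rx : Rintegral (@leb2 R) setT fx = 0 by rewrite /Rintegral Ix.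
have Ry : Rintegral (@leb2 R) setT fy = 0 by rewrite /Rintegral Iy.
have Ls : L1 (fun z => fx z + fy z).
  rewrite /L1 (_ : EFin \o _ = (EFin \o fx) \+ (EFin \o fy)); last by apply/funext.
  exact: integrableD.
rewrite e RintegralB //.
by rewrite RintegralD // Rx Ry addr0 sub0r opprK.
Unshelve. all: by end_near. Qed.

End RadialWeak.

(** * Integrability and flux of the constructed solutions *)

Section FluxOfPrimitive.
Variable R : realType.
Local Notation leb := (@lebesgue_measure R).

Lemma cvg_of_exp2_pinfty (f : R -> R) (l : R) :
  f (expR (2 * t)) @[t --> +oo] --> l -> f s @[s --> +oo] --> l.
Proof.
move=> cf; apply/cvgrPdist_lt => e e0.
have /cvgrPdist_lt /(_ e e0) [M [Mr hM]] := cf.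
exists (expR (2 * M)); split; first exact: num_real.
move=> s sM; have s0 : 0 < s := lt_trans (expR_gt0 _) sM.
have -> : s = expR (2 * (ln s / 2)) by rewrite mulrC divfK ?pnatr_eq0 // lnK.
apply: hM; rewrite ltr_pdivlMr // mulrC -(@expRK R (2 * M)).
by rewrite ltr_ln ?posrE ?expR_gt0.
Qed.

(** Integrability is a conclusion: for a nonnegative source the finite limit of the primitive is its
    integral over the half-line. *)
Lemma flux_of_prim (F : R -> R) (b : R) : continuous F -> (forall s, 0 <= s -> 0 <= F s) ->
  2^-1 * prim F (expR (2 * t)) @[t --> +oo] --> b ->
  L1 (fun z => F (sqnorm z)) /\ b = (2 * pi)^-1 * Rintegral (@leb2 R) setT (fun z => F (sqnorm z)).
Proof.
move=> cF F0 cb.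
have cp : prim F s @[s --> +oo] --> 2 * b.
  have -> : prim F = (fun s => 2 * (2^-1 * prim F s)) by apply/funext => s; field.
  apply: cvgMr; exact: (cvg_of_exp2_pinfty (f := fun s => 2^-1 * prim F s)).
have mF : measurable_fun setT F by exact: continuous_measurable_fun.
have e : (\int[leb]_(s in `[0%R, +oo[) (F s)%:E = (2 * b)%:E)%E.
  rewrite (@ge0_continuous_FTC2y R F (prim F) 0 (2 * b)) //.
  - by rewrite prim0 // sube0.
  - exact: continuous_subspaceT.
  - by move=> x _; have [] := der_prim x cF.
  - by apply: cvg_at_right_filter; exact: der_cont (der_prim 0 cF).
  - by move=> x _; rewrite derive1E; have [_] := der_prim x cF.
have iF : leb.-integrable `[0, +oo[ (EFin \o F).
  apply/integrableP; split; first by apply/measurable_EFinP; exact: measurable_funTS.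
  suff -> : (\int[leb]_(s in `[0%R, +oo[) `|(EFin \o F) s| = (2 * b)%:E)%E by rewrite ltry.
  rewrite -e; apply: eq_integral => s; rewrite inE /= in_itv /= andbT => s0.
  by rewrite ger0_norm // F0.
split; first exact/(polar_integrable mF).
rewrite polar_Rintegral // /Rintegral e /= invfM -mulrA mulKf; last by rewrite gt_eqF // pi_gt0.
by rewrite mulKf.
Qed.

Lemma L1loc_radial (F : R -> R) : continuous F -> L1loc (fun z => F (sqnorm z)).
Proof.
move=> cF r r0; have r2 : 0 <= r ^+ 2 by exact: sqr_ge0.
have [M M0 hM] := continuous_bounded_itv r2 cF.
have mD : measurable [set z : R * R | sqnorm z < r ^+ 2].
  rewrite -[X in measurable X]setTI.
  exact: (measurable_sqnorm measurableT (measurable_itv `]-oo, _[)).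
apply: measurable_bounded_integrable => //.
- have fin : (@leb2 R [set z | (sqnorm z < r ^+ 2)%R] < +oo)%E by rewrite disc_measure ltry.
  exact: fin.
- by apply: measurable_funTS; apply: measurable_comp_sqnorm; exact: continuous_measurable_fun.
- exists M; split; first exact: num_real.
  move=> x Mx z /= hz; apply: (le_trans (hM _ _)); last exact: ltW.
  by rewrite sqnorm_ge0 ltW.
Qed.

End FluxOfPrimitive.

Lemma sufficiency (R : realType) (N tau b1 b2 : R) (c : R * R) (w : (R -> R) * (R -> R)) :
  0 < N -> 0 < tau -> tau < 1 -> fixed N 0 tau c w -> c.1 <= 0 -> c.2 <= 0 ->
  mass1 N 0 tau w (expR (2 * t)) @[t --> +oo] --> b1 ->
  mass2 N 0 tau w (expR (2 * t)) @[t --> +oo] --> b2 ->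
  exists v1 v2 : R * R -> R, radial v1 /\ radial v2 /\ solves_P N tau v1 v2 b1 b2.
Proof.
move=> N0 t0 t1 Hw c1 c2 m1 m2.
have cw1 : continuous w.1 by exact: Hw.1.1.
have cw2 : continuous w.2 by exact: Hw.1.2.
pose h1 s := nl1 N 0 tau s (w.1 s); pose h2 s := nl2 N 0 tau s (w.2 s).
have ch1 : continuous h1.
  by move=> s; apply: cvgM; [apply: continuous_pw; exact: ltW|exact: continuous_trunc_exp].
have ch2 : continuous h2.
  by move=> s; apply: cvgM; [exact: continuous_pw|exact: continuous_trunc_exp].
have cs1 : continuous (fun s => h1 s - tau * h2 s).
  by move=> s; apply: cvgB; [exact: ch1|apply: cvgMr; exact: ch2].
have cs2 : continuous (fun s => h2 s - tau * h1 s).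
  by move=> s; apply: cvgB; [exact: ch2|apply: cvgMr; exact: ch1].
have cap z := fixed_lt_cap (ltW N0) (lexx 0) t0 t1 Hw c1 c2 (sqnorm_ge0 z).
have e1 z : weight N z * expR (w.1 (sqnorm z)) = h1 (sqnorm z).
  rewrite /h1 /nl1 trunc_expE; last by have [/ltW] := cap z.
  by rewrite pwE // sqnorm_ge0.
have e2 z : expR (w.2 (sqnorm z)) = h2 (sqnorm z).
  rewrite /h2 /nl2 trunc_expE; last by have [_ /ltW] := cap z.
  by rewrite /pw powRr0 mul1r.
have [i1 f1] := flux_of_prim ch1 (fun s _ => mulr_ge0 (pw_ge0 _ _) (expR_ge0 _)) m1.
have [i2 f2] := flux_of_prim ch2 (fun s _ => mulr_ge0 (pw_ge0 _ _) (expR_ge0 _)) m2.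
exists (fun z => w.1 (sqnorm z)), (fun z => w.2 (sqnorm z)).
split; first by move=> x y ->.
split; first by move=> x y ->.
have E1 : (fun x => weight N x * expR (w.1 (sqnorm x))) = (fun z => h1 (sqnorm z)) by apply/funext.
have E2 : (fun x : R * R => expR (w.2 (sqnorm x))) = (fun z => h2 (sqnorm z)) by apply/funext.
have G1 : (fun x => weight N x * expR (w.1 (sqnorm x)) - tau * expR (w.2 (sqnorm x))) =
    (fun z => (fun s => h1 s - tau * h2 s) (sqnorm z)) by apply/funext => z; rewrite e1 e2.
have G2 : (fun x => expR (w.2 (sqnorm x)) - tau * (weight N x * expR (w.1 (sqnorm x)))) =
    (fun z => (fun s => h2 s - tau * h1 s) (sqnorm z)) by apply/funext => z; rewrite e1 e2.
have P1 : (fun x : R * R => w.1 (sqnorm x)) =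
    (fun z => picard c.1 (fun s => h1 s - tau * h2 s) (sqnorm z)).
  by apply/funext => z; exact: Hw.2.1.
have P2 : (fun x : R * R => w.2 (sqnorm x)) =
    (fun z => picard c.2 (fun s => h2 s - tau * h1 s) (sqnorm z)).
  by apply/funext => z; exact: Hw.2.2.
have D1 : dist_eq_mlap (fun x => w.1 (sqnorm x))
    (fun x => weight N x * expR (w.1 (sqnorm x)) - tau * expR (w.2 (sqnorm x))).
  rewrite G1 P1; exact: (@radial_weak R c.1 _ cs1).
have D2 : dist_eq_mlap (fun x => w.2 (sqnorm x))
    (fun x => expR (w.2 (sqnorm x)) - tau * (weight N x * expR (w.1 (sqnorm x)))).
  rewrite G2 P2; exact: (@radial_weak R c.2 _ cs2).
refine (conj (L1loc_radial cw1) (conj (L1loc_radial cw2) (conj _ (conj _ (conj D1 (conj D2 (conj _ _))))))).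
- by rewrite E1.
- by rewrite E2.
- by rewrite E1.
- by rewrite E2.
Qed.

(* [tau <= tau0 N] says that tau times the square root is at most 1 - tau (N + 1); square it. *)
Lemma tau0_bound (R : realType) (N tau : R) : 0 < N -> 0 < tau -> tau <= tau0 N ->
  4 * tau ^+ 2 + 2 * (N + 1) * tau <= 1.
Proof.
move=> N0 t0; rewrite /tau0; set q := Num.sqrt _ => tq.
have q0 : 0 <= q by exact: sqrtr_ge0.
have qq : q ^+ 2 = (N + 1) ^+ 2 + 4 by rewrite sqr_sqrtr //; nra.
have d0 : 0 < N + 1 + q by lra.
have : tau * (N + 1 + q) <= 1.
  have : tau * (N + 1 + q) <= (N + 1 + q)^-1 * (N + 1 + q) by rewrite ler_pM2r.
  by rewrite mulVf // gt_eqF.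
move=> h.
have h1 : tau * q <= 1 - tau * (N + 1) by lra.
have tq0 : 0 <= tau * q by rewrite mulr_ge0 // ltW.
have h2 : (tau * q) ^+ 2 <= (1 - tau * (N + 1)) ^+ 2.
  by rewrite lerXn2r ?nnegrE //; lra.
move: h2; rewrite exprMn qq !expr2; nra.
Qed.

Theorem mainTheorem1 (R : realType) (N tau b1 b2 : R) :
  0 < N -> 0 < tau -> tau <= tau0 N ->
  ((exists v1 v2 : R * R -> R,
       radial v1 /\ radial v2 /\ solves_P N tau v1 v2 b1 b2) <->
   [/\ b1 ^+ 2 + b2 ^+ 2 - 2 * tau * b1 * b2 - 4 * (N + 1) * b1 - 4 * b2 = 0,
       4 * (N + 1) < b1 & 4 < b2]).
Proof.
move=> N0 t0 /(tau0_bound N0 t0) tb.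
have t1 : tau < 1 by nra.
split=> [[v1 [v2 [r1 [r2 sol]]]]|[cb l1 l2]].
  have [e l1 l2] := necessity N0 t0 r1 r2 sol.
  by split => //; move: e; rewrite /pohozaev !expr2; nra.
(* [C2] is [tb] doubled, the sharp condition; [C1] is [tb] times 2 (N + 1), weakened by (N + 1)^2 >=
   1. *)
have C1 : 4 * (2 * (N + 1)) * tau ^+ 2 + 2 * (2 * (0 + 1)) * tau <= 2 * (N + 1).
  move: tb; rewrite !expr2; nra.
have C2 : 4 * (2 * (0 + 1)) * tau ^+ 2 + 2 * (2 * (N + 1)) * tau <= 2 * (0 + 1).
  by move: tb; rewrite !expr2; nra.
have cb' : pohozaev (2 * (N + 1)) (2 * (0 + 1)) tau b1 b2 = 0.
  by move: cb; rewrite /pohozaev !expr2; lra.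
have k1 : 2 * (2 * (N + 1)) < b1 by lra.
have k2 : 2 * (2 * (0 + 1)) < b2 by lra.
have [c [w [Hw c1 c2 m1 m2]]] := shooting (ltW N0) (lexx 0) t0 t1 C1 C2 cb' k1 k2.
exact: (sufficiency N0 t0 t1 Hw c1 c2 m1 m2).
Qed.
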